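(* There is a polynomial-time algorithm that, given a point $a\in\mathcal X\cap\mathbb Q^d$ and $\epsilon\in\mathbb Q_{>0}$, either 1. ascertains that $a$ is an $\epsilon$-SVI solution to $\mathrm{VI}(\mathcal X,F)$, or 2. returns $c\in\mathbb Q^d$, with $\|c\|_\infty=1$, such that $\langle c,x\rangle\le\langle c,a\rangle-\gamma$ for every MVI solution $x\in\mathcal X$ of $\mathrm{VI}(\mathcal X,F)$, where $\gamma=\epsilon^2\cdot\mathrm{poly}(R^{-1},L^{-1},B^{-1})$.
   Context: $\|\cdot\|$ is the Euclidean norm. $\mathcal X\subseteq\mathbb R^d$ is convex and compact with $\mathcal B_1(0)\subseteq\mathcal X\subseteq\mathcal B_R(0)$, $R\le\mathrm{poly}(d)$ (isotropic position), where $\mathcal B_r(0)$ is the closed Euclidean ball of radius $r$. It is accessed through a separation oracle: given $x\in\mathbb Q^d$, the oracle either asserts $x\in\mathcal X$ or returns $c\in\mathbb Q^d$ with $\|c\|_\infty=1$ and $\langle c,x'\rangle<\langle c,x\rangle$ for every $x'\in\mathcal X$ (equivalently, up to polynomial time, a linear optimization oracle). $F:\mathcal X\to\mathbb R^d$ satisfies: (i) for every $x\in\mathcal X\cap\mathbb Q^d$, $F(x)$ is rational, can be evaluated exactly in $\mathrm{poly}(d)$ time, and has bit length polynomial in that of $x$; (ii) $F$ is $L$-Lipschitz continuous, $L\in\mathbb Q_{>0}$; (iii) $\|F(x)\|\le B$ on $\mathcal X$, $B\in\mathbb Q_{>0}$. The parameters $L,B$ are given to the algorithm. An $\epsilon$-SVI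 solution is $x\in\mathcal X$ with $\langle F(x),x'-x\rangle\ge-\epsilon$ for all $x'\in\mathcal X$. An MVI solution is $x\in\mathcal X$ with $\langle F(x'),x'-x\rangle\ge0$ for all $x'\in\mathcal X$. ''$\gamma=\epsilon^2\cdot\mathrm{poly}(R^{-1},L^{-1},B^{-1})$'' means that $\gamma\ge\epsilon^2/q(R,L,B)$ for a fixed polynomial $q$ with positive coefficients. ''Polynomial time'' is in $d$, the bit lengths of $a,\epsilon,L,B$, and oracle calls. *)

(* Defs.v *)
From HB Require Import structures.
From mathcomp Require Import all_boot all_order all_algebra.
From mathcomp Require Import all_classical all_reals all_analysis.
From mathcomp Require Import -(notations) mpoly.
Set Implicit Arguments.
Unset Strict Implicit.
Unset Printing Implicit Defensive.
Import Order.TTheory GRing.Theory Num.Theory.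
Import numFieldNormedType.Exports.
Local Open Scope ring_scope.

Definition dotv (K : pzRingType) (d : nat) (u v : 'rV[K]_d) : K :=
  \sum_(i < d) u 0 i * v 0 i.

(* The norm that the library puts on 'rV[R]_d is the sup norm, so the
   Euclidean norm is defined here; both induce the topology of 'rV[R]_d. *)
Definition enorm (R : rcfType) (d : nat) (u : 'rV[R]_d) : R :=
  Num.sqrt (dotv u u).

Definition supnorm (K : realDomainType) (d : nat) (u : 'rV[K]_d) : K :=
  \big[Num.max/0]_(i < d) `|u 0 i|.

Definition eball (R : realType) (d : nat) (r : R) : set 'rV[R]_d :=
  [set x | enorm x <= r]%classic.

Definition ratv (R : realType) (d : nat) (x : 'rV[rat]_d) : 'rV[R]_d :=
  map_mx ratr x.
Arguments ratv R {d} x.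

Definition eps_svi (R : realType) (d : nat) (X : set 'rV[R]_d)
    (F : 'rV[R]_d -> 'rV[R]_d) (eps : R) (x : 'rV[R]_d) : Prop :=
  X x /\ forall x', X x' -> - eps <= dotv (F x) (x' - x).

Definition mvi (R : realType) (d : nat) (X : set 'rV[R]_d)
    (F : 'rV[R]_d -> 'rV[R]_d) (x : 'rV[R]_d) : Prop :=
  X x /\ forall x', X x' -> 0 <= dotv (F x') (x' - x).

(* Maps are total on 'rV[R]_d; only their values on X are constrained. *)
Definition elipschitz (R : realType) (d : nat) (X : set 'rV[R]_d)
    (F : 'rV[R]_d -> 'rV[R]_d) (L : R) : Prop :=
  forall x y, X x -> X y -> enorm (F x - F y) <= L * enorm (x - y).

Definition ebounded (R : realType) (d : nat) (X : set 'rV[R]_d)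
    (F : 'rV[R]_d -> 'rV[R]_d) (B : R) : Prop :=
  forall x, X x -> enorm (F x) <= B.

Definition nbits (n : nat) : nat := up_log 2 n.+1.

Definition qbits (q : rat) : nat := (nbits `|numq q| + nbits `|denq q| + 1)%N.

Definition vbits (d : nat) (x : 'rV[rat]_d) : nat :=
  (\sum_(i < d) qbits (x 0%R i))%N.

(* [sep x = None] asserts membership; [ftime x] is the time taken by one
   evaluation of the map at [x]. *)
Record oracles (d : nat) := Oracles {
  sep : 'rV[rat]_d -> option 'rV[rat]_d;
  feval : 'rV[rat]_d -> 'rV[rat]_d;
  ftime : 'rV[rat]_d -> nat
}.

Definition separates (R : realType) (d : nat) (X : set 'rV[R]_d)
    (O : oracles d) : Prop :=
  forall x, match sep O x with
            | None => X (ratv R x)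
            | Some c => supnorm c = 1 /\
                forall x', X x' -> dotv (ratv R c) x' < dotv (ratv R c) (ratv R x)
            end.

(* As usual for polynomial-time oracle algorithms, an answer of the separation
   oracle has bit length polynomial in that of the query. *)
Definition sep_bits (d : nat) (O : oracles d) (p : {poly nat}) : Prop :=
  forall x c, sep O x = Some c -> (vbits c <= p.[vbits x])%N.

Definition evaluates (R : realType) (d : nat) (X : set 'rV[R]_d)
    (F : 'rV[R]_d -> 'rV[R]_d) (O : oracles d) : Prop :=
  forall x, X (ratv R x) -> F (ratv R x) = ratv R (feval O x).

Definition feval_bits (R : realType) (d : nat) (X : set 'rV[R]_d)
    (O : oracles d) (p : {poly nat}) : Prop :=
  forall x, X (ratv R x) -> (vbits (feval O x) <= p.[vbits x])%N.

Definition feval_time (R : realType) (d : nat) (X : set 'rV[R]_d)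
    (O : oracles d) (p : {poly nat}) : Prop :=
  forall x, X (ratv R x) -> (ftime O x <= p.[d + vbits x])%N.

(* Algorithms are while programs over rational registers and rational arrays,
   run with logarithmic cost: every operation is charged the bit length of the
   number it produces.  A run of cost t therefore only handles numbers of bit
   length at most t, and this running time agrees with that of oracle Turing
   machines up to a polynomial.  A program is a finite syntactic object, fixed
   before the dimension, the set, the map and the inputs. *)

Inductive binop := Add | Sub | Mul | Div | Leq.

Inductive expr :=
| Cst of rat
| Reg of nat
| Cell of nat & expr
| Bin of binop & expr & expr
| Floor of expr.

Inductive cmd :=
| Skip
| Assign of nat & expr
| Store of nat & expr & expr
| Seq of cmd & cmd
| If of expr & cmd & cmd
| While of expr & cmd
| CallSep of nat & nat & nat
| CallF of nat & nat.

Record state := State {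
  reg : nat -> rat;
  mem : nat -> nat -> rat
}.

Definition upd (T : Type) (f : nat -> T) (i : nat) (v : T) : nat -> T :=
  fun j => if j == i then v else f j.

Definition set_reg (s : state) (r : nat) (v : rat) : state :=
  State (upd (reg s) r v) (mem s).

Definition set_cell (s : state) (A i : nat) (v : rat) : state :=
  State (reg s) (upd (mem s) A (upd (mem s A) i v)).

Definition array_of (d : nat) (x : 'rV[rat]_d) : nat -> rat :=
  fun i => oapp (fun j : 'I_d => x 0 j) 0 (insub i).

Definition set_array (d : nat) (s : state) (A : nat) (x : 'rV[rat]_d) : state :=
  State (reg s) (upd (mem s) A (array_of x)).

Definition get_array (d : nat) (s : state) (A : nat) : 'rV[rat]_d :=
  \row_(i < d) mem s A i.
Arguments get_array d s A : clear implicits.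

Definition eval_binop (o : binop) (x y : rat) : rat :=
  match o with
  | Add => x + y
  | Sub => x - y
  | Mul => x * y
  | Div => x / y
  | Leq => if x <= y then 1 else 0
  end.

(* Division by zero yields 0, and a cell index is truncated to a natural
   number, negative values giving 0. *)
Fixpoint eval (s : state) (e : expr) : rat :=
  match e with
  | Cst q => q
  | Reg r => reg s r
  | Cell A e1 => mem s A (Num.truncn (eval s e1))
  | Bin o e1 e2 => eval_binop o (eval s e1) (eval s e2)
  | Floor e1 => (Num.floor (eval s e1))%:~R
  end.

Fixpoint ecost (s : state) (e : expr) : nat :=
  (qbits (eval s e) +
   match e with
   | Cst _ | Reg _ => 0
   | Cell _ e1 | Floor e1 => ecost s e1
   | Bin _ e1 e2 => ecost s e1 + ecost s e2
   end)%N.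

(* [exec O c s s' t]: started in state s, the program c halts in state s'
   after time t. *)
Inductive exec (d : nat) (O : oracles d) : cmd -> state -> state -> nat -> Prop :=
| ExSkip s : exec O Skip s s 1
| ExAssign r e s :
    exec O (Assign r e) s (set_reg s r (eval s e)) (ecost s e)
| ExStore A i e s :
    exec O (Store A i e) s (set_cell s A (Num.truncn (eval s i)) (eval s e))
      (ecost s i + ecost s e)
| ExSeq c1 c2 s1 s2 s3 t1 t2 :
    exec O c1 s1 s2 t1 -> exec O c2 s2 s3 t2 ->
    exec O (Seq c1 c2) s1 s3 (t1 + t2)
| ExIfTrue e c1 c2 s s' t :
    eval s e != 0 -> exec O c1 s s' t ->
    exec O (If e c1 c2) s s' (ecost s e + t)
| ExIfFalse e c1 c2 s s' t :
    eval s e = 0 -> exec O c2 s s' t ->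
    exec O (If e c1 c2) s s' (ecost s e + t)
| ExWhileTrue e c s1 s2 s3 t1 t2 :
    eval s1 e != 0 -> exec O c s1 s2 t1 -> exec O (While e c) s2 s3 t2 ->
    exec O (While e c) s1 s3 (ecost s1 e + t1 + t2)
| ExWhileFalse e c s :
    eval s e = 0 -> exec O (While e c) s s (ecost s e)
| ExSepIn A r C s :
    sep O (get_array d s A) = None ->
    exec O (CallSep A r C) s (set_reg s r 0) (1 + vbits (get_array d s A))
| ExSepOut A r C s c :
    sep O (get_array d s A) = Some c ->
    exec O (CallSep A r C) s (set_array (set_reg s r 1) C c)
      (1 + vbits (get_array d s A) + vbits c)
| ExF A C s :
    exec O (CallF A C) s (set_array s C (feval O (get_array d s A)))
      (1 + vbits (get_array d s A) + ftime O (get_array d s A)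
         + vbits (feval O (get_array d s A))).

(* Programs are deterministic, so the run exhibited by a statement of the form
   "exists s' t, exec O c s s' t" is the only one. *)
Lemma exec_det (d : nat) (O : oracles d) (c : cmd) (s s1 s2 : state)
    (t1 t2 : nat) :
  exec O c s s1 t1 -> exec O c s s2 t2 -> s1 = s2 /\ t1 = t2.
Proof.
move=> E; elim: E s2 t2 => {c s s1 t1}.
- by move=> s s2 t2 E; inversion E.
- by move=> r e s s2 t2 E; inversion E.
- by move=> A i e s s2 t2 E; inversion E.
- move=> c1 c2 s1 s2 s3 t1 t2 _ I1 _ I2 s' t' E; inversion E; subst.
  match goal with H : exec O c1 _ _ _ |- _ => have [? ?] := I1 _ _ H end; subst.
  by match goal with H : exec O c2 _ _ _ |- _ => have [-> ->] := I2 _ _ H end.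
- move=> e c1 c2 s s' t N _ I s2 t2 E; inversion E; subst.
    by match goal with H : exec O _ _ _ _ |- _ => have [-> ->] := I _ _ H end.
  by match goal with H : eval s e = 0 |- _ => rewrite H eqxx in N end.
- move=> e c1 c2 s s' t N _ I s2 t2 E; inversion E; subst.
    by match goal with H : is_true (_ != 0) |- _ => rewrite N eqxx in H end.
  by match goal with H : exec O _ _ _ _ |- _ => have [-> ->] := I _ _ H end.
- move=> e c s1 s2 s3 t1 t2 N _ I1 _ I2 s' t' E; inversion E; subst; last first.
    by match goal with H : eval _ e = 0 |- _ => rewrite H eqxx in N end.
  match goal with H : exec O c _ _ _ |- _ => have [? ?] := I1 _ _ H end; subst.
  by match goal with H : exec O (While e c) _ _ _ |- _ =>
    have [-> ->] := I2 _ _ H end.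
- move=> e c s N s' t' E; inversion E; subst => //.
  by match goal with H : is_true (_ != 0) |- _ => rewrite N eqxx in H end.
- by move=> A r C s N s' t' E; inversion E; subst => //; congruence.
- move=> A r C s c N s' t' E; inversion E; subst; first congruence.
  by match goal with H : sep O _ = Some ?x |- _ =>
    have -> : c = x by congruence end.
- by move=> A C s s' t' E; inversion E.
Qed.

Definition init_state (d : nat) (a : 'rV[rat]_d) (eps L B : rat) : state :=
  State (nth 0 [:: d%:R; eps; L; B]) (upd (fun _ _ => 0) 0%N (array_of a)).

Definition input_bits (d : nat) (a : 'rV[rat]_d) (eps L B : rat) : nat :=
  (d + vbits a + qbits eps + qbits L + qbits B)%N.

Inductive verdict (d : nat) :=
| SolvesSVI
| Cut of 'rV[rat]_d.
Arguments SolvesSVI {d}.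

Definition output (d : nat) (s : state) : verdict d :=
  if reg s 0%N == 0 then SolvesSVI else Cut (get_array d s 0%N).

(* The zero polynomial is excluded: it would make [eps ^+ 2 / q(R, L, B)]
   equal to 0. *)
Definition pos_mpoly (R : realType) (n : nat) (q : mpoly n R) : Prop :=
  q != 0 /\ forall m, m \in msupp q -> 0 < mcoeff m q.

Definition eval3 (R : realType) (q : mpoly 3 R) (x y z : R) : R :=
  meval (tnth [tuple x; y; z]) q.

(* Main.v *)
Require Import Defs.
From HB Require Import structures.
From mathcomp Require Import all_boot all_order all_algebra.
From mathcomp Require Import fingroup perm.
From mathcomp Require Import all_classical all_reals all_analysis.
From mathcomp Require Import -(notations) mpoly.
From mathcomp Require Import zify ring lra.
Set Implicit Arguments.
Unset Strict Implicit.
Unset Printing Implicit Defensive.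
Import Order.TTheory GRing.Theory Num.Theory.
Import numFieldNormedType.Exports.
Local Open Scope classical_set_scope.
Local Open Scope ring_scope.

(* Idea. Write f = F(a). If some z in X satisfies <f, z - a> < - eps / 2, then a
   short step b = a + lam (z - a) keeps <F(b), z - a> <= - eps / 4 by the Lipschitz
   condition, and every MVI solution x satisfies <F(b), x> <= <F(b), b>, so that F(b),
   normalized, is the required cut.

   Such a point z is searched for with the simplex variant of the ellipsoid method
   (Yamnitsky and Levin), which needs neither square roots nor volumes. The points
   searched for stay inside a simplex with rational vertices; its centroid is either
   what we look for or is cut off, by the separation oracle or by f. The remaining
   part of the simplex lies in a simplex that keeps one vertex and whose other vertices
   are moved along the edges to it, and whose determinant is smaller by the factor
   1 + 1 / (12 n^2), where n = d + 1. Rounding the contraction factors up to multiples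
   of 1 / (64 n^3) only enlarges the new simplex, and it makes the bit lengths of the
   vertices grow by O(log n) bits per step.

   If the search fails and some x in X had <f, x - a> < - eps, then X, containing the
   unit ball, would contain a simplex of determinant t^d, with t polynomial in the data,
   all of whose vertices are searched-for points. Its matrix is a stochastic matrix times
   the matrix of the last simplex, and stochastic matrices have determinant at most 1
   in absolute value: a contradiction. *)

(** * Heights of rational numbers *)

(** The failure of the search is conclusive because of the gap between the tested threshold
    [eps / 2] and the promised [eps]: a violation by more than [eps] at one point makes a whole
    simplex of known size improving. The localization is claimed only if improving points exist.
    Without them the simplices carry no information, but their sizes and the running time must be
    controlled all the same, so localization and size are separate invariants. The main obstacle is
    the logarithmic cost. Bounding heights operation by operation enlarges the bound polynomially in
    each round, which would compound over the rounds. Such bounds are used inside one round only;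
    across rounds the vertices keep the common denominator [K ^ k] with [K = 64 n ^ 3], which is
    what the rounding is for. The radius is not an input of the program. The polynomial bounding it
    is built into the program, and its value [rho] at [d] replaces the radius there, whereas the gap
    of the cut is stated with the true radius. *)

Lemma nbits_le n k : (nbits n <= k)%N = (n < 2 ^ k)%N.
Proof.
apply/idP/idP => [h|]; last exact: up_log_min.
apply: (leq_trans (up_logP n.+1 (isT : 1 < 2)%N)).
by rewrite leq_exp2l.
Qed.

(** Equivalent to [qbits] up to constants, but under each operation of the language it grows at most
    to the sum of the heights plus 1. *)
Definition height (q : rat) : nat := maxn (nbits `|numq q|) (nbits `|denq q|).

Lemma height_le q k :
  (height q <= k)%N = (`|numq q| < 2 ^ k)%N && (`|denq q| < 2 ^ k)%N.
Proof. by rewrite /height geq_max !nbits_le. Qed.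

(** The reduced numerator divides [x] and the reduced denominator divides [y], so any representation
    as a quotient bounds the height. The value 0 at [y = 0] satisfies the bound too. *)
Lemma height_div (x y : int) k :
  (`|x| < 2 ^ k)%N -> (`|y| < 2 ^ k)%N -> (0 < k)%N ->
  (height (x%:Q / y%:Q) <= k)%N.
Proof.
move=> hx hy k0.
have hk : (1 < 2 ^ k)%N by rewrite -(expn0 2) ltn_exp2l.
have [->|x0] := eqVneq x 0; first by rewrite mul0r height_le /= hk expn_gt0.
have [->|y0] := eqVneq y 0.
  by rewrite invr0 mulr0 height_le /= hk expn_gt0.
rewrite height_le; set q := _ / _.
have e : x * denq q = numq q * y.
  apply: (@intr_inj rat); rewrite !rmorphM /=.
  have := divq_num_den q; rewrite {3}/q => h.
  have d0 : (denq q)%:~R != 0 :> rat by rewrite intr_eq0 denq_neq0.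
  have yy0 : y%:~R != 0 :> rat by rewrite intr_eq0.
  have := congr1 (fun z => z * (denq q)%:~R * y%:~R) h.
  by rewrite mulfVK // [in RHS]mulrAC divfK // => ->.
have e' : (`|x| * `|denq q| = `|numq q| * `|y|)%N by rewrite -!abszM e.
have c := coprime_num_den q.
have dn : (`|numq q| %| `|x|)%N.
  by rewrite -(Gauss_dvdl _ c) e' dvdn_mulr.
have dd : (`|denq q| %| `|y|)%N.
  by rewrite coprime_sym in c; rewrite -(Gauss_dvdr _ c) -e' dvdn_mull.
rewrite (leq_ltn_trans (dvdn_leq _ dn) hx) ?absz_gt0 //=.
by rewrite (leq_ltn_trans (dvdn_leq _ dd) hy) ?absz_gt0.
Qed.

Lemma height_gt0 q : (0 < height q)%N.
Proof.
rewrite ltnNge height_le expn0 negb_and -!leqNgt.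
by rewrite orbC absz_gt0 denq_neq0.
Qed.

Lemma height_num q : (`|numq q| < 2 ^ height q)%N.
Proof. by have := leqnn (height q); rewrite {1}height_le => /andP[]. Qed.

Lemma height_den q : (`|denq q| < 2 ^ height q)%N.
Proof. by have := leqnn (height q); rewrite {1}height_le => /andP[]. Qed.

Lemma heightN q : height (- q) = height q.
Proof. by rewrite /height numqN denqN abszN. Qed.

Lemma heightD x y : (height (x + y) <= height x + height y + 1)%N.
Proof.
rewrite -[x in (x + y)%R]divq_num_den -[y in (_ + y)%R]divq_num_den.
have dx : (denq x)%:~R != 0 :> rat by rewrite intr_eq0 denq_neq0.
have dy : (denq y)%:~R != 0 :> rat by rewrite intr_eq0 denq_neq0.
rewrite addf_div // -!intrM -intrD.
have b u v : (u < 2 ^ height x -> v < 2 ^ height y ->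
  u * v < 2 ^ (height x + height y))%N.
  by move=> hu hv; rewrite expnD ltn_mul.
apply: height_div; last by rewrite addn1.
  rewrite addn1 expnS mul2n -addnn.
  have tri (u v : int) : (`|(u + v)%R| <= `|u| + `|v|)%N by lia.
  apply: (leq_ltn_trans (tri _ _)); rewrite !abszM.
  rewrite -addnS leq_add //; first by apply/ltnW/b; [exact: height_num|exact: height_den].
  by rewrite mulnC; apply: b; [exact: height_den|exact: height_num].
rewrite abszM; apply: (ltn_trans (b _ _ (height_den x) (height_den y))).
by rewrite addn1 ltn_exp2l.
Qed.

Lemma heightB x y : (height (x - y) <= height x + height y + 1)%N.
Proof. by rewrite (leq_trans (heightD _ _)) // heightN. Qed.

Lemma heightM x y : (height (x * y) <= height x + height y)%N.
Proof.
rewrite -[x in (x * y)%R]divq_num_den -[y in (_ * y)%R]divq_num_den.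
rewrite mulf_div -!intrM; apply: height_div.
- by rewrite abszM expnD ltn_mul // height_num.
- by rewrite abszM expnD ltn_mul // height_den.
- by rewrite addn_gt0 height_gt0.
Qed.

Lemma heightV x : (height x^-1 <= height x)%N.
Proof.
rewrite -[x in x^-1]divq_num_den invf_div.
by apply: height_div; rewrite ?height_num ?height_den ?height_gt0.
Qed.

Lemma height_int (z : int) k : (0 < k)%N -> (`|z| < 2 ^ k)%N -> (height z%:~R <= k)%N.
Proof.
move=> k0 h; rewrite -[_%:~R]divr1; apply: (@height_div z 1) => //.
by have := @ltn_exp2l 2 0 k isT; rewrite expn0 k0 => ->.
Qed.

Lemma height_nat n k : (0 < k)%N -> (n <= k)%N -> (height n%:R <= k)%N.
Proof.
move=> k0 h; rewrite -[n%:R]/(n%:Z%:~R); apply: height_int => //=.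
by apply: leq_ltn_trans h _; exact: ltn_expl.
Qed.

Lemma height_floor x : (height (Num.floor x)%:~R <= height x)%N.
Proof.
apply: height_int; first exact: height_gt0.
apply: leq_ltn_trans (height_num x).
have d0 : 0 < (denq x)%:~R :> rat by rewrite ltr0z denq_gt0.
have d1 : 1 <= (denq x)%:~R :> rat by rewrite ler1z -gtz0_ge1 denq_gt0.
have ex : x = (numq x)%:~R / (denq x)%:~R by rewrite divq_num_den.
have [x0|x0] := leP 0 x.
  have f0 : 0 <= Num.floor x by rewrite floor_ge0.
  have n0 : 0 <= numq x by rewrite numq_ge0.
  suff : Num.floor x <= numq x by lia.
  rewrite -(ler_int rat); apply: (le_trans (floor_le x)).
  by rewrite [leLHS]ex ler_pdivrMr // ler_peMr // ler0z.
have n0 : numq x < 0 by rewrite numq_lt0.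
suff : numq x <= Num.floor x /\ Num.floor x <= 0 by lia.
split; last first.
  rewrite -(ler_int rat); apply: (le_trans (floor_le x)); exact: ltW.
rewrite floor_ge_int [leRHS]ex ler_pdivlMr //.
by rewrite ler_neMr // lerz0 ltW.
Qed.

Lemma height_qbits q : (height q <= qbits q)%N.
Proof. rewrite /height /qbits; lia. Qed.

Lemma qbits_height q : (qbits q <= 2 * height q + 1)%N.
Proof. rewrite /height /qbits; lia. Qed.

(** * Expressions, programs and their running times *)

Fixpoint esize (e : expr) : nat :=
  match e with
  | Cst _ | Reg _ => 1
  | Cell _ e1 | Floor e1 => (esize e1).+1
  | Bin _ e1 e2 => (esize e1 + esize e2).+1
  end.

(** Only constants and values read from the state are constrained; the heights of intermediate
    results then follow from the size of the expression ([height_eval]). *)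
Fixpoint reads_bounded (s : state) (b : nat) (e : expr) : Prop :=
  match e with
  | Cst q => (height q <= b)%N
  | Reg r => (height (reg s r) <= b)%N
  | Cell A e1 => reads_bounded s b e1 /\
                 (height (Defs.mem s A (Num.truncn (Defs.eval s e1))) <= b)%N
  | Bin _ e1 e2 => reads_bounded s b e1 /\ reads_bounded s b e2
  | Floor e1 => reads_bounded s b e1
  end.

Definition evaluates_to (s : state) (b : nat) (e : expr) (x : rat) : Prop :=
  Defs.eval s e = x /\ reads_bounded s b e.

Lemma height_binop o x y :
  (height (eval_binop o x y) <= height x + height y + 1)%N.
Proof.
case: o => /=.
- exact: heightD.
- exact: heightB.
- by apply: leq_trans (heightM _ _) _; rewrite leq_addr.
- apply: leq_trans (heightM _ _) _.
  by apply: leq_trans (leq_addr 1 _); rewrite leq_add2l heightV.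
- have h1 := height_gt0 x; have h2 := height_gt0 y.
  by case: ifP => _; [apply: (@height_nat 1)|apply: (@height_nat 0)]; lia.
Qed.

Lemma height_eval s b e : reads_bounded s b e ->
  (height (Defs.eval s e) <= esize e * (b + 1))%N.
Proof.
elim: e => [q|r|A e IH|o e1 IH1 e2 IH2|e IH] /=.
- by rewrite mul1n; lia.
- by rewrite mul1n; lia.
- by move=> [_ h]; nia.
- move=> [/IH1 h1 /IH2 h2].
  by apply: leq_trans (height_binop _ _ _) _; nia.
- by move=> /IH h; apply: leq_trans (height_floor _) _; nia.
Qed.

(** Each of the at most [k] nodes produces a number of height at most [k * (b + 1)], charged at most
    three times that. *)
Definition ecost_bound (k b : nat) : nat := (3 * (k * k) * (b + 1))%N.

Lemma ecost_le s b e : reads_bounded s b e ->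
  (ecost s e <= ecost_bound (esize e) b)%N.
Proof.
have q e' : reads_bounded s b e' ->
    (qbits (Defs.eval s e') <= 3 * (esize e' * (b + 1)))%N.
  move=> /height_eval h; have := height_gt0 (Defs.eval s e').
  by have := qbits_height (Defs.eval s e'); lia.
rewrite /ecost_bound.
elim: e => [x|r|A e IH|o e1 IH1 e2 IH2|e IH] h; have /= := q _ h.
- by rewrite addn0; lia.
- by rewrite addn0; lia.
- by case: h => /IH h _; nia.
- by case: h => /IH1 h1 /IH2 h2; nia.
- by move/IH: h => h; nia.
Qed.

Lemma ev_cost s b e x : evaluates_to s b e x ->
  (ecost s e <= ecost_bound (esize e) b)%N.
Proof. by case=> _ /ecost_le. Qed.

Lemma ev_height s b e x : evaluates_to s b e x ->
  (height x <= esize e * (b + 1))%N.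
Proof. by case=> <- /height_eval. Qed.

Lemma ev_cst s b q : (height q <= b)%N -> evaluates_to s b (Cst q) q.
Proof. by []. Qed.

Lemma ev_reg s b r x : reg s r = x -> (height x <= b)%N ->
  evaluates_to s b (Reg r) x.
Proof. by move=> <-. Qed.

Lemma ev_cell s b A e k x : evaluates_to s b e k%:R -> Defs.mem s A k = x ->
  (height x <= b)%N -> evaluates_to s b (Cell A e) x.
Proof. by move=> [e1 h] <- hx; split=> /=; rewrite e1 natrK. Qed.

Lemma ev_bin s b o e1 e2 x y : evaluates_to s b e1 x -> evaluates_to s b e2 y ->
  evaluates_to s b (Bin o e1 e2) (eval_binop o x y).
Proof. by move=> [h1 r1] [h2 r2]; split=> //=; rewrite h1 h2. Qed.

Lemma ev_floor s b e x : evaluates_to s b e x ->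
  evaluates_to s b (Floor e) (Num.floor x)%:~R.
Proof. by move=> [h r]; split=> //=; rewrite h. Qed.

Lemma ev_leq s b e1 e2 x y : evaluates_to s b e1 x -> evaluates_to s b e2 y ->
  evaluates_to s b (Bin Leq e1 e2) (x <= y)%R%:R.
Proof.
move=> h1 h2; have := ev_bin Leq h1 h2.
by rewrite /=; case: (x <= y).
Qed.

Fixpoint wregs (c : cmd) : seq nat :=
  match c with
  | Assign r _ => [:: r]
  | Seq c1 c2 | If _ c1 c2 => wregs c1 ++ wregs c2
  | While _ c1 => wregs c1
  | CallSep _ r _ => [:: r]
  | _ => [::]
  end.

Fixpoint wmems (c : cmd) : seq nat :=
  match c with
  | Store A _ _ => [:: A]
  | Seq c1 c2 | If _ c1 c2 => wmems c1 ++ wmems c2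
  | While _ c1 => wmems c1
  | CallSep _ _ A | CallF _ A => [:: A]
  | _ => [::]
  end.

Definition frame (rs As : seq nat) (s s' : state) : Prop :=
  (forall r, r \notin rs -> reg s' r = reg s r) /\
  (forall A, A \notin As -> Defs.mem s' A = Defs.mem s A).

Lemma frame_trans rs As s1 s2 s3 :
  frame rs As s1 s2 -> frame rs As s2 s3 -> frame rs As s1 s3.
Proof.
by move=> [h1 k1] [h2 k2]; split=> x hx; [rewrite h2 ?h1|rewrite k2 ?k1].
Qed.

Lemma frame_sub rs As rs' As' s s' :
  {subset rs <= rs'} -> {subset As <= As'} ->
  frame rs As s s' -> frame rs' As' s s'.
Proof.
move=> h k [f g]; split=> x hx; [apply: f|apply: g]; apply: contra hx.
  exact: h.
exact: k.
Qed.

Lemma frame_set_reg rs As s r x : r \in rs -> frame rs As s (set_reg s r x).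
Proof.
by move=> h; split=> // r' hr /=; rewrite /upd; case: eqP => // e; rewrite e h in hr.
Qed.

Section runs.
Variables (d : nat) (O : oracles d).

Lemma exec_frame c s s' t : exec O c s s' t -> frame (wregs c) (wmems c) s s'.
Proof.
have updE (T : Type) (f : nat -> T) i v j : j \notin [:: i] -> upd f i v j = f j.
  by rewrite /upd inE => /negbTE ->.
elim=> {c s s' t}.
- by [].
- by move=> r e s; split=> //= r'; apply: updE.
- by move=> A i e s; split=> //= A' h; rewrite updE.
- move=> c1 c2 s1 s2 s3 t1 t2 _ h1 _ h2 /=.
  apply: (@frame_trans _ _ _ s2).
    by apply: frame_sub h1 => x; rewrite mem_cat => ->.
  by apply: frame_sub h2 => x; rewrite mem_cat => ->; rewrite orbT.
- by move=> e c1 c2 s s' t _ _; apply: frame_sub => x; rewrite mem_cat => ->.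
- move=> e c1 c2 s s' t _ _.
  by apply: frame_sub => x; rewrite mem_cat => ->; rewrite orbT.
- by move=> e c s1 s2 s3 t1 t2 _ _ h1 _; apply: frame_trans.
- by [].
- by move=> A r C s _; split=> //= r'; apply: updE.
- by move=> A r C s c _; split=> /= x h; rewrite updE.
- by move=> A C s; split=> //= x h; rewrite updE.
Qed.

(** Total correctness with a time bound. Exhibiting one run is enough, since programs are
    deterministic. *)
Definition runs (c : cmd) (s : state) (Q : state -> Prop) (tau : nat) : Prop :=
  exists s' t, [/\ exec O c s s' t, (t <= tau)%N & Q s'].

Lemma runs_weaken c s Q Q' tau tau' : runs c s Q tau ->
  (forall s', Q s' -> Q' s') -> (tau <= tau')%N -> runs c s Q' tau'.
Proof.
move=> [s' [t [e ht q]]] h le; exists s', t; split=> //; last exact: h.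
exact: leq_trans le.
Qed.

Lemma runs_frame c s Q tau : runs c s Q tau ->
  runs c s (fun s' => Q s' /\ frame (wregs c) (wmems c) s s') tau.
Proof.
move=> [s' [t [e ht q]]]; exists s', t; split=> //; split=> //.
exact: exec_frame e.
Qed.

Lemma runs_skip s (Q : state -> Prop) tau : Q s -> (0 < tau)%N -> runs Skip s Q tau.
Proof. by move=> h t0; exists s, 1%N; split=> //; constructor. Qed.

Lemma runs_assign r e s (Q : state -> Prop) b x :
  evaluates_to s b e x -> Q (set_reg s r x) ->
  runs (Assign r e) s Q (ecost_bound (esize e) b).
Proof.
move=> h q; exists (set_reg s r x), (ecost s e); split=> //; last exact: ev_cost h.
by case: h => <- _; constructor.
Qed.

Lemma runs_store A i e s (Q : state -> Prop) b k x :
  evaluates_to s b i k%:R -> evaluates_to s b e x -> Q (set_cell s A k x) ->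
  runs (Store A i e) s Q (ecost_bound (esize i) b + ecost_bound (esize e) b).
Proof.
move=> hi h q; exists (set_cell s A k x), (ecost s i + ecost s e)%N; split=> //.
  case: h hi => <- _ [ei _]; rewrite -[k in set_cell _ _ k](natrK (R := rat)) -ei; exact: ExStore.
by rewrite leq_add // (ev_cost h, ev_cost hi).
Qed.

Lemma runs_seq c1 c2 s Q1 Q tau1 tau2 : runs c1 s Q1 tau1 ->
  (forall s', Q1 s' -> frame (wregs c1) (wmems c1) s s' -> runs c2 s' Q tau2) ->
  runs (Seq c1 c2) s Q (tau1 + tau2).
Proof.
move=> [s1 [t1 [e1 h1 q1]]] /(_ _ q1 (exec_frame e1)) [s2 [t2 [e2 h2 q2]]].
exists s2, (t1 + t2)%N; split=> //; last exact: leq_add.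
exact: ExSeq e1 e2.
Qed.

Lemma runs_if e c1 c2 s Q b (x : bool) tau1 tau2 : evaluates_to s b e x%:R ->
  (x -> runs c1 s Q tau1) -> (~~ x -> runs c2 s Q tau2) ->
  runs (If e c1 c2) s Q (ecost_bound (esize e) b + tau1 + tau2).
Proof.
move=> h; have hc := ev_cost h; case: h.
case: x => e0 _ h1 h2.
  have [s' [t [E ht q]]] := h1 isT; exists s', (ecost s e + t)%N; split=> //.
    by apply: ExIfTrue => //; rewrite e0.
  by rewrite (leq_trans (leq_add hc ht)) // leq_addr.
have [s' [t [E ht q]]] := h2 isT; exists s', (ecost s e + t)%N; split=> //.
  by apply: ExIfFalse => //; rewrite e0.
by rewrite -addnA leq_add // (leq_trans ht) // leq_addl.
Qed.

Lemma runs_while (I : nat -> state -> Prop) J e c s b tau : I 0%N s ->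
  (forall j s, (j < J)%N -> I j s -> evaluates_to s b e 1 /\ runs c s (I j.+1) tau) ->
  (forall s, I J s -> evaluates_to s b e 0) ->
  runs (While e c) s (I J) (J.+1 * (ecost_bound (esize e) b + tau)).
Proof.
move=> i0 step stop.
suff H k s0 : (k <= J)%N -> I (J - k)%N s0 ->
    runs (While e c) s0 (I J) (k.+1 * (ecost_bound (esize e) b + tau)).
  by apply: H; rewrite ?subnn.
elim: k s0 => [|k IH] s0 kJ iS.
  rewrite subn0 in iS; have ev := stop _ iS.
  exists s0, (ecost s0 e); split=> //; first by apply: ExWhileFalse; case: ev.
  by rewrite mul1n (leq_trans (ev_cost ev)) // leq_addr.
have [|ev [s1 [t1 [e1 h1 i1]]]] := step (J - k.+1)%N s0 _ iS; first by lia.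
rewrite subnSK // in i1; have [s2 [t2 [e2 h2 i2]]] := IH _ (ltnW kJ) i1.
exists s2, (ecost s0 e + t1 + t2)%N; split=> //.
  by apply: ExWhileTrue e1 e2; case: ev => -> _; rewrite oner_eq0.
by rewrite mulSn leq_add // leq_add // (ev_cost ev).
Qed.

Definition For (i rm : nat) (body : cmd) : cmd :=
  Seq (Assign i (Cst 0))
    (While (Bin Leq (Bin Add (Reg i) (Cst 1)) (Reg rm))
      (Seq body (Assign i (Bin Add (Reg i) (Cst 1))))).

(** One parameter serves twice: [b] bounds the heights and, as [m < b], also the number of
    iterations. *)
Definition for_bound (b tau : nat) : nat := (b.+1 * (tau + 200 * (b + 1)))%N.

(** The value of the counter and the frame are supplied to the body at each round, so the invariant
    [I] need not carry them. Its conclusion is stated in the state after the increment. *)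
Lemma runs_for (I : nat -> state -> Prop) i rm m body s b tau :
  reg s rm = m%:R -> rm != i -> rm \notin wregs body -> i \notin wregs body ->
  (m < b)%N -> I 0%N (set_reg s i 0) ->
  (forall j s1, (j < m)%N -> I j s1 ->
     frame (i :: wregs body) (wmems body) s s1 -> reg s1 i = j%:R ->
     runs body s1 (fun s2 => I j.+1 (set_reg s2 i j.+1%:R)) tau) ->
  runs (For i rm body) s
    (fun s' => I m s' /\ frame (i :: wregs body) (wmems body) s s')
    (for_bound b tau).
Proof.
move=> hm ni nrm nib mb i0 step.
pose I' j s1 := [/\ I j s1, frame (i :: wregs body) (wmems body) s s1
                  & reg s1 i = j%:R].
have hb k : (k <= m)%N -> (height k.+1%:R <= b)%N by move=> ?; apply: height_nat; lia.
have hb' k : (k <= m)%N -> (height k%:R <= b)%N by move=> ?; apply: height_nat; lia.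
have regm j s1 : I' j s1 -> reg s1 rm = m%:R.
  by case=> _ [fr _] _; rewrite fr // inE (negbTE ni).
have test j s1 : (j <= m)%N -> I' j s1 ->
  evaluates_to s1 b (Bin Leq (Bin Add (Reg i) (Cst 1)) (Reg rm)) (j < m)%:R.
  move=> jm i1; have r := regm _ _ i1; case: i1 => _ _ ri.
  have := ev_leq (ev_bin Add (ev_reg ri (hb' _ jm)) (ev_cst _ (hb 0%N isT)))
                 (ev_reg r (hb' _ (leqnn m))).
  by rewrite /= -natrD ler_nat addn1.
have W : runs (While (Bin Leq (Bin Add (Reg i) (Cst 1)) (Reg rm))
      (Seq body (Assign i (Bin Add (Reg i) (Cst 1))))) (set_reg s i 0) (I' m)
      (m.+1 * (ecost_bound 5 b + (tau + ecost_bound 3 b))).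
  apply: (@runs_while I').
  - by split=> //; [apply: frame_set_reg; rewrite inE eqxx|rewrite /= /upd eqxx].
  - move=> j s1 jm i1; split; first by have := test _ _ (ltnW jm) i1; rewrite jm.
    have rm1 := regm _ _ i1; case: i1 => i1 f1 r1.
    apply: runs_seq (step _ _ jm i1 f1 r1) _ => s2 i2 f2.
    have r2 : reg s2 i = j%:R by case: f2 => f2 _; rewrite f2.
    apply: (@runs_assign _ _ _ _ b j.+1%:R).
      have := ev_bin Add (ev_reg r2 (hb' _ (ltnW jm))) (ev_cst _ (hb 0%N isT)).
      by rewrite /= -natrD addn1.
    split=> //; last by rewrite /= /upd eqxx.
    apply: frame_trans f1 _; apply: (@frame_trans _ _ _ s2).
      by apply: frame_sub f2 => // x; rewrite inE => ->; rewrite orbT.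
    by apply: frame_set_reg; rewrite inE eqxx.
  - by move=> s1 i1; have := test _ _ (leqnn m) i1; rewrite ltnn.
have := @runs_seq (Assign i (Cst 0)) _ s (fun s1 => s1 = set_reg s i 0)
  _ (ecost_bound 1 b) _
  (runs_assign (ev_cst _ (hb' 0%N isT)) erefl)
  (fun s' e _ => eq_ind_r (fun s' => runs _ s' _ _) W e).
move=> /runs_weaken; apply; first by move=> s' [].
rewrite /ecost_bound /for_bound.
(* Here 102 = 75 + 27: the test has size 5 and the increment size 3. *)
have : (m.+1 * (tau + 102 * (b + 1)) + 3 * (b + 1) <= b.+1 * (tau + 200 * (b + 1)))%N.
  have : (m.+1 * (tau + 102 * (b + 1)) <= b * (tau + 102 * (b + 1)))%N.
    by rewrite leq_mul2r mb orbT.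
  by nia.
by nia.
Qed.

End runs.

(** * Loops for sums, array filling and minima *)

Section macros.
Variables (d : nat) (O : oracles d).

Definition Sum (r i rm : nat) (e : expr) : cmd :=
  Seq (Assign r (Cst 0)) (For i rm (Assign r (Bin Add (Reg r) e))).

(** Heights add up along a sum, so the accumulator outgrows [b] and needs a bound of its own. *)
Definition sum_height (k b : nat) : nat := (b.+1 * (k * (b + 1) + 2))%N.

Definition sum_bound (k b : nat) : nat :=
  (3 * (b + 1) + for_bound b (4 * sum_height k b + 2 + ecost_bound k b))%N.

Lemma height_sum (g : nat -> rat) m h :
  (forall l, (l < m)%N -> height (g l) <= h)%N ->
  (height (\sum_(l < m) g l) <= m * (h + 1) + 1)%N.
Proof.
elim: m => [|m IH] H; first by rewrite big_ord0; apply: (@height_nat 0); lia.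
rewrite big_ord_recr /=; apply: leq_trans (heightD _ _) _.
have h1 := IH (fun l lm => H l (ltnW lm)); have h2 := H m (ltnSn m).
apply: (@leq_trans (h + (m * (h + 1) + 1) + 1)); last by lia.
by rewrite leq_add2r addnC leq_add.
Qed.

Lemma runs_sum r i rm e m s b (g : nat -> rat) :
  reg s rm = m%:R -> uniq [:: r; i; rm] -> (m < b)%N ->
  (forall k s1, (k < m)%N -> frame [:: r; i] [::] s s1 -> reg s1 i = k%:R ->
     evaluates_to s1 b e (g k)) ->
  runs O (Sum r i rm e) s
    (fun s' => [/\ reg s' r = \sum_(k < m) g k,
       (height (reg s' r) <= sum_height (esize e) b)%N
     & frame [:: r; i] [::] s s'])
    (sum_bound (esize e) b).
Proof.
rewrite /= !inE negb_or andbT => hm /andP[/andP[ri rrm] irm] mb he.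
have hb k : (k <= m)%N -> (height k%:R <= b)%N by move=> ?; apply: height_nat; lia.
set B := sum_height _ _.
have e0 : (0 < esize e)%N by case: (e).
have hg k : (k <= m)%N -> (height (\sum_(l < k) g l) <= B)%N.
  move=> km; apply: leq_trans (@height_sum g k (esize e * (b + 1)) _) _.
    (* The height of [g l] is read off from the evaluation of [e] in an artificial state whose
       counter is [l]. *)
    move=> l lk; pose s1 := set_reg s i l%:R; apply: (@ev_height s1).
    apply: he; first by lia.
      by apply: frame_set_reg; rewrite !inE eqxx orbT.
    by rewrite /= /upd eqxx.
  by rewrite /B /sum_height; nia.
apply: runs_seq.
  apply: (@runs_assign _ _ _ _ _ (fun s1 => s1 = set_reg s r 0)) erefl.
  exact: ev_cst (hb 0%N isT).
move=> _ -> _.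
pose s0 := set_reg s r 0.
pose I k s1 := reg s1 r = \sum_(l < k) g l.
have fr0 : frame [:: r; i] [::] s s0 by apply: frame_set_reg; rewrite inE eqxx.
have := @runs_for d O I i rm m (Assign r (Bin Add (Reg r) e)) s0 b
  (4 * B + 2 + ecost_bound (esize e) b).
case.
- by rewrite /= /upd eq_sym (negbTE rrm).
- by rewrite eq_sym.
- by rewrite /= inE eq_sym.
- by rewrite /= inE eq_sym.
- by [].
- by rewrite /I big_ord0 /= /upd (negbTE ri) eqxx.
- move=> j s1 jm ij fj rj.
  have fj' : frame [:: r; i] [::] s s1.
    apply: frame_trans fr0 _; apply: frame_sub fj => // x.
    by rewrite /= !inE orbC.
  have ev := he _ _ jm fj' rj.
  have evr : evaluates_to s1 B (Reg r) (\sum_(l < j) g l).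
    by apply: ev_reg => //; exact: hg (ltnW jm).
  have E : Defs.eval s1 (Bin Add (Reg r) e) = \sum_(l < j.+1) g l.
    by rewrite big_ord_recr /=; case: ev => -> _; rewrite ij.
  (* The accumulator is bounded by [B] and not by [b], so the cost is counted directly: two numbers
     of height at most [B] besides the cost of [e]. *)
  exists (set_reg s1 r (\sum_(l < j.+1) g l)),
         (ecost s1 (Bin Add (Reg r) e)); split.
  + by rewrite -E; constructor.
  + rewrite /ecost -/ecost E.
    have h1 := qbits_height (\sum_(l < j.+1) g l).
    have h2 := qbits_height (\sum_(l < j) g l).
    have h3 := hg _ jm; have h4 := hg _ (ltnW jm).
    have h5 := ev_cost ev.
    by case: evr => -> _; lia.
  + by rewrite /I /= /upd (negbTE ri) eqxx.
- move=> s' [t [ex ht [i1 f1]]]; exists s', t; split=> //.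
  split=> //; first by rewrite i1; apply: hg.
  apply: frame_trans fr0 _; apply: frame_sub f1 => // x.
  by rewrite /= !inE orbC.
Qed.

Definition Fill (A i rm : nat) (off e : expr) : cmd :=
  For i rm (Store A (Bin Add off (Reg i)) e).

Definition fill_bound (ko k b : nat) : nat :=
  for_bound b (ecost_bound (ko + 2) b + ecost_bound k b).

(* The state [s1] in the hypothesis is the one reached after [k] stores. *)
Lemma runs_fill A i rm off e m o s b (g : nat -> rat) :
  reg s rm = m%:R -> rm != i -> (m < b)%N ->
  (forall k s1, (k < m)%N -> frame [:: i] [:: A] s s1 -> reg s1 i = k%:R ->
     (forall x, Defs.mem s1 A x =
        if (o <= x < o + k)%N then g (x - o)%N else Defs.mem s A x) ->
     evaluates_to s1 b off o%:R /\ evaluates_to s1 b e (g k)) ->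
  runs O (Fill A i rm off e) s
    (fun s' => [/\ (forall x, Defs.mem s' A x =
        if (o <= x < o + m)%N then g (x - o)%N else Defs.mem s A x),
       forall k, (k < m)%N -> (height (g k) <= esize e * (b + 1))%N
     & frame [:: i] [:: A] s s'])
    (fill_bound (esize off) (esize e) b).
Proof.
move=> hm ni mb he.
pose I k s1 := (forall x, Defs.mem s1 A x =
        if (o <= x < o + k)%N then g (x - o)%N else Defs.mem s A x) /\
  forall l, (l < k)%N -> (height (g l) <= esize e * (b + 1))%N.
have := @runs_for d O I i rm m (Store A (Bin Add off (Reg i)) e) s b
  (ecost_bound (esize off + 2) b + ecost_bound (esize e) b).
case=> //.
- by split=> // x; rewrite addn0; case: ifP => //; lia.
- move=> j s1 jm [ij hj] fj rj.
  have [ev1 ev2] := he _ _ jm fj rj ij.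
  have hb : (height j%:R <= b)%N by apply: height_nat; lia.
  have evi : evaluates_to s1 b (Bin Add off (Reg i)) (o + j)%:R.
    by have := ev_bin Add ev1 (ev_reg rj hb); rewrite /= -natrD.
  have := runs_store O (Q := fun s2 => I j.+1 (set_reg s2 i j.+1%:R)) (A := A) evi ev2.
  move=> /(_ _) H; apply: runs_weaken (H _) (fun _ h => h) _.
    split; last by move=> l; rewrite ltnS leq_eqVlt => /predU1P[->|/hj //]; apply: ev_height ev2.
    move=> x; rewrite /= /upd eqxx.
    case: eqP => [->|xn]; first by rewrite addKn ifT //; lia.
    rewrite ij; case: ifP => h; first by rewrite ifT //; lia.
    by rewrite ifF //; lia.
  by rewrite /= addn1 addn2.
- by move=> s' [t [ex ht [[i1 h1] f1]]]; exists s', t; split.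
Qed.

Definition Argmin (T k i rm : nat) : cmd :=
  Seq (Assign k (Cst 0))
    (For i rm (If (Bin Leq (Cell T (Reg k)) (Cell T (Reg i))) Skip
                  (Assign k (Reg i)))).

Definition argmin_bound (b : nat) : nat :=
  (3 * (b + 1) + for_bound b (78 * (b + 1) + 1))%N.

Lemma runs_argmin T k i rm m s b (g : nat -> rat) :
  reg s rm = m%:R -> uniq [:: k; i; rm] -> (0 < m < b)%N ->
  (forall l, (l < m)%N -> Defs.mem s T l = g l /\ (height (g l) <= b)%N) ->
  runs O (Argmin T k i rm) s
    (fun s' => [/\ (exists2 l0, (l0 < m)%N & reg s' k = l0%:R /\
                     forall l, (l < m)%N -> g l0 <= g l)
     & frame [:: k; i] [::] s s'])
    (argmin_bound b).
Proof.
rewrite /= !inE negb_or andbT => hm /andP[/andP[ki krm] irm] /andP[m0 mb] hT.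
have hb l : (l <= m)%N -> (height l%:R <= b)%N by move=> ?; apply: height_nat; lia.
apply: runs_seq.
  apply: (@runs_assign _ _ _ _ _ (fun s1 => s1 = set_reg s k 0)) erefl.
  exact: ev_cst (hb 0%N isT).
move=> _ -> _.
pose s0 := set_reg s k 0.
pose I j s1 := exists2 l0, (l0 < m)%N & reg s1 k = l0%:R /\
                     forall l, (l < j)%N -> g l0 <= g l.
have fr0 : frame [:: k; i] [::] s s0 by apply: frame_set_reg; rewrite inE eqxx.
have := @runs_for d O I i rm m
  (If (Bin Leq (Cell T (Reg k)) (Cell T (Reg i))) Skip (Assign k (Reg i))) s0 b
  (78 * (b + 1) + 1).
case.
- by rewrite /= /upd eq_sym (negbTE krm).
- by rewrite eq_sym.
- by rewrite /= inE eq_sym.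
- by rewrite /= inE eq_sym.
- by [].
- by exists 0%N => //; split=> //; rewrite /= /upd (negbTE ki) eqxx.
- move=> j s1 jm [l0 l0m [kE hl]] fj rj.
  have fj' : frame [:: k; i] [::] s s1.
    apply: frame_trans fr0 _; apply: frame_sub fj => // x.
    by rewrite /= !inE orbC.
  have mE : Defs.mem s1 T = Defs.mem s T by case: fj' => _ ->.
  have [Tl Hl] := hT _ l0m; have [Tj Hj] := hT _ jm.
  have ev1 : evaluates_to s1 b (Cell T (Reg k)) (g l0).
    by apply: (@ev_cell _ _ _ _ l0); rewrite ?mE //; apply: ev_reg => //; apply/hb/ltnW.
  have ev2 : evaluates_to s1 b (Cell T (Reg i)) (g j).
    by apply: (@ev_cell _ _ _ _ j); rewrite ?mE //; apply: ev_reg => //; apply/hb/ltnW.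
  apply: runs_weaken (runs_if (tau1 := 1) (tau2 := ecost_bound 1 b)
    (Q := fun s2 => I j.+1 (set_reg s2 i j.+1%:R)) (ev_leq ev1 ev2) _ _) (fun _ h => h) _.
  + move=> le; apply: runs_skip => //; exists l0 => //; split.
      by rewrite /= /upd (negbTE ki).
    by move=> l; rewrite ltnS leq_eqVlt => /predU1P[->|/hl].
  + rewrite -ltNge => lt; apply: runs_assign.
      by apply: ev_reg rj _; apply/hb/ltnW.
    exists j => //; split; first by rewrite /= /upd (negbTE ki) eqxx.
    move=> l; rewrite ltnS leq_eqVlt => /predU1P[->//|/hl].
    exact/le_trans/ltW.
  + by rewrite /ecost_bound /=; lia.
- move=> s' [t [ex ht [i1 f1]]]; exists s', t; split=> //.
  split=> //.
  apply: frame_trans fr0 _; apply: frame_sub f1 => // x.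
  by rewrite /= !inE orbC.
Qed.

End macros.

(** * Shrinking simplices *)

Section simplex.
Variable R : realFieldType.

(** Weierstrass's product inequality; nonnegativity of the partial sums is carried along to make the
    induction work. *)
Lemma prod_ge_1sum (I : finType) (x : I -> R) :
  (forall i, 0 <= x i) -> 1 + \sum_i x i <= \prod_i (1 + x i).
Proof.
move=> x0; suff : 1 + \sum_i x i <= \prod_i (1 + x i) /\ 0 <= \sum_i x i by case.
elim/big_rec2: _ => [|i z y _ [h1 h2]]; first by rewrite addr0.
split; last exact: addr_ge0.
have h3 := mulr_ge0 (x0 i) (_ : 0 <= y - (1 + z)).
have h4 := mulr_ge0 (x0 i) h2.
by rewrite subr_ge0 in h3; have := h3 h1; lra.
Qed.

Lemma bernoulli_le (x : R) n : -1 <= x -> 1 + n%:R * x <= (1 + x) ^+ n.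
Proof.
move=> x1; elim: n => [|n IH]; first by rewrite mul0r addr0 expr0.
rewrite exprS; apply: le_trans (_ : (1 + x) * (1 + n%:R * x) <= _); last first.
  by rewrite ler_wpM2l //; lra.
rewrite -natr1; have : 0 <= n%:R * x ^+ 2 by rewrite mulr_ge0 ?sqr_ge0.
by rewrite expr2; lra.
Qed.

(** The Leibniz expansion is bounded by the sum of [\prod_i S i (s i)] over permutations. Extending
    it to all maps adds nonnegative terms and yields the product of the row sums, which is 1. *)
Lemma stochastic_det_le1 n (S : 'M[R]_n) :
  (forall i j, 0 <= S i j) -> (forall i, \sum_j S i j = 1) -> `|\det S| <= 1.
Proof.
move=> S0 S1; apply: le_trans (ler_norm_sum _ _ _) _.
rewrite [leRHS](_ : _ = \prod_(i < n) \sum_(j < n) S i j); last by rewrite big1.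
rewrite bigA_distr_bigA /= (bigID (fun f : {ffun 'I_n -> 'I_n} => injectiveb f)) /=.
rewrite -[leLHS]addr0; apply: lerD; last first.
  by apply: sumr_ge0 => f _; apply: prodr_ge0.
rewrite (reindex (@pval _)) /=; last first.
  pose in_Sn := insubd (1%g : 'S_n).
  by exists in_Sn => /= f Uf; first apply: val_inj; apply: insubdK.
rewrite [leRHS](eq_bigl xpredT) => [|s]; last by rewrite (valP s).
apply: ler_sum => s _; rewrite normrMsign normr_prod.
by apply: ler_prod => i _; rewrite normr_ge0 ger0_norm // pvalE /=.
Qed.

Variable d : nat.
Implicit Types (V W : 'M[R]_(1 + d, d)) (w p : 'rV[R]_d).

Definition in_simplex V w : Prop :=
  exists l : 'rV[R]_(1 + d),
    [/\ forall i, 0 <= l 0 i, \sum_i l 0 i = 1 & w = l *m V].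

(** The column of ones turns barycentric combinations into matrix products; the determinant is, up
    to sign, [d!] times the volume of the simplex. *)
Definition homog V : 'M[R]_(1 + d) := row_mx (const_mx 1) V.

Lemma simplex_det_le V W : (forall i, in_simplex V (row i W)) ->
  `|\det (homog W)| <= `|\det (homog V)|.
Proof.
move=> /(_ _)/cid h; pose S : 'M[R]_(1 + d) := \matrix_i (sval (h i)).
have -> : homog W = S *m homog V.
  rewrite /homog mul_mx_row; congr row_mx.
    apply/matrixP => i j; rewrite !mxE -[LHS](_ : \sum_l sval (h i) 0 l = 1).
      by apply: eq_bigr => l _; rewrite !mxE mulr1.
    by case: (svalP (h i)).
  apply/row_matrixP => i; rewrite row_mul rowK; by case: (svalP (h i)).
rewrite det_mulmx normrM ler_piMl ?normr_ge0 //; apply: stochastic_det_le1.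
  by move=> i j; rewrite mxE; case: (svalP (h i)).
move=> i; under eq_bigr do rewrite mxE; by case: (svalP (h i)).
Qed.

(** Row 0 is [p], because [0 == j.+1] never holds, and row [j + 1] is [p] moved by [t] along axis
    [j]. Both the initial simplex and the final witness have this shape. *)
Definition corner p (t : R) : 'M[R]_(1 + d, d) :=
  \matrix_(i, j) (p 0 j + t * (i == j.+1 :> nat)%:R).

Lemma det_corner p t : \det (homog (corner p t)) = t ^+ d.
Proof.
have -> : homog (corner p t) =
    block_mx (1%:M : 'M[R]_1) 0 (const_mx 1) 1%:M *m block_mx (1%:M : 'M[R]_1) p 0 t%:M.
  rewrite mulmx_block !mul1mx !mul0mx !mulmx1 !addr0.
  rewrite /homog block_mxEh; congr row_mx.
    apply/matrixP => i j; rewrite !mxE; case: fintype.splitP => k _; rewrite !mxE //.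
    by rewrite !ord1.
  apply/matrixP => i j; rewrite !mxE; case: fintype.splitP => k e; rewrite e ?mxE.
    by rewrite ord1 /= mulr0 addr0.
  rewrite big_ord1 !mxE mul1r; congr (_ + _).
  by rewrite add1n eqSS -val_eqE /= mulr_natr.
by rewrite det_mulmx det_lblock det_ublock !det1 det_scalar !mul1r.
Qed.

Lemma in_corner p t w : 0 < t -> (forall j, 0 <= w 0 j - p 0 j) ->
  \sum_j (w 0 j - p 0 j) <= t -> in_simplex (corner p t) w.
Proof.
move=> t0 h s.
pose l : 'rV[R]_(1 + d) :=
  row_mx (1 - \sum_j (w 0 j - p 0 j) / t)%:M (\row_j ((w 0 j - p 0 j) / t)).
have l0 : l 0 (@ord0 d) = 1 - \sum_j (w 0 j - p 0 j) / t.
  rewrite mxE; case: fintype.splitP => j // _; by rewrite mxE !ord1 eqxx mulr1n.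
have lS j : l 0 (@lift d.+1 (@ord0 d) j) = (w 0 j - p 0 j) / t.
  rewrite mxE; case: fintype.splitP => k // e.
    by case: k e => -[].
  rewrite mxE; have -> // : k = j by apply: val_inj; move: e; rewrite /= /bump /=; lia.
exists l; split.
- move=> i; case: (unliftP (@ord0 d) i) => [j|] ->; rewrite ?lS ?l0.
    by rewrite divr_ge0 // ltW.
  by rewrite subr_ge0 -mulr_suml ler_pdivrMr // mul1r.
- by rewrite big_ord_recl l0; under [X in _ + X]eq_bigr do rewrite lS; rewrite subrK.
- apply/rowP => j; rewrite mxE big_ord_recl l0 !mxE /= mulr0 addr0.
  under [X in _ + X]eq_bigr => i _.
    rewrite lS !mxE /= /bump /= add1n eqSS mulrDr.
  over.
  rewrite big_split /= -[in RHS]mulr_suml.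
  rewrite [X in _ + (_ + X)](bigD1 j) //= eqxx mulr1 divfK ?gt_eqF //.
  rewrite [X in _ + (_ + (_ + X))]big1 => [|i ij]; last by rewrite (negbTE (ij : (i : nat) != j)) !mulr0.
  rewrite -[in RHS]mulr_suml -[X in _ + (X * _ + _)]mulr_suml; ring.
Qed.

Definition shrink V (k : 'I_(1 + d)) (al : 'I_(1 + d) -> R) : 'M[R]_(1 + d, d) :=
  \matrix_(i, j) (V k j + al i * (V i j - V k j)).

(** The shrinking is left multiplication by [D], whose row [k] is a unit vector since
    [al k + (1 - al k) = 1]; expanding along that row leaves a diagonal minor. *)
Lemma det_shrink V k al :
  \det (homog (shrink V k al)) = (\prod_(i < d) al (lift k i)) * \det (homog V).
Proof.
pose D : 'M[R]_(1 + d) :=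
  \matrix_(i, j) (al i * (i == j)%:R + (1 - al i) * (j == k)%:R).
have DM m (A : 'M[R]_(1 + d, m)) i j :
    (D *m A) i j = al i * A i j + (1 - al i) * A k j.
  rewrite mxE; under eq_bigr do rewrite mxE mulrDl -!mulrA.
  rewrite big_split /= -!mulr_sumr; congr (_ * _ + _ * _).
    rewrite (bigD1 i) //= eqxx mul1r big1 ?addr0 // => l li.
    by rewrite eq_sym (negbTE li) mul0r.
  by rewrite (bigD1 k) //= eqxx mul1r big1 ?addr0 // => l /negbTE ->; rewrite mul0r.
have -> : homog (shrink V k al) = D *m homog V.
  rewrite /homog mul_mx_row; congr row_mx; apply/matrixP => i j; rewrite DM !mxE; ring.
rewrite det_mulmx; congr (_ * _); rewrite (expand_det_row D k) (bigD1 k) //=.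
rewrite big1 ?addr0 => [|j jk]; last first.
  by rewrite mxE eq_sym (negbTE jk) !mulr0 addr0 mul0r.
rewrite mxE eqxx !mulr1 addrC subrK mul1r /cofactor -signr_odd addnn odd_double mul1r.
have -> : row' k (col' k D) = diag_mx (\row_i al (lift k i)).
  apply/matrixP => i j; rewrite !mxE (inj_eq (@lift_inj _ k)).
  by rewrite [lift k j == k]eq_sym (negbTE (neq_lift _ _)) mulr0 addr0 mulr_natr.
by rewrite det_diag; apply: eq_bigr => i _; rewrite mxE.
Qed.

(* A point of the simplex keeps its barycentric weight at the other vertices up
   to the factor [1 / al i], so it suffices that these new weights sum to at most 1. *)
Lemma in_shrink V k al (h : 'I_(1 + d) -> R) (Q : R) (l : 'rV[R]_(1 + d)) :
  h k < 0 -> 1 < Q -> (forall i, h k <= h i) ->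
  (forall i, Q * - h k / (Q * - h k + h i) <= al i) ->
  (forall i, 0 <= l 0 i) -> \sum_i l 0 i = 1 -> \sum_i l 0 i * h i <= 0 ->
  in_simplex (shrink V k al) (l *m V).
Proof.
move=> hk Q1 hmin hal l0 l1 lh.
set m := - h k in hal; have m0 : 0 < m by rewrite /m; lra.
have Qm : m < Q * m by rewrite ltr_pMl.
have den i : 0 < Q * m + h i by have := hmin i; rewrite /m in Qm *; lra.
have al0 i : 0 < al i.
  by apply: lt_le_trans (hal i); rewrite divr_gt0 // (lt_trans m0).
have alV i : (al i)^-1 <= 1 + h i / (Q * m).
  have -> : 1 + h i / (Q * m) = (Q * m / (Q * m + h i))^-1.
    by rewrite invf_div mulrDl divff // gt_eqF // (lt_trans m0).
  by rewrite lef_pV2 ?posrE // divr_gt0 // (lt_trans m0).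
pose c i : R := if i == k then 0 else l 0 i / al i.
have c0 i : 0 <= c i by rewrite /c; case: ifP => // _; rewrite divr_ge0 // ltW.
have c1 : \sum_i c i <= 1.
  rewrite (bigD1 k) //= {1}/c eqxx add0r.
  apply: le_trans (_ : \sum_(i | i != k) (l 0 i + l 0 i * h i / (Q * m)) <= _).
    apply: ler_sum => i /negbTE ik; rewrite /c ik -mulrA.
    by rewrite -[X in _ <= X + _]mulr1 -mulrDr ler_wpM2l.
  rewrite big_split /= -mulr_suml.
  set A := \sum_(i | _) l 0 i; set B := \sum_(i | _) _.
  have e1 : l 0 k + A = 1 by rewrite -l1 [RHS](bigD1 k).
  have e2 : l 0 k * h k + B <= 0 by have := lh; rewrite (bigD1 k).
  (* The cut bounds the weighted slacks away from [k] by [l 0 k * m], and [m < Q * m]: dropping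
     vertex [k] frees at least the weight that the other vertices gain. *)
  have Bm : B / (Q * m) <= l 0 k.
    rewrite ler_pdivrMr ?(lt_trans m0) //.
    have := ler_wpM2l (l0 k) (ltW Qm); rewrite /m in e2 *; lra.
  lra.
exists (\row_i (c i + (i == k)%:R * (1 - \sum_j c j))); split.
- by move=> i; rewrite mxE addr_ge0 // mulr_ge0 // ?ler0n // subr_ge0.
- under eq_bigr do rewrite mxE.
  rewrite big_split /= -mulr_suml.
  have -> : \sum_(i < 1 + d) (i == k)%:R = 1 :> R.
    by rewrite (bigD1 k) //= eqxx big1 ?addr0 // => i /negbTE ->.
  rewrite mul1r.
  by rewrite addrC subrK.
- apply/rowP => j; rewrite !mxE.
  under [RHS]eq_bigr do rewrite !mxE mulrDl.
  rewrite big_split /=.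
  have -> : \sum_i (i == k)%:R * (1 - \sum_j c j) * (V k j + al i * (V i j - V k j))
     = (1 - \sum_j c j) * V k j.
    rewrite (bigD1 k) //= eqxx [X in _ + X]big1 ?addr0; last by move=> i /negbTE ->; rewrite !mul0r.
    by rewrite mul1r subrr mulr0 addr0.
  have -> : \sum_i c i * (V k j + al i * (V i j - V k j)) =
     (\sum_i c i) * V k j + \sum_i l 0 i * (V i j - V k j).
    rewrite mulr_suml -big_split /=; apply: eq_bigr => i _.
    rewrite mulrDr mulrA; congr (_ + _); rewrite /c; case: eqP => [->|_].
      by rewrite !subrr !mulr0.
    by rewrite divfK // gt_eqF.
  under [X in _ = _ + X + _]eq_bigr do rewrite mulrBr.
  rewrite big_split /= sumrN -mulr_suml l1; ring.
Qed.

Definition shrink_rate : R := (1 + (12 * (1 + d) ^ 2)%:R^-1)^-1.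

Lemma shrink_rate_gt0 : 0 < shrink_rate.
Proof. by rewrite invr_gt0 ltr_pwDl. Qed.

(* Up to the rounding error [1 / (64 n^3)] the factor [al i] is
   [(1 + s) / (1 + s u_i)] with [s = 1 / (4 n^2)] and [u_i = 1 - h i / h k >= 0],
   where the [u_i] sum to [n]; the product of the denominators is at least [1 + s n]. *)
Lemma prod_shrink (k : 'I_(1 + d)) (al h : 'I_(1 + d) -> R) :
  let n : R := (1 + d)%:R in let Q := 4 * n ^+ 2 + 1 in
  h k < 0 -> (forall i, h k <= h i) -> \sum_i h i = 0 ->
  (forall i, 0 <= al i <= Q * - h k / (Q * - h k + h i) + (64 * n ^+ 3)^-1) ->
  \prod_(i < d) al (lift k i) <= shrink_rate.
Proof.
move=> n Q hk hmin hsum hal.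
have n1 : 1 <= n by rewrite /n ler1n.
have n0 : 0 < n by lra.
have dE : d%:R = n - 1 by rewrite /n add1n -natr1 addrK.
pose s := (4 * n ^+ 2)^-1.
have n2 : 0 < 4 * n ^+ 2 by rewrite mulr_gt0 ?exprn_gt0.
have s0 : 0 < s by rewrite invr_gt0.
pose sg := s + (32 * n ^+ 3)^-1.
have n3 : 0 < (32 * n ^+ 3)^-1 by rewrite invr_gt0 mulr_gt0 ?exprn_gt0.
pose u i := 1 - h i / h k.
have hkN : h k != 0 by rewrite lt_eqF.
have u0 i : 0 <= u i.
  by rewrite subr_ge0 ler_ndivrMr // mul1r.
have uk : u k = 0 by rewrite /u divff // subrr.
have usum : \sum_i u i = n.
  by rewrite big_split /= sumrN -mulr_suml hsum mul0r subr0 sumr_const card_ord.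
have ulift : \sum_(i < d) u (lift k i) = n.
  by rewrite -usum [RHS](bigD1_ord k) //= uk add0r.
have un i : u i <= n.
  rewrite -usum (bigD1 i) //= lerDl; apply: sumr_ge0 => j _; exact: u0.
have aE i : Q * - h k / (Q * - h k + h i) = (1 + s) / (1 + s * u i).
  have e1 : 0 < 1 + s * u i by rewrite ltr_pwDl // mulr_ge0 // ltW.
  have -> : Q * - h k = 4 * n ^+ 2 * - h k * (1 + s).
    by rewrite /Q /s; field; rewrite gt_eqF.
  have -> : 4 * n ^+ 2 * - h k * (1 + s) + h i = 4 * n ^+ 2 * - h k * (1 + s * u i).
    by rewrite /u /s; field; rewrite hkN gt_eqF.
  rewrite -mulf_div divff ?mul1r // mulf_neq0 ?oppr_eq0 // gt_eqF //.
have al_le i : al i <= (1 + sg) / (1 + s * u i).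
  have /andP[_ h1] := hal i; apply: le_trans h1 _; rewrite aE.
  have e1 : 0 < 1 + s * u i by rewrite ltr_pwDl // mulr_ge0 // ltW.
  (* The denominator is at most 2, so the additive rounding error [1 / (64 n ^ 3)] is absorbed by
     enlarging the numerator by [1 / (32 n ^ 3)], which is where [sg] comes from. *)
  have e2 : 1 + s * u i <= 2.
    have h1 : s * u i <= s * n by rewrite ler_pM2l.
    have h2 : s * n <= 1.
      rewrite /s mulrC ler_pdivrMr // mul1r expr2; nra.
    lra.
  rewrite /sg addrA [in leRHS]mulrDl lerD2l ler_pdivlMr //.
  have -> : (32 * n ^+ 3)^-1 = (64 * n ^+ 3)^-1 * 2 by field; rewrite gt_eqF.
  by rewrite ler_pM2l // invr_gt0 mulr_gt0 ?exprn_gt0.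
have sg0 : 0 < sg by rewrite addr_gt0.
have p1 : \prod_(i < d) al (lift k i) <= (1 + sg) ^+ d / \prod_(i < d) (1 + s * u (lift k i)).
  rewrite -[X in _ ^+ X](card_ord d) -prodr_const -prodf_div; apply: ler_prod => i _.
  by rewrite al_le andbT; case/andP: (hal (lift k i)).
apply: le_trans p1 _.
have p2 : 1 + s * n <= \prod_(i < d) (1 + s * u (lift k i)).
  rewrite -ulift mulr_sumr; apply: prod_ge_1sum => i; exact: mulr_ge0 (ltW s0) (u0 _).
have sn : 0 < 1 + s * n by rewrite ltr_pwDl // mulr_ge0 // ltW.
have A0 : 0 < (1 + sg) ^+ d by rewrite exprn_gt0 // addr_gt0.
apply: (@le_trans _ _ ((1 + sg) ^+ d / (1 + s * n))).
  by rewrite ler_pM2l // lef_pV2 ?posrE // (lt_le_trans sn).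
pose w := n^-1.
have w0 : 0 < w by rewrite invr_gt0.
have w1 : w <= 1 by rewrite invf_le1.
have nw : n * w = 1 by rewrite divff // gt_eqF.
have sE : s = w ^+ 2 / 4 by rewrite /s /w; field; rewrite gt_eqF.
have sgE : sg = w ^+ 2 / 4 + w ^+ 3 / 32.
  by rewrite /sg sE /w; field; rewrite gt_eqF.
have snE : s * n = w / 4 by rewrite /s /w; field; rewrite gt_eqF.
have dsgE : d%:R * sg = w / 4 - 7 / 32 * w ^+ 2 - w ^+ 3 / 32.
  by rewrite dE sgE /w; field; rewrite gt_eqF.
have w3 : w ^+ 3 <= 1 by rewrite exprn_ile1 // ltW.
have w2 : w ^+ 2 <= 1 by rewrite exprn_ile1 // ltW.
have w20 : 0 < w ^+ 2 by rewrite exprn_gt0.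
have w30 : 0 < w ^+ 3 by rewrite exprn_gt0.
have w40 : 0 < w ^+ 4 by rewrite exprn_gt0.
(* Bernoulli's inequality for [- sg], together with [(1 + sg) * (1 - sg) <= 1], bounds the power
   from above. *)
have B1 : (1 + sg) ^+ d * (1 - d%:R * sg) <= 1.
  have b1 : 1 - d%:R * sg <= (1 - sg) ^+ d.
    by have := @bernoulli_le (- sg) d; rewrite mulrN; apply; rewrite sgE; lra.
  apply: (@le_trans _ _ ((1 + sg) ^+ d * (1 - sg) ^+ d)); first by rewrite ler_pM2l.
  rewrite -exprMn; apply: exprn_ile1.
    by apply: mulr_ge0; rewrite sgE; lra.
  by have := sqr_ge0 sg; rewrite expr2; lra.
(* The term [5 / 32 * w ^+ 2] is [5 / 8] of [s]; the remaining slack allows the rounder rate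
   [s / 3 = 1 / (12 n ^ 2)]. *)
have B2 : 1 + s / 3 <= (1 - d%:R * sg) * (1 + s * n).
  rewrite dsgE snE sE.
  have -> : (1 - (w / 4 - 7 / 32 * w ^+ 2 - w ^+ 3 / 32)) * (1 + w / 4) =
     1 + 5 / 32 * w ^+ 2 + 11 / 128 * w ^+ 3 + w ^+ 4 / 128 by field.
  lra.
have xE : ((12 * (1 + d) ^ 2)%:R)^-1 = s / 3 :> R.
  by rewrite natrM natrX -/n /s; field; rewrite gt_eqF.
rewrite ler_pdivrMr // /shrink_rate xE [leRHS]mulrC ler_pdivlMr; last by lra.
apply: (@le_trans _ _ ((1 + sg) ^+ d * ((1 - d%:R * sg) * (1 + s * n)))).
  by rewrite ler_pM2l.
by rewrite mulrA -[leRHS]mul1r ler_pM2r.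
Qed.

(** By Bernoulli's inequality, [12 n ^ 2] rounds at least halve the determinant. *)
Lemma shrink_rate_iter (N : nat) : shrink_rate ^+ (12 * (1 + d) ^ 2 * N) <= 2^-1 ^+ N.
Proof.
have r0 := ltW shrink_rate_gt0.
rewrite exprM; apply: lerXn2r; rewrite ?nnegrE ?exprn_ge0 ?invr_ge0 //.
rewrite /shrink_rate exprVn lef_pV2 ?posrE ?exprn_gt0 ?ltr_pwDl //.
apply: le_trans (bernoulli_le _ _); last by rewrite (le_trans (lerN10 _)).
by rewrite divff // pnatr_eq0.
Qed.

End simplex.

(** * Euclidean geometry of the variational inequality *)

Section dotv.
Variables (K : comPzRingType) (d : nat).
Implicit Types u v w : 'rV[K]_d.

Lemma dotvC u v : dotv u v = dotv v u.
Proof. by apply: eq_bigr => i _; rewrite mulrC. Qed.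

Lemma dotvDr u v w : dotv u (v + w) = dotv u v + dotv u w.
Proof. by rewrite -big_split; apply: eq_bigr => i _; rewrite mxE mulrDr. Qed.

Lemma dotvZr (c : K) u v : dotv u (c *: v) = c * dotv u v.
Proof. by rewrite mulr_sumr; apply: eq_bigr => i _; rewrite mxE mulrCA. Qed.

Lemma dotvNr u v : dotv u (- v) = - dotv u v.
Proof. by rewrite -scaleN1r dotvZr mulN1r. Qed.

Lemma dotvBr u v w : dotv u (v - w) = dotv u v - dotv u w.
Proof. by rewrite dotvDr dotvNr. Qed.

Lemma dotvBl u v w : dotv (v - w) u = dotv v u - dotv w u.
Proof. by rewrite dotvC dotvBr !(dotvC u). Qed.

Lemma dotv0 u : dotv u 0 = 0.
Proof. by apply: big1 => i _; rewrite mxE mulr0. Qed.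

Lemma dotv_sumr (I : finType) u (l : I -> K) (V : I -> 'rV[K]_d) :
  dotv u (\sum_i l i *: V i) = \sum_i l i * dotv u (V i).
Proof.
elim/big_rec2: _ => [|i x y _ <-]; first exact: dotv0.
by rewrite dotvDr dotvZr.
Qed.

End dotv.

Section euclid.
Variables (R : rcfType) (d : nat).
Implicit Types u v w : 'rV[R]_d.

Lemma dotv_ge0 u : 0 <= dotv u u.
Proof. by apply: sumr_ge0 => i _; rewrite -expr2 sqr_ge0. Qed.

Lemma dotv_eq0 u : dotv u u = 0 -> u = 0.
Proof.
move=> h; apply/rowP => i; rewrite mxE; apply/eqP; rewrite -sqrf_eq0.
move/eqP: h; rewrite psumr_eq0 => [|j _]; last by rewrite -expr2 sqr_ge0.
by move=> /allP /(_ i); rewrite mem_index_enum -expr2; apply.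
Qed.

Lemma enorm_ge0 u : 0 <= enorm u.
Proof. exact: sqrtr_ge0. Qed.

Lemma enorm_sqr u : enorm u ^+ 2 = dotv u u.
Proof. by rewrite sqr_sqrtr // dotv_ge0. Qed.

Lemma cauchy_schwarz u v : `|dotv u v| <= enorm u * enorm v.
Proof.
rewrite -sqrtrM ?dotv_ge0 // -sqrtr_sqr ler_wsqrtr //.
have [v0|v0] := eqVneq (dotv v v) 0.
  by rewrite (dotv_eq0 v0) !dotv0 expr0n mulr0.
have c0 : 0 < dotv v v by rewrite lt_def v0 dotv_ge0.
(* Up to the factor [dotv v v], this vector is the component of [u] orthogonal to [v]. *)
have := dotv_ge0 (dotv v v *: u - dotv u v *: v).
rewrite dotvBr !dotvBl !dotvZr ![dotv (_ *: _) _]dotvC !dotvZr (dotvC v u).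
rewrite [X in 0 <= X](_ : _ = dotv v v * (dotv u u * dotv v v - dotv u v ^+ 2)).
  by rewrite pmulr_rge0 // subr_ge0.
ring.
Qed.

Lemma dotv_le_enorm u v : dotv u v <= enorm u * enorm v.
Proof. exact: le_trans (ler_norm _) (cauchy_schwarz _ _). Qed.

Lemma enormB_le u v : enorm (u - v) <= enorm u + enorm v.
Proof.
have h := enorm_ge0 u; have h' := enorm_ge0 v.
rewrite -(@ler_pXn2r _ 2) ?nnegrE ?enorm_ge0 ?addr_ge0 //.
rewrite sqrrD !enorm_sqr dotvBr !dotvBl (dotvC v u).
have := cauchy_schwarz u v; rewrite ler_norml => /andP[h1 _].
lra.
Qed.

Lemma coord_le_enorm u i : `|u 0 i| <= enorm u.
Proof.
rewrite -sqrtr_sqr ler_wsqrtr // /dotv (bigD1 i) //= -expr2 lerDl.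
by apply: sumr_ge0 => j _; rewrite -expr2 sqr_ge0.
Qed.

End euclid.

Section ratv.
Variables (R : realType) (d : nat).
Implicit Types u v : 'rV[rat]_d.

Lemma dotv_ratv u v : dotv (ratv R u) (ratv R v) = ratr (dotv u v).
Proof. by rewrite /dotv rmorph_sum; apply: eq_bigr => i _; rewrite !mxE rmorphM. Qed.

Lemma ratvB u v : ratv R (u - v) = ratv R u - ratv R v.
Proof. by rewrite /ratv raddfB. Qed.

Lemma ratvD u v : ratv R (u + v) = ratv R u + ratv R v.
Proof. by rewrite /ratv raddfD. Qed.

Lemma ratvZ c u : ratv R (c *: u) = ratr c *: ratv R u.
Proof. by rewrite /ratv map_mxZ. Qed.

End ratv.

Section geometry.
Variables (R : realType) (d : nat) (X : set 'rV[R]_d) (Rad : R).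
Hypothesis convX : convex_set (X : set (convex_lmodType 'rV[R]_d)).
Hypothesis ballX : eball 1 `<=` X.
Hypothesis Xball : X `<=` eball Rad.

Lemma convex_comb x y t : X x -> X y -> 0 <= t <= 1 -> X (t *: x + (1 - t) *: y).
Proof.
move=> Xx Xy /andP[t0 t1].
have ti : Itv.spec (@Itv.num_sem R) (Itv.Real `[0, 1]%Z) t.
  by rewrite /= /Itv.num_sem num_real /= in_itv /= t0 t1.
pose p : {i01 R} := Itv.mk ti.
have := convX p (mem_set Xx) (mem_set Xy).
by move=> /set_mem.
Qed.

Lemma Rad_ge1 : (0 < d)%N -> 1 <= Rad.
Proof.
move=> d0; pose u : 'rV[R]_d := \row_j (j == Ordinal d0)%:R.
have u1 : enorm u = 1.
  rewrite /enorm /dotv (bigD1 (Ordinal d0)) //= !mxE eqxx mul1r big1 ?addr0 ?sqrtr1 //.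
  by move=> i /negbTE ne; rewrite !mxE ne mulr0.
have : X u by apply: ballX; rewrite /eball /= u1.
by move=> /Xball; rewrite /eball /= u1.
Qed.

Lemma dist_le x y : X x -> X y -> enorm (x - y) <= 2 * Rad.
Proof.
move=> /Xball h1 /Xball h2; apply: le_trans (enormB_le _ _) _.
by move: h1 h2; rewrite /eball /=; lra.
Qed.

Definition improving (f a : 'rV[R]_d) (eps : R) (w : 'rV[R]_d) : Prop :=
  X w /\ dotv f (w - a) < - (eps / 2).

(* The shrunken simplex spanned by [(1 - t) x + t u] for [u] in
   [{0, e_1, ..., e_d}] consists of points that are still improving. *)
Lemma no_improvement (f a : 'rV[R]_d) (eps B rho : R) (V : 'M[R]_(1 + d, d)) :
  X a -> 0 < eps -> enorm f <= B -> Rad <= rho -> 0 <= rho -> 0 < B ->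
  ((exists w, improving f a eps w) ->
    (forall w, improving f a eps w -> in_simplex V w) /\
    `|\det (homog V)| < (eps / (2 * (eps + B * (1 + rho)))) ^+ d) ->
  forall x, X x -> - eps <= dotv f (x - a).
Proof.
move=> Xa e0 fB Rr r0 B0 HV x Xx; rewrite leNgt; apply/negP => hx.
set t := eps / (2 * (eps + B * (1 + rho))) in HV.
have Br : 0 <= B * (1 + rho) by rewrite mulr_ge0 ?addr_ge0 // ltW.
have D0 : 0 < 2 * (eps + B * (1 + rho)) by lra.
have t0 : 0 < t by rewrite divr_gt0.
(* This equation dictates [t]: the value at the contracted point is below
   [- (1 - t) * eps + t * B * (1 + rho)], which then equals [- eps / 2]. *)
have tE : t * (eps + B * (1 + rho)) = eps / 2.
  by rewrite /t; field; rewrite gt_eqF //; lra.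
have t1 : t <= 1 by rewrite /t ler_pdivrMr //; lra.
have imp i : improving f a eps (row i (corner ((1 - t) *: x) t)).
  pose u : 'rV[R]_d := \row_j (i == j.+1 :> nat)%:R.
  have rE : row i (corner ((1 - t) *: x) t) = t *: u + (1 - t) *: x.
    by apply/rowP => j; rewrite !mxE addrC.
  have u1 : enorm u <= 1.
    rewrite -sqrtr1 ler_wsqrtr // /dotv.
    case: (unliftP (@ord0 d) i) => [j|] ie; last first.
      by rewrite big1 ?ler01 // => l _; rewrite mxE ie /= mul0r.
    rewrite (bigD1 j) //= big1 ?addr0 => [|l lj]; last first.
      rewrite mxE ie /= /bump /= add1n eqSS.
      by rewrite eq_sym (negbTE (lj : (l : nat) != j)) mulr0.
    by rewrite mxE ie /= /bump /= add1n eqxx mulr1.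
  have Xu : X u by exact: ballX.
  rewrite rE; split; first by apply: convex_comb => //; rewrite (ltW t0).
  have -> : t *: u + (1 - t) *: x - a = t *: (u - a) + (1 - t) *: (x - a).
    by apply/rowP => j; rewrite !mxE; ring.
  rewrite dotvDr !dotvZr.
  have h1 : dotv f (u - a) <= B * (1 + rho).
    apply: le_trans (dotv_le_enorm _ _) _; apply: ler_pM; rewrite ?enorm_ge0 //.
    apply: le_trans (enormB_le _ _) _; apply: lerD => //.
    exact: le_trans (Xball Xa) Rr.
  have h2 : t * dotv f (u - a) <= t * (B * (1 + rho)) by rewrite ler_pM2l.
  have t1' : t < 1 by rewrite /t ltr_pdivrMr //; lra.
  have h3 : (1 - t) * dotv f (x - a) < (1 - t) * - eps by rewrite ltr_pM2l // subr_gt0.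
  lra.
have [|h1 h2] := HV; first by exists (row 0 (corner ((1 - t) *: x) t)).
have := simplex_det_le (fun i => h1 _ (imp i)).
rewrite det_corner ger0_norm ?exprn_ge0 ?(ltW t0) // => h3.
by have := le_lt_trans h3 h2; rewrite ltxx.
Qed.

Variables (F : 'rV[R]_d -> 'rV[R]_d) (L B : R).
Hypotheses (L0 : 0 < L) (B0 : 0 < B).
Hypotheses (lipF : elipschitz X F L) (bndF : ebounded X F B).

(** The step [lam] is the longest one in [[0, 1]] for which the Lipschitz error [L * lam * D] is at
    most [eps / 4]. It involves the squared distance only, so it is rational on rational data.
    Dividing by [B] in the third claim anticipates the normalization of [F b], whose coordinates are
    at most [B] in absolute value. *)
Lemma extragradient_cut (a z : 'rV[R]_d) (eps : R) :
  let D := dotv (z - a) (z - a) in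
  let lam := Num.min 1 (eps / (4 * L * D)) in
  let b := a + lam *: (z - a) in
  X a -> 0 < eps -> improving (F a) a eps z ->
  [/\ X b, dotv (F b) (z - a) < 0,
      eps ^+ 2 / (64 * Rad ^+ 2 * L * B + 16 * Rad * B ^+ 2) <= lam * eps / (4 * B)
    & forall x, mvi X F x -> dotv (F b) x <= dotv (F b) a - lam * eps / 4].
Proof.
move=> D lam b Xa e0 [Xz hz].
have D0 : 0 < D.
  rewrite lt_def dotv_ge0 andbT; apply/eqP => /dotv_eq0 h.
  by move: hz; rewrite h dotv0; lra.
have LD : 0 < 4 * L * D by rewrite !mulr_gt0.
have lam0 : 0 < lam by rewrite lt_min ltr01 divr_gt0.
have lam1 : lam <= 1 by rewrite ge_min lexx.
have lamD : L * lam * D <= eps / 4.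
  have : lam <= eps / (4 * L * D) by rewrite ge_min lexx orbT.
  rewrite ler_pdivlMr //; lra.
have bE : b = lam *: z + (1 - lam) *: a.
  by apply/rowP => j; rewrite !mxE; ring.
have Xb : X b by rewrite bE; apply: convex_comb => //; rewrite (ltW lam0).
have dec : dotv (F b) (z - a) <= - (eps / 4).
  have -> : dotv (F b) (z - a) = dotv (F a) (z - a) + dotv (F b - F a) (z - a).
    by rewrite dotvBl; ring.
  have h1 : dotv (F b - F a) (z - a) <= L * lam * D.
    apply: le_trans (dotv_le_enorm _ _) _.
    have h2 : enorm (b - a) = lam * enorm (z - a).
      rewrite /b addrAC subrr add0r /enorm dotvZr dotvC dotvZr mulrA -expr2.
      by rewrite sqrtrM ?sqr_ge0 // sqrtr_sqr gtr0_norm.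
    apply: (@le_trans _ _ (L * enorm (b - a) * enorm (z - a))).
      by rewrite ler_wpM2r ?enorm_ge0 //; exact: lipF.
    by rewrite h2 -!mulrA -expr2 enorm_sqr.
  lra.
split=> //; first by lra.
- have dR := dist_le Xz Xa.
  have R0 : 0 < Rad.
    have : 0 < enorm (z - a).
      by rewrite lt_def enorm_ge0 andbT -sqrf_eq0 enorm_sqr gt_eqF.
    lra.
  have DR : D <= 4 * Rad ^+ 2.
    rewrite /D -enorm_sqr; have -> : 4 * Rad ^+ 2 = (2 * Rad) ^+ 2 by ring.
    by rewrite ler_pXn2r ?nnegrE ?enorm_ge0 //; lra.
  (* An improving point forces [eps / 2] below [B] times the diameter bound [2 * Rad]. *)
  have eR : eps <= 4 * Rad * B.
    have h := cauchy_schwarz (F a) (z - a).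
    have h1 : enorm (F a) * enorm (z - a) <= B * (2 * Rad).
      by apply: ler_pM; rewrite ?enorm_ge0 //; exact: bndF.
    have := ler_norm (- dotv (F a) (z - a)); rewrite normrN; lra.
  have q1 : 0 < 64 * Rad ^+ 2 * L * B by rewrite !mulr_gt0 ?exprn_gt0.
  have q2 : 0 < 16 * Rad * B ^+ 2 by rewrite !mulr_gt0 ?exprn_gt0.
  (* Each branch of the minimum accounts for one summand of the denominator: [lam = 1] with
     [eps <= 4 * Rad * B] for the one with [B ^+ 2], the other branch with [D <= 4 * Rad ^+ 2] for
     the one with [L]. *)
  rewrite ler_pdivrMr ?addr_gt0 // /lam; case: (leP 1 (eps / (4 * L * D))) => _.
    rewrite mul1r mulrAC ler_pdivlMr ?mulr_gt0 //.
    have : eps * eps <= eps * (4 * Rad * B) by rewrite ler_pM2l.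
    move=> h; have : eps * eps * (4 * B) <= eps * (4 * Rad * B) * (4 * B).
      by rewrite ler_pM2r // mulr_gt0.
    have : 0 < eps * (64 * Rad ^+ 2 * L * B) by rewrite mulr_gt0.
    rewrite !expr2; lra.
  rewrite -[X in X <= _]mulr1 -[X in _ <= X](_ : eps ^+ 2 * ((64 * Rad ^+ 2 * L * B + 16 * Rad * B ^+ 2) / (4 * L * D * (4 * B))) = _); last first.
    by field; rewrite !gt_eqF.
  rewrite ler_pM2l ?exprn_gt0 // ler_pdivlMr ?mulr_gt0 // mul1r.
  have : 16 * L * B * D <= 16 * L * B * (4 * Rad ^+ 2) by rewrite ler_pM2l // !mulr_gt0.
  lra.
- move=> x [Xx /(_ b Xb)]; rewrite dotvBr => h.
  have : dotv (F b) b = dotv (F b) a + lam * dotv (F b) (z - a).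
    by rewrite /b dotvDr dotvZr.
  have : lam * dotv (F b) (z - a) <= lam * - (eps / 4) by rewrite ler_pM2l.
  lra.
Qed.

End geometry.

(** * Evaluation rules for compound expressions *)

Section expressions.
Variables (s : state) (b : nat).

Lemma ev_add e1 e2 x y : evaluates_to s b e1 x -> evaluates_to s b e2 y ->
  evaluates_to s b (Bin Add e1 e2) (x + y).
Proof. exact: ev_bin. Qed.

Lemma ev_sub e1 e2 x y : evaluates_to s b e1 x -> evaluates_to s b e2 y ->
  evaluates_to s b (Bin Defs.Sub e1 e2) (x - y).
Proof. exact: ev_bin. Qed.

Lemma ev_mul e1 e2 x y : evaluates_to s b e1 x -> evaluates_to s b e2 y ->
  evaluates_to s b (Bin Mul e1 e2) (x * y).
Proof. exact: ev_bin. Qed.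

Lemma ev_div e1 e2 x y : evaluates_to s b e1 x -> evaluates_to s b e2 y ->
  evaluates_to s b (Bin Div e1 e2) (x / y).
Proof. exact: ev_bin. Qed.

Lemma ev_eq e x y : evaluates_to s b e x -> x = y -> evaluates_to s b e y.
Proof. by move=> h <-. Qed.

Lemma ev_nat n : (n < b)%N -> evaluates_to s b (Cst n%:R) n%:R.
Proof. by move=> h; apply: ev_cst; apply: height_nat; lia. Qed.

Lemma ev_regnat r n : reg s r = n%:R -> (n < b)%N -> evaluates_to s b (Reg r) n%:R.
Proof. by move=> h nb; apply: ev_reg => //; apply: height_nat; lia. Qed.

Lemma ev_affine e1 e2 e3 x y z :
  evaluates_to s b e1 x%:R -> evaluates_to s b e2 y%:R -> evaluates_to s b e3 z%:R ->
  evaluates_to s b (Bin Add (Bin Mul e1 e2) e3) (x * y + z)%:R.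
Proof.
move=> h1 h2 h3; apply: ev_eq (ev_add (ev_mul h1 h2) h3) _.
by rewrite natrD natrM.
Qed.

(** Builds the coefficients of a fixed polynomial into the program, which thereby computes its own
    bound on the radius from [d]. *)
Definition horner_expr (p : seq nat) (e : expr) : expr :=
  foldr (fun c acc => Bin Add (Bin Mul acc e) (Cst c%:R)) (Cst 0) p.

Lemma ev_horner (p : {poly nat}) e n : evaluates_to s b e n%:R ->
  (forall c, c \in (p : seq nat) -> (c < b)%N) -> (0 < b)%N ->
  evaluates_to s b (horner_expr p e) (p.[n])%:R.
Proof.
move=> h; rewrite /horner; elim: (p : seq nat) => [|c l IH] hc b0 /=.
  exact: (@ev_nat 0).
apply: ev_eq (ev_add (ev_mul (IH _ b0) h) (ev_nat (hc c _))) _.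
- by move=> c' cl; apply: hc; rewrite inE cl orbT.
- by rewrite inE eqxx.
- by rewrite -natrM -natrD.
Qed.

End expressions.

Section tabulate.
Variables (d : nat) (O : oracles d).

Definition TabSum (A io ro r i ri : nat) (e e2 : expr) : cmd :=
  For io ro (Seq (Sum r i ri e) (Store A (Reg io) e2)).

Definition tabsum_bound (k k2 b : nat) : nat :=
  for_bound b (sum_bound k b +
    (ecost_bound 1 b + ecost_bound k2 (b + sum_height k b))).

Lemma ev_le s b b' e x : (b <= b')%N -> evaluates_to s b e x -> evaluates_to s b' e x.
Proof.
move=> bb [h r]; split=> //; elim: e {h} r => //=.
- by move=> q h; apply: leq_trans bb.
- by move=> q h; apply: leq_trans bb.
- by move=> A e IH [/IH h1 h2]; split=> //; apply: leq_trans bb.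
- by move=> o e1 IH1 e2 IH2 [/IH1 h1 /IH2 h2].
Qed.

(** The centroid and the slacks both have this shape, one sum for each outer index followed by a
    function of the sum. [e2] reads the accumulator, hence the larger bound for it. *)
Lemma runs_tabsum A io ro r i ri e e2 M m s b (g : nat -> nat -> rat) (G : nat -> rat) :
  reg s ro = M%:R -> reg s ri = m%:R -> (M < b)%N -> (m < b)%N ->
  uniq [:: io; r; i; ri] -> ro \notin [:: io; r; i] ->
  (forall x k s1, (x < M)%N -> (k < m)%N -> frame [:: io; r; i] [:: A] s s1 ->
     reg s1 io = x%:R -> reg s1 i = k%:R -> evaluates_to s1 b e (g x k)) ->
  (forall x s1, (x < M)%N -> frame [:: io; r; i] [:: A] s s1 ->
     reg s1 io = x%:R -> reg s1 r = \sum_(k < m) g x k ->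
     (height (reg s1 r) <= sum_height (esize e) b)%N ->
     evaluates_to s1 (b + sum_height (esize e) b) e2 (G x)) ->
  runs O (TabSum A io ro r i ri e e2) s
    (fun s' => [/\ forall x, (x < M)%N -> Defs.mem s' A x = G x,
       forall x, (x < M)%N ->
         (height (G x) <= esize e2 * (b + sum_height (esize e) b + 1))%N
     & frame [:: io; r; i] [:: A] s s'])
    (tabsum_bound (esize e) (esize e2) b).
Proof.
move=> hM hm Mb mb uq nro he he2.
pose I x s1 := (forall y, (y < x)%N -> Defs.mem s1 A y = G y) /\
  (forall y, (y < x)%N ->
         (height (G y) <= esize e2 * (b + sum_height (esize e) b + 1))%N).
move: uq nro; rewrite /= !inE !negb_or -!andbA andbT.
move=> /and5P[ior ioi iori ri_ /andP[rri iri]] /and3P[roio ror roi].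
have [||||| |s' [t [ex ht [[i1 h1] f1]]]] := @runs_for d O I io ro M
  (Seq (Sum r i ri e) (Store A (Reg io) e2)) s b
  (sum_bound (esize e) b +
    (ecost_bound 1 b + ecost_bound (esize e2) (b + sum_height (esize e) b))) hM.
- by [].
- by rewrite /= !inE !negb_or ror roi.
- by rewrite /= !inE !negb_or ior ioi.
- by [].
- by [].
- move=> x s1 xM [Ix hx] fx rx.
  have fx' : frame [:: io; r; i] [:: A] s s1.
    by apply: frame_sub fx => y; rewrite /= !inE // => /or4P[]->; rewrite ?orbT.
  apply: runs_seq.
    apply: (@runs_sum _ O r i ri e m s1 b (g x)).
    + by rewrite (proj1 fx') // !inE !negb_or !(eq_sym ri) iori rri iri.
    + by rewrite /= !inE negb_or ri_ rri iri.
    + by [].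
    + move=> k s2 km f2 r2; apply: he => //.
        apply: frame_trans fx' _; apply: frame_sub f2 => // y.
        by rewrite !inE => ->; rewrite orbT.
      by rewrite (proj1 f2) // !inE negb_or ior.
  move=> s2 [r2 h2 f2] _.
  have f2' : frame [:: io; r; i] [:: A] s s2.
    apply: frame_trans fx' _; apply: frame_sub f2 => // y.
    by rewrite !inE => ->; rewrite orbT.
  have io2 : reg s2 io = x%:R by rewrite (proj1 f2) // !inE negb_or ior.
  have ev1 : evaluates_to s2 b (Reg io) x%:R by apply: ev_regnat => //; lia.
  have ev2 := he2 _ _ xM f2' io2 r2 h2.
  have ev1' := ev_le (leq_addr (sum_height (esize e) b) b) ev1.
  exists (set_cell s2 A x (G x)), (ecost s2 (Reg io) + ecost s2 e2)%N; split.
  + rewrite -[in set_cell _ _ x](natrK (R := rat) x).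
    case: ev1 => <- _; case: ev2 => <- _; exact: ExStore.
  + by apply: leq_add; [exact: ev_cost ev1|exact: ev_cost ev2].
  + split=> y; rewrite ltnS leq_eqVlt => /predU1P[->|yx].
    * by rewrite /= /upd !eqxx.
    * rewrite /= /upd eqxx ltn_eqF // -(Ix _ yx); case: f2 => _ -> //.
    * exact: ev_height ev2.
    * exact: hx.
- exists s', t; split=> //; split=> //.
  by apply: frame_sub f1 => y; rewrite /= !inE // => /or4P[]->; rewrite ?orbT.
Qed.

Definition LogLoop (m p t : nat) : cmd :=
  Seq (Assign m (Cst 0)) (Seq (Assign p (Cst 1))
    (While (Bin Leq (Reg p) (Reg t))
      (Seq (Assign p (Bin Add (Reg p) (Reg p))) (Assign m (Bin Add (Reg m) (Cst 1)))))).

Definition log_bound (b : nat) : nat := (b.+2 * (100 * (b + 4)))%N.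

Lemma lt_expn_height (x : rat) : x < (2 ^ height x)%:R.
Proof.
apply: (@le_lt_trans _ _ (`|numq x|%N)%:R); last by rewrite ltr_nat height_num.
have d1 : 1 <= (denq x)%:~R :> rat by rewrite ler1z -gtz0_ge1 denq_gt0.
apply: (le_trans (ler_norm x)).
rewrite -{1}(divq_num_den x) normrM normfV -!intr_norm natr_absz.
rewrite [`|denq x|%R]ger0_norm ?denq_ge0 // ler_pdivrMr ?(lt_le_trans ltr01) //.
by rewrite ler_peMr // intr_norm.
Qed.

(** Doubling stops at the least [k] with [x < 2 ^ k]; since [x < 2 ^ height x], the number of rounds
    is linear in the bit length. *)
Lemma runs_log m p t s b (x : rat) : reg s t = x -> uniq [:: m; p; t] ->
  (height x < b)%N ->
  runs O (LogLoop m p t) s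
    (fun s' => [/\ exists2 k, reg s' m = k%:R & (k <= height x)%N /\ x < (2 ^ k)%:R
     & frame [:: m; p] [::] s s'])
    (log_bound b).
Proof.
rewrite /= !inE negb_or andbT => ht /andP[/andP[mp mt] pt] xb.
have ex : exists k, x < (2 ^ k)%:R by exists (height x); exact: lt_expn_height.
case: (ex_minnP ex) => J hJ minJ.
have Jh : (J <= height x)%N by apply: minJ; exact: lt_expn_height.
pose I k s1 := [/\ reg s1 m = k%:R, reg s1 p = (2 ^ k)%:R & frame [:: m; p] [::] s s1].
have hp k : (k <= J)%N -> (height (2 ^ k)%:R <= b)%N.
  move=> kJ; rewrite -[_%:R]/((2 ^ k)%N%:Z%:~R); apply: height_int => //=; first lia.
  by rewrite ltn_exp2l //; lia.
have hb k : (k <= J)%N -> (height k%:R <= b)%N by move=> ?; apply: height_nat; lia.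
have I0 : I 0%N (set_reg (set_reg s m 0) p 1).
  split; rewrite /= /upd ?eqxx ?(negbTE mp) //.
  apply: (@frame_trans _ _ _ (set_reg s m 0)).
    by apply: frame_set_reg; rewrite inE eqxx.
  by apply: frame_set_reg; rewrite !inE eqxx orbT.
have test k s1 : (k <= J)%N -> I k s1 ->
    evaluates_to s1 b (Bin Leq (Reg p) (Reg t)) ((2 ^ k)%:R <= x)%R%:R.
  move=> kJ [rm rp fr]; apply: ev_leq; first by apply: ev_reg; rewrite ?rp ?hp.
  apply: ev_reg; last exact: ltnW.
  by rewrite (proj1 fr) // !inE negb_or !(eq_sym t) mt pt.
have W : runs O (While (Bin Leq (Reg p) (Reg t))
     (Seq (Assign p (Bin Add (Reg p) (Reg p))) (Assign m (Bin Add (Reg m) (Cst 1)))))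
     (set_reg (set_reg s m 0) p 1) (I J)
     (J.+1 * (ecost_bound 3 b + (ecost_bound 3 b + ecost_bound 3 b))).
  apply: runs_while I0 _ _.
    move=> k s3 kJ i3; split.
      have := test _ _ (ltnW kJ) i3; rewrite leNgt.
      case: ltP => // lt; have := minJ _ lt; lia.
    case: i3 => rm rp fr.
    apply: runs_seq.
      apply: (@runs_assign _ O _ _ _ (fun s4 => s4 = set_reg s3 p (2 ^ k.+1)%:R) b) => //.
      apply: ev_eq (ev_add (ev_reg rp (hp _ (ltnW kJ))) (ev_reg rp (hp _ (ltnW kJ)))) _.
      by rewrite -natrD addnn -mul2n expnS.
    move=> _ -> _; apply: (@runs_assign _ O _ _ _ _ b k.+1%:R).
      apply: ev_eq (ev_add (ev_reg _ (hb _ (ltnW kJ))) (ev_cst _ (hp 0%N isT))) _.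
        by rewrite /= /upd (negbTE mp) rm.
      by rewrite -natrD addn1.
    split.
    - by rewrite /= /upd eqxx.
    - by rewrite /= /upd eq_sym (negbTE mp) eqxx.
    - apply: frame_trans fr _; apply: (@frame_trans _ _ _ (set_reg s3 p (2 ^ k.+1)%:R)).
        by apply: frame_set_reg; rewrite !inE eqxx orbT.
      by apply: frame_set_reg; rewrite inE eqxx.
  move=> s3 i3; have := test _ _ (leqnn J) i3.
  by rewrite leNgt hJ.
have H : runs O (LogLoop m p t) s (I J) (ecost_bound 1 b + (ecost_bound 1 b +
    J.+1 * (ecost_bound 3 b + (ecost_bound 3 b + ecost_bound 3 b)))).
  apply: runs_seq (runs_assign (Q := fun s1 => s1 = set_reg s m 0) O
    (ev_cst _ (hb 0%N isT)) erefl) _ => _ -> _.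
  apply: runs_seq (runs_assign (Q := fun s1 => s1 = set_reg (set_reg s m 0) p 1) O
    (ev_cst _ (hp 0%N isT)) erefl) _ => _ -> _.
  exact: W.
apply: runs_weaken H _ _.
  by move=> s' [rm rp fr]; split=> //; exists J.
rewrite /ecost_bound /log_bound /=.
have h : (J.+1 * (27 * (b + 1) + (27 * (b + 1) + 27 * (b + 1))) <=
          b * (81 * (b + 1)))%N by apply: leq_mul; lia.
by nia.
Qed.

End tabulate.

Lemma leq_horner (p : {poly nat}) m n : (m <= n)%N -> (p.[m] <= p.[n])%N.
Proof.
move=> mn; rewrite /horner; elim: (p : seq nat) => //= c l IH.
by apply: leq_add => //; apply: leq_mul.
Qed.

(** * The search loop *)

(* Registers: 0 holds d (at the end, the verdict), 1 eps, 2 L, 3 B, 4 n = d + 1,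
   5 the radius bound rho, 6 the threshold 2 d rho / t, 7 its logarithm m, 8 the power
   2 ^ m, 9 the number of iterations, 10 whether a point z was found, 11 to 13 loop
   counters, 14 sums, 15 the answer of the separation oracle, 16 the index of a minimum,
   17 a contraction factor, 18 the step length lam.
   Arrays: 0 holds a (at the end, the cut), 1 f = F(a), 2 the centroid z, 3 the vertices
   in row-major order, 4 the cut at z, 5 the slacks <c, v_i - z>, 6 the fixed vertex,
   7 the point b, 8 F(b), 9 the negated absolute values of its coordinates. *)
Definition vertex_cell (i j : expr) : expr := Cell 3 (Bin Add (Bin Mul i (Reg 0)) j).

Definition CentroidLoop : cmd :=
  TabSum 2 12 0 14 13 4 (vertex_cell (Reg 13) (Reg 12)) (Bin Div (Reg 14) (Reg 4)).

Definition TestLoop : cmd :=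
  Seq (Sum 14 12 0 (Bin Mul (Cell 1 (Reg 12)) (Bin Defs.Sub (Cell 2 (Reg 12)) (Cell 0 (Reg 12)))))
    (If (Bin Leq (Bin Defs.Sub (Cst 0) (Bin Div (Reg 1) (Cst 2%:R))) (Reg 14))
      (Fill 4 12 0 (Cst 0) (Cell 1 (Reg 12)))
      (Assign 10 (Cst 1))).

Definition SlackLoop : cmd :=
  TabSum 5 13 4 14 12 0
    (Bin Mul (Cell 4 (Reg 12)) (Bin Defs.Sub (vertex_cell (Reg 13) (Reg 12)) (Cell 2 (Reg 12))))
    (Reg 14).

Definition cubeK : expr := Bin Mul (Cst 64%:R) (Bin Mul (Reg 4) (Bin Mul (Reg 4) (Reg 4))).
Definition pivotQm : expr :=
  Bin Mul (Bin Add (Bin Mul (Cst 4%:R) (Bin Mul (Reg 4) (Reg 4))) (Cst 1%:R))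
    (Bin Defs.Sub (Cst 0) (Cell 5 (Reg 16))).
Definition contraction_expr : expr :=
  Bin Div (Bin Add (Floor (Bin Mul cubeK
      (Bin Div pivotQm (Bin Add pivotQm (Cell 5 (Reg 13)))))) (Cst 1%:R)) cubeK.

Definition shrunk_cell : expr :=
  Bin Add (Cell 6 (Reg 12)) (Bin Mul (Reg 17)
    (Bin Defs.Sub (vertex_cell (Reg 13) (Reg 12)) (Cell 6 (Reg 12)))).

Definition ShrinkLoop : cmd :=
  For 13 4 (Seq (Assign 17 contraction_expr)
    (Fill 3 12 0 (Bin Mul (Reg 13) (Reg 0)) shrunk_cell)).

Definition UpdateStep : cmd :=
  Seq SlackLoop (Seq (Argmin 5 16 13 4)
    (Seq (Fill 6 12 0 (Cst 0) (vertex_cell (Reg 16) (Reg 12))) ShrinkLoop)).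

Definition Separate : cmd := Seq (CallSep 2 15 4) (If (Reg 15) Skip TestLoop).

Definition LoopBody : cmd :=
  Seq CentroidLoop (Seq Separate (If (Reg 10) Skip UpdateStep)).

Lemma row_index_other d i i' j : i' != i -> (j < d)%N ->
  (i * d <= i' * d + j < i * d + d)%N = false.
Proof.
move=> ne jd; case: (ltngtP i' i) ne => // lt _.
  have : (i'.+1 * d <= i * d)%N by rewrite leq_mul2r lt orbT.
  by rewrite mulSn; lia.
have : (i.+1 * d <= i' * d)%N by rewrite leq_mul2r lt orbT.
by rewrite mulSn; lia.
Qed.

Lemma array_ofE d (x : 'rV[rat]_d) (j : 'I_d) : array_of x j = x 0 j.
Proof. by rewrite /array_of valK. Qed.

Lemma height_array_of d (x : 'rV[rat]_d) j : (j < d)%N -> (height (array_of x j) <= vbits x)%N.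
Proof.
move=> jd; rewrite (array_ofE x (Ordinal jd)) /vbits (bigD1 (Ordinal jd)) //=.
by apply: leq_trans (height_qbits _) _; rewrite leq_addr.
Qed.

Lemma vbits_le d (x : 'rV[rat]_d) h : (forall j, (height (x 0%R j) <= h)%N) ->
  (vbits x <= d * (2 * h + 1))%N.
Proof.
move=> H; rewrite /vbits -[X in (_ <= X * _)%N](card_ord d) -sum_nat_const.
apply: leq_sum => j _; apply: leq_trans (qbits_height _) _.
by have := H j; lia.
Qed.

(** * One round of the search *)

Section body.
Variables (d : nat) (O : oracles d) (a f : nat -> rat) (eps : rat).
Let n := d.+1.

Definition centroid (v : nat -> nat -> rat) j : rat := (\sum_(i < n) v i j) / n%:R.

Definition slack (v : nat -> nat -> rat) (c : nat -> rat) i : rat :=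
  \sum_(j < d) c j * (v i j - centroid v j).

(** The floor plus 1 always rounds up, by at most [1 / K]. The shape, including [0 - h k], copies
    [contraction_expr], so that the evaluation rules produce this very term. *)
Definition contraction (h : nat -> rat) k i : rat :=
  let K := 64%:R * (n%:R * (n%:R * n%:R)) in
  let Qm := (4%:R * (n%:R * n%:R) + 1%:R) * (0 - h k) in
  ((Num.floor (K * (Qm / (Qm + h i))))%:~R + 1%:R) / K.

Definition shrunk (v : nat -> nat -> rat) (h : nat -> rat) k i j : rat :=
  v k j + contraction h k i * (v i j - v k j).

Definition centroid_row v : 'rV[rat]_d := \row_j centroid v j.

Definition improves (z : nat -> rat) : bool :=
  \sum_(j < d) f j * (z j - a j) < 0 - eps / 2%:R.

Definition valid_cut v (c : nat -> rat) : Prop :=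
  sep O (centroid_row v) = Some (\row_j c j) \/
  [/\ sep O (centroid_row v) = None, ~~ improves (centroid v) &
      forall j, (j < d)%N -> c j = f j].

(** A relation, because the minimal slack may be attained at several vertices and the one picked by
    the program need not be known. *)
Definition step v v' : Prop :=
  exists c k, [/\ (k < n)%N, valid_cut v c,
    forall i, (i < n)%N -> slack v c k <= slack v c i &
    forall i j, (i < n)%N -> (j < d)%N -> v' i j = shrunk v (slack v c) k i j].

Record persistent (s : state) : Prop := Persistent {
  pers_d : reg s 0 = d%:R;
  pers_eps : reg s 1 = eps;
  pers_n : reg s 4 = n%:R;
  pers_a : forall j, (j < d)%N -> Defs.mem s 0%N j = a j;
  pers_f : forall j, (j < d)%N -> Defs.mem s 1%N j = f j }.

Definition holds_matrix (s : state) v : Prop :=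
  forall i j, (i < n)%N -> (j < d)%N -> Defs.mem s 3%N (i * d + j)%N = v i j.

Lemma persistent_frame rs As s s' : frame rs As s s' ->
  0%N \notin rs -> 1%N \notin rs -> 4%N \notin rs -> 0%N \notin As -> 1%N \notin As ->
  persistent s -> persistent s'.
Proof.
move=> [fr fm] h0 h1 h4 a0 a1 [p0 p1 p4 pa pf].
by split; rewrite ?fr // => j jd; rewrite fm // (pa, pf).
Qed.

Lemma holds_frame rs As s s' v : frame rs As s s' -> 3%N \notin As ->
  holds_matrix s v -> holds_matrix s' v.
Proof. by move=> [fr fm] h hv i j i_n jd; rewrite fm // hv. Qed.

Variables (pS : {poly nat}) (v : nat -> nat -> rat) (b : nat).
Hypothesis (b_large : (n + 64 < b)%N).
Hypothesis (hv : forall i j, (i < n)%N -> (j < d)%N -> (height (v i j) <= b)%N).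
Hypothesis (ha : forall j, (j < d)%N -> (height (a j) <= b)%N).
Hypothesis (hf : forall j, (j < d)%N -> (height (f j) <= b)%N).
Hypothesis (heps : (height eps <= b)%N).

Lemma n_lt_b : (n < b)%N.
Proof. by move: b_large; lia. Qed.

Lemma d_lt_b : (d < b)%N. Proof. exact: ltn_trans (ltnSn d) n_lt_b. Qed.

Lemma ev_vertex s b' ei ej i j : (b <= b')%N -> persistent s -> holds_matrix s v ->
  (i < n)%N -> (j < d)%N ->
  evaluates_to s b' ei i%:R -> evaluates_to s b' ej j%:R ->
  evaluates_to s b' (vertex_cell ei ej) (v i j).
Proof.
move=> bb ps hs i_n jd hi hj; apply: ev_cell (hs _ _ i_n jd) _.
  apply: ev_affine => //; apply: ev_regnat (pers_d ps) _.
  exact: leq_trans d_lt_b bb.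
by apply: leq_trans bb; apply: hv.
Qed.

(** First of a chain of bounds [b <= bz <= bc <= bh <= bal] for the quantities of one round, each
    polynomial in the one before. The chain never feeds back into [b]: the heights of the new
    vertices are bounded independently, from their common denominator. *)
Definition centroid_height : nat := (b + 3 * (b + sum_height 6 b + 1))%N.
Notation bz := centroid_height.

Lemma leq_bz : (b <= bz)%N. Proof. exact: leq_addr. Qed.

Lemma runs_centroid s : persistent s -> holds_matrix s v ->
  runs O CentroidLoop s
    (fun s' => [/\ forall j, (j < d)%N -> Defs.mem s' 2%N j = centroid v j,
       forall j, (j < d)%N -> (height (centroid v j) <= bz)%N
     & frame [:: 12; 14; 13]%N [:: 2%N] s s'])
    (tabsum_bound 6 3 b).
Proof.
move=> ps hs; have nb := n_lt_b; have db := d_lt_b.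
have := @runs_tabsum d O 2 12 0 14 13 4 (vertex_cell (Reg 13) (Reg 12))
  (Bin Div (Reg 14) (Reg 4)) d n s b (fun j i => v i j) (centroid v).
case=> //.
- exact: pers_d.
- exact: pers_n.
- move=> j i s1 jd i_n fr r12 r13.
  apply: ev_vertex => //; first exact: persistent_frame fr _ _ _ _ _ ps.
  + exact: holds_frame fr _ hs.
  + by apply: ev_regnat => //; lia.
  + by apply: ev_regnat => //; lia.
- move=> j s1 jd fr r12 r14 h14.
  apply: ev_div; first by apply: ev_reg => //; rewrite -r14; apply: leq_trans h14 (leq_addl _ _).
  apply: ev_regnat; last by lia.
  by rewrite (proj1 fr) // pers_n.
- move=> s' [t [ex ht [i1 h1 f1]]]; exists s', t; split=> //; split=> //.
  move=> j jd; apply: leq_trans (h1 _ jd) (leq_addl _ _).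
Qed.

Hypothesis sepO : sep_bits O pS.

Definition query_bits : nat := (b * (2 * bz + 1))%N.

Definition cut_height : nat := (bz + pS.[query_bits])%N.
Notation bc := cut_height.

Lemma leq_bc : (bz <= bc)%N. Proof. exact: leq_addr. Qed.

Definition test_bound : nat :=
  (sum_bound 8 bz + (ecost_bound 7 (bz + sum_height 8 bz) + fill_bound 1 2 b + ecost_bound 1 b))%N.

Lemma runs_test s : persistent s -> reg s 10 = 0 ->
  (forall j, (j < d)%N -> Defs.mem s 2%N j = centroid v j) ->
  (forall j, (j < d)%N -> (height (centroid v j) <= bz)%N) ->
  runs O TestLoop s
    (fun s' => [/\ frame [:: 14; 12; 10]%N [:: 4%N] s s',
       improves (centroid v) -> reg s' 10 = 1 &
       ~~ improves (centroid v) -> reg s' 10 = 0 /\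
         forall j, (j < d)%N -> Defs.mem s' 4%N j = f j])
    test_bound.
Proof.
move=> ps r10 hz hzh; have nb := n_lt_b; have db := d_lt_b; have bb := leq_bz.
apply: runs_seq.
  apply: (@runs_sum d O 14 12 0 _ d s bz (fun j => f j * (centroid v j - a j))) => //.
  - exact: pers_d.
  - by lia.
  - move=> j s1 jd fr r12.
    have ps1 := persistent_frame fr isT isT isT isT isT ps.
    have ej : evaluates_to s1 bz (Reg 12) j%:R by apply: ev_regnat => //; lia.
    apply: ev_mul; first by apply: ev_cell ej (pers_f ps1 jd) _; apply: leq_trans (hf jd) bb.
    apply: ev_sub; last by apply: ev_cell ej (pers_a ps1 jd) _; apply: leq_trans (ha jd) bb.
    by apply: ev_cell ej _ (hzh _ jd); rewrite (proj2 fr) // hz.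
move=> s1 [r14 h14 fr _].
have ps1 := persistent_frame fr isT isT isT isT isT ps.
set b1 := (bz + sum_height 8 bz)%N.
have ev : evaluates_to s1 b1
    (Bin Leq (Bin Defs.Sub (Cst 0) (Bin Div (Reg 1) (Cst 2%:R))) (Reg 14))
    (~~ improves (centroid v))%:R.
  rewrite /improves -leNgt; apply: ev_leq.
    apply: ev_sub; first by apply: (@ev_nat _ _ 0); lia.
    apply: ev_div; last by apply: ev_nat; lia.
    by apply: ev_reg (pers_eps ps1) _; lia.
  by apply: ev_reg => //; rewrite -r14; apply: leq_trans h14 (leq_addl _ _).
apply: runs_if ev _ _ => hi.
  apply: runs_weaken (@runs_fill d O 4 12 0 (Cst 0) (Cell 1 (Reg 12)) d 0 s1 b f _ _ _ _) _ _ => //.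
  - exact: pers_d.
  - move=> k s2 kd fr2 r12 _; split; first by apply: (@ev_nat _ _ 0); lia.
    have ps2 := persistent_frame fr2 isT isT isT isT isT ps1.
    apply: ev_cell (pers_f ps2 kd) (hf kd); apply: ev_regnat => //; lia.
  - move=> s2 [m4 _ fr2]; split.
    + apply: (@frame_trans _ _ _ s1).
        by apply: frame_sub fr => // x; rewrite !inE => /orP[]->; rewrite ?orbT.
      by apply: frame_sub fr2 => // x; rewrite !inE => ->; rewrite ?orbT.
    + by rewrite (negbTE hi).
    + move=> _; split; first by rewrite (proj1 fr2) // (proj1 fr).
      by move=> j jd; rewrite m4 /= add0n jd subn0.
rewrite negbK in hi.
apply: (@runs_assign _ O _ _ _ _ b 1); first by apply: (@ev_nat _ _ 1); lia.
split.
- apply: (@frame_trans _ _ _ s1).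
    by apply: frame_sub fr => // x; rewrite !inE => /orP[]->; rewrite ?orbT.
  by apply: frame_set_reg.
- by rewrite /= /upd.
- by rewrite hi.
Qed.

Definition separate_bound : nat :=
  (1 + query_bits + pS.[query_bits] + (ecost_bound 1 b + 1 + test_bound))%N.

Lemma runs_separate s : persistent s -> reg s 10 = 0 ->
  (forall j, (j < d)%N -> Defs.mem s 2%N j = centroid v j) ->
  (forall j, (j < d)%N -> (height (centroid v j) <= bz)%N) ->
  runs O Separate s
    (fun s' => [/\ frame [:: 15; 14; 12; 10]%N [:: 4%N] s s',
       persistent s' &
       [/\ sep O (centroid_row v) = None, improves (centroid v) & reg s' 10 = 1] \/
       (reg s' 10 = 0 /\ exists2 c, valid_cut v c & forall j, (j < d)%N ->
          Defs.mem s' 4%N j = c j /\ (height (c j) <= bc)%N)])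
    separate_bound.
Proof.
move=> ps r10 hz hzh; have nb := n_lt_b; have db := d_lt_b; have bb := leq_bz.
have bbc := leq_bc.
have zE : get_array d s 2 = centroid_row v by apply/rowP => j; rewrite !mxE hz.
have zbits : (vbits (centroid_row v) <= query_bits)%N.
  apply: leq_trans (@vbits_le d _ bz _) _; first by move=> j; rewrite mxE hzh.
  by rewrite leq_mul2r (ltnW db) orbT.
have H : runs O (CallSep 2 15 4) s (fun s1 =>
    (sep O (centroid_row v) = None /\ s1 = set_reg s 15 0) \/
    exists2 c, sep O (centroid_row v) = Some c &
      s1 = set_array (set_reg s 15 1) 4 c /\ (vbits c <= pS.[query_bits])%N)
    (1 + query_bits + pS.[query_bits]).
  case E : (sep O (centroid_row v)) => [c|]; last first.
    exists (set_reg s 15 0), (1 + vbits (get_array d s 2))%N; split.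
    - by apply: ExSepIn; rewrite zE.
    - by rewrite zE; lia.
    - by left.
  have hc : (vbits c <= pS.[query_bits])%N.
    by apply: leq_trans (sepO E) _; apply: leq_horner.
  exists (set_array (set_reg s 15 1) 4 c), (1 + vbits (get_array d s 2) + vbits c)%N.
  split; [by apply: ExSepOut; rewrite zE|by rewrite zE; lia|].
  by right; exists c.
apply: (runs_seq H) => s1 hs1 fr1.
have fr1' : frame [:: 15]%N [:: 4%N] s s1 by apply: frame_sub fr1.
have ps1 : persistent s1 := persistent_frame fr1 isT isT isT isT isT ps.
have ev (x : bool) : reg s1 15 = x%:R -> evaluates_to s1 b (Reg 15) x%:R.
  by move=> r; apply: ev_reg => //; case: (x); apply: height_nat; lia.
case: hs1 => [[sN s1E]|[c sS [s1E cb]]].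
  apply: (runs_if (x := false)) => [||_] //; first by apply: ev; rewrite s1E /= /upd.
  have r10' : reg s1 10 = 0 by rewrite (proj1 fr1').
  have hz' j : (j < d)%N -> Defs.mem s1 2%N j = centroid v j.
    by move=> jd; rewrite (proj2 fr1') // hz.
  apply: runs_weaken (runs_test ps1 r10' hz' hzh) _ _ => // s2 [fr2 h1 h2].
  have fr : frame [:: 15; 14; 12; 10]%N [:: 4%N] s s2.
    apply: (@frame_trans _ _ _ s1).
      by apply: frame_sub fr1' => // x; rewrite !inE => ->.
    by apply: frame_sub fr2 => // x; rewrite !inE => ->; rewrite orbT.
  split=> //; first exact: persistent_frame fr isT isT isT isT isT ps.
  case: (boolP (improves (centroid v))) => imp; first by left; split=> //; exact: h1.
  have [r2 m4] := h2 imp; right; split=> //; exists f; first by right.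
  by move=> j jd; split; [exact: m4|apply: leq_trans (hf jd) (leq_trans bb bbc)].
apply: (runs_if (x := true)) => [|_|] //; first by apply: ev; rewrite s1E /= /upd.
apply: runs_skip => //; split=> //.
  by apply: frame_sub fr1' => // x; rewrite !inE => ->.
right; split; first by rewrite (proj1 fr1').
exists (array_of c).
  by left; rewrite sS; congr Some; apply/rowP => j; rewrite mxE array_ofE.
move=> j jd; split; first by rewrite s1E.
apply: leq_trans (height_array_of _ jd) _.
by apply: leq_trans cb (leq_addl _ _).
Qed.

Definition slack_height : nat := (bc + (bc + sum_height 12 bc + 1))%N.
Notation bh := slack_height.
Definition contraction_height : nat := (bh + 47 * (bh + 1))%N.
Notation bal := contraction_height.

Definition update_bound : nat :=
  (tabsum_bound 12 1 bc + (argmin_bound bh + (fill_bound 1 6 b +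
    for_bound b (ecost_bound 47 bh + fill_bound 3 14 bal))))%N.

Lemma runs_slack c s : persistent s -> holds_matrix s v ->
  (forall j, (j < d)%N -> Defs.mem s 2%N j = centroid v j) ->
  (forall j, (j < d)%N -> (height (centroid v j) <= bz)%N) ->
  (forall j, (j < d)%N -> Defs.mem s 4%N j = c j /\ (height (c j) <= bc)%N) ->
  runs O SlackLoop s
    (fun s' => [/\ forall i, (i < n)%N -> Defs.mem s' 5%N i = slack v c i,
       forall i, (i < n)%N -> (height (slack v c i) <= bh)%N
     & frame [:: 13; 14; 12]%N [:: 5%N] s s'])
    (tabsum_bound 12 1 bc).
Proof.
move=> ps hs hz hzh hc; have nb := n_lt_b; have db := d_lt_b.
have bb := leq_bz; have bbc := leq_bc.
have := @runs_tabsum d O 5 13 4 14 12 0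
  (Bin Mul (Cell 4 (Reg 12)) (Bin Defs.Sub (vertex_cell (Reg 13) (Reg 12)) (Cell 2 (Reg 12))))
  (Reg 14) n d s bc (fun i j => c j * (v i j - centroid v j)) (slack v c).
case=> //.
- exact: pers_n.
- exact: pers_d.
- by lia.
- by lia.
- move=> i j s1 i_n jd fr r13 r12.
  have ps1 := persistent_frame fr isT isT isT isT isT ps.
  have ej : evaluates_to s1 bc (Reg 12) j%:R by apply: ev_regnat => //; lia.
  have ei : evaluates_to s1 bc (Reg 13) i%:R by apply: ev_regnat => //; lia.
  have [cj hcj] := hc _ jd.
  apply: ev_mul; first by apply: ev_cell ej _ hcj; rewrite (proj2 fr).
  apply: ev_sub.
    by apply: ev_vertex => //; [lia|apply: holds_frame fr _ hs].
  apply: ev_cell ej _ (leq_trans (hzh _ jd) bbc).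
  by rewrite (proj2 fr) // hz.
- move=> i s1 i_n fr r13 r14 h14.
  by apply: ev_reg => //; rewrite /slack -r14; apply: leq_trans h14 (leq_addl _ _).
- move=> s' [t [ex ht [i1 h1 f1]]]; exists s', t; split=> //; split=> //.
  by move=> i i_n; apply: leq_trans (h1 _ i_n) _; rewrite mul1n leq_addl.
Qed.

(** The vertices are overwritten in place: in the invariant, rows below [i] are new and the others
    still old. The fixed vertex is read from its copy in array 6, so its own position among the rows
    does not matter. *)
Lemma runs_shrink (h : nat -> rat) k s : persistent s -> holds_matrix s v ->
  (k < n)%N -> reg s 16 = k%:R ->
  (forall i, (i < n)%N -> Defs.mem s 5%N i = h i /\ (height (h i) <= bh)%N) ->
  (forall j, (j < d)%N -> Defs.mem s 6%N j = v k j) ->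
  runs O ShrinkLoop s (fun s' => holds_matrix s' (shrunk v h k))
    (for_bound b (ecost_bound 47 bh + fill_bound 3 14 bal)).
Proof.
move=> ps hs kn r16 hh hP; have nb := n_lt_b; have db := d_lt_b.
have bb := leq_bz; have bbc := leq_bc; have bbh : (bc <= bh)%N := leq_addr _ _.
have bbal : (bh <= bal)%N := leq_addr _ _.
pose I i s1 := forall i' j', (i' < n)%N -> (j' < d)%N ->
  Defs.mem s1 3%N (i' * d + j')%N = if (i' < i)%N then shrunk v h k i' j' else v i' j'.
apply: runs_weaken (@runs_for d O I 13 4 n _ s b
  (ecost_bound 47 bh + fill_bound 3 14 bal) (pers_n ps) _ _ _ nb _ _) _ _ => //.
- move=> i s1 i_n Ii fr r13.
  have ps1 := persistent_frame fr isT isT isT isT isT ps.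
  have nbh : (n < bh)%N by lia.
  have ei : evaluates_to s1 bh (Reg 13) i%:R by apply: ev_regnat => //; lia.
  have ek : evaluates_to s1 bh (Reg 16) k%:R.
    by apply: ev_regnat; [rewrite (proj1 fr)|lia].
  have e4 : evaluates_to s1 bh (Reg 4) n%:R by apply: ev_regnat (pers_n ps1) nbh.
  have [hi hhi] := hh _ i_n; have [hk hhk] := hh _ kn.
  have eh : evaluates_to s1 bh (Cell 5 (Reg 13)) (h i).
    by apply: ev_cell ei _ hhi; rewrite (proj2 fr).
  have ehk : evaluates_to s1 bh (Cell 5 (Reg 16)) (h k).
    by apply: ev_cell ek _ hhk; rewrite (proj2 fr).
  have eK : evaluates_to s1 bh cubeK (64%:R * (n%:R * (n%:R * n%:R))).
    by apply: ev_mul (ev_mul e4 (ev_mul e4 e4)); apply: ev_nat; lia.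
  have eQ : evaluates_to s1 bh pivotQm
      ((4%:R * (n%:R * n%:R) + 1%:R) * (0 - h k)).
    apply: ev_mul; last by apply: ev_sub => //; apply: (@ev_nat _ _ 0); lia.
    apply: ev_add; last by apply: ev_nat; lia.
    by apply: ev_mul (ev_mul e4 e4); apply: ev_nat; lia.
  have ef : evaluates_to s1 bh contraction_expr (contraction h k i).
    apply: (ev_div _ eK); apply: ev_add; last by apply: ev_nat; lia.
    exact: ev_floor (ev_mul eK (ev_div eQ (ev_add eQ eh))).
  (* Not a hypothesis on [height (contraction _ _ _)]: [done] would compute it. *)
  have e17 s' : reg s' 17 = contraction h k i ->
      evaluates_to s' bal (Reg 17) (contraction h k i).
    by move=> r; apply: ev_reg r (leq_trans (ev_height ef) (leq_addl _ _)).
  apply: runs_seq (@runs_assign _ O 17 _ _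
    (fun s2 => s2 = set_reg s1 17 (contraction h k i)) _ _ ef erefl) _ => _ -> _.
  set s2 := set_reg s1 17 _.
  have ps2 : persistent s2.
    exact: persistent_frame (@frame_set_reg [:: 17%N] [::] s1 17 (contraction h k i) isT)
      isT isT isT isT isT ps1.
  have dbal : (d < bal)%N by lia.
  apply: runs_weaken (@runs_fill d O 3 12 0 (Bin Mul (Reg 13) (Reg 0)) shrunk_cell d
    (i * d) s2 bal (fun j => shrunk v h k i j) (pers_d ps2) isT dbal _) _ (leqnn _).
  + move=> j s3 jd fr3 r12 m3.
    have ps3 := persistent_frame fr3 isT isT isT isT isT ps2.
    have ej : evaluates_to s3 bal (Reg 12) j%:R by apply: ev_regnat => //; lia.
    have e13 : evaluates_to s3 bal (Reg 13) i%:R.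
      by apply: ev_regnat; [rewrite (proj1 fr3)|lia].
    have e0 : evaluates_to s3 bal (Reg 0) d%:R by apply: ev_regnat (pers_d ps3) _; lia.
    split; first by apply: ev_eq (ev_mul e13 e0) _; rewrite natrM.
    have eP : evaluates_to s3 bal (Cell 6 (Reg 12)) (v k j).
      apply: ev_cell ej _ _; last by have := hv kn jd; lia.
      by rewrite (proj2 fr3) //= (proj2 fr) // hP.
    apply: (ev_add eP _); apply: ev_mul; first by apply: e17; rewrite (proj1 fr3).
    apply: (ev_sub _ eP); apply: ev_cell (ev_affine e13 e0 ej) _ _; last first.
      by have := hv i_n jd; lia.
    (* The cells written so far in row [i] lie strictly before [i * d + j], so the old coordinate is
       still in place when it is read. *)
    by rewrite m3 ltnn andbF /= Ii // ltnn.
  + move=> s3 [m3 _ fr3] i' j' i'n jd /=; rewrite m3.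
    have [->|ne] := eqVneq i' i.
      by rewrite leq_addr ltn_add2l jd addKn ltnSn.
    by rewrite row_index_other //= Ii // ltnS [(i' <= i)%N]leq_eqVlt (negbTE ne).
- by move=> s' [Is _] i j i_n jd; rewrite Is // i_n.
Qed.

Lemma runs_update c s : persistent s -> holds_matrix s v ->
  (forall j, (j < d)%N -> Defs.mem s 2%N j = centroid v j) ->
  (forall j, (j < d)%N -> (height (centroid v j) <= bz)%N) ->
  (forall j, (j < d)%N -> Defs.mem s 4%N j = c j /\ (height (c j) <= bc)%N) ->
  runs O UpdateStep s
    (fun s' => exists k, [/\ (k < n)%N,
       forall i, (i < n)%N -> slack v c k <= slack v c i
     & holds_matrix s' (shrunk v (slack v c) k)])
    update_bound.
Proof.
move=> ps hs hz hzh hc; have nb := n_lt_b; have db := d_lt_b.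
have bb := leq_bz; have bbc := leq_bc; have bbh : (bc <= bh)%N := leq_addr _ _.
apply: runs_seq (runs_slack ps hs hz hzh hc) _ => s1 [h5 hh5 _] fr1.
have ps1 := persistent_frame fr1 isT isT isT isT isT ps.
have hs1 := holds_frame fr1 isT hs.
apply: runs_seq.
  apply: (@runs_argmin d O 5 16 13 4 n s1 bh (slack v c)) => //.
  - exact: pers_n.
  - by lia.
  - by move=> i i_n; split; [exact: h5|exact: hh5].
move=> s2 [[k kn [r16 kmin]] _] fr2.
have ps2 := persistent_frame fr2 isT isT isT isT isT ps1.
have hs2 := holds_frame fr2 isT hs1.
apply: runs_seq.
  apply: (@runs_fill d O 6 12 0 _ _ d 0 s2 b (v k)) => //.
  - exact: pers_d.
  - move=> j s3 jd fr3 r12 _; split; first by apply: (@ev_nat _ _ 0); lia.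
    apply: ev_vertex => //; first exact: persistent_frame fr3 isT isT isT isT isT ps2.
    + exact: holds_frame fr3 _ hs2.
    + by apply: ev_regnat; [rewrite (proj1 fr3)|lia].
    + by apply: ev_regnat => //; lia.
move=> s3 [m6 _ _] fr3.
have ps3 := persistent_frame fr3 isT isT isT isT isT ps2.
have hs3 := holds_frame fr3 isT hs2.
apply: runs_weaken (@runs_shrink (slack v c) k s3 ps3 hs3 kn _ _ _) _ _ => //.
- by rewrite (proj1 fr3).
- move=> i i_n; split; last exact: hh5.
  by rewrite (proj2 fr3) // (proj2 fr2) // h5.
- by move=> j jd; rewrite m6 /= add0n jd subn0.
- by move=> s' h; exists k.
Qed.

Definition body_bound : nat :=
  (tabsum_bound 6 3 b + (separate_bound + (ecost_bound 1 b + 1 + update_bound)))%N.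

Lemma runs_body s : persistent s -> holds_matrix s v -> reg s 10 = 0 ->
  runs O LoopBody s
    (fun s' =>
       [/\ sep O (centroid_row v) = None, improves (centroid v), reg s' 10 = 1 &
           forall j, (j < d)%N -> Defs.mem s' 2%N j = centroid v j /\
             (height (centroid v j) <= bz)%N] \/
       reg s' 10 = 0 /\ exists2 v', step v v' & holds_matrix s' v')
    body_bound.
Proof.
move=> ps hs r10; have nb := n_lt_b; have bb := leq_bz; have bbc := leq_bc.
apply: runs_seq (runs_centroid ps hs) _ => s1 [m2 hz _] fr1.
have ps1 := persistent_frame fr1 isT isT isT isT isT ps.
have hs1 := holds_frame fr1 isT hs.
have r1 : reg s1 10 = 0 by rewrite (proj1 fr1).
apply: runs_seq (runs_separate ps1 r1 m2 hz) _ => s2 [fr2 ps2 h2] _.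
have hs2 := holds_frame fr2 isT hs1.
have m2' j : (j < d)%N -> Defs.mem s2 2%N j = centroid v j.
  by move=> jd; rewrite (proj2 fr2) // m2.
case: h2 => [[sN imp r2]|[r2 [c cut m4]]].
  apply: (runs_if (x := true) (b := b)) => [|_|] //.
    by apply: ev_reg => //; apply: height_nat; lia.
  apply: runs_skip => //; left; split=> // j jd; split; [exact: m2'|exact: hz].
apply: (runs_if (x := false) (b := b)) => [||_] //.
  by apply: ev_reg => //; apply: (@height_nat 0); lia.
apply: runs_weaken (runs_frame (runs_update ps2 hs2 m2' hz m4)) _ _ => //.
move=> s3 [[k [kn kmin hs3]] fr3]; right; split; first by rewrite (proj1 fr3).
by exists (shrunk v (slack v c) k) => //; exists c, k.
Qed.

End body.

(** * From an improving point to the normalized cut *)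

Definition StepVector : cmd :=
  Seq (Sum 14 12 0 (Bin Mul (Bin Defs.Sub (Cell 2 (Reg 12)) (Cell 0 (Reg 12)))
                            (Bin Defs.Sub (Cell 2 (Reg 12)) (Cell 0 (Reg 12)))))
  (Seq (Assign 18 (Bin Div (Reg 1) (Bin Mul (Bin Mul (Cst 4%:R) (Reg 2)) (Reg 14))))
  (Seq (If (Bin Leq (Cst 1%:R) (Reg 18)) (Assign 18 (Cst 1%:R)) Skip)
  (Fill 7 12 0 (Cst 0) (Bin Add (Cell 0 (Reg 12))
     (Bin Mul (Reg 18) (Bin Defs.Sub (Cell 2 (Reg 12)) (Cell 0 (Reg 12)))))))).

(** Negated, so that the minimum search of [Argmin] finds a coordinate of largest absolute value. *)
Definition neg_abs_expr (e : expr) : expr :=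
  Bin Mul e (Bin Defs.Sub (Cst 1%:R) (Bin Mul (Cst 2%:R) (Bin Leq (Cst 0) e))).

Definition NormalizedCut : cmd :=
  Seq (Fill 9 12 0 (Cst 0) (neg_abs_expr (Cell 8 (Reg 12))))
  (Seq (Argmin 9 16 12 0)
  (Seq (Fill 0 12 0 (Cst 0) (Bin Div (Cell 8 (Reg 12)) (Bin Defs.Sub (Cst 0) (Cell 9 (Reg 16)))))
    (Assign 0 (Cst 1%:R)))).

Definition Finish : cmd :=
  If (Reg 10) (Seq StepVector (Seq (CallF 7 8) NormalizedCut)) (Assign 0 (Cst 0)).

Section step_vector.
Variables (d : nat) (O : oracles d) (a z : nat -> rat) (eps L : rat) (b : nat).
Hypotheses (bd : (d + 64 < b)%N) (heps : (height eps <= b)%N) (hL : (height L <= b)%N).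
Hypothesis ha : forall j, (j < d)%N -> (height (a j) <= b)%N.
Hypothesis hz : forall j, (j < d)%N -> (height (z j) <= b)%N.

Definition step_length : rat :=
  let t := eps / (4%:R * L * \sum_(j < d) (z j - a j) * (z j - a j)) in
  if 1%:R <= t then 1%:R else t.

Definition step_point j : rat := a j + step_length * (z j - a j).

Definition sqdist_height : nat := (b + sum_height 11 b)%N.
Definition length_height : nat := (sqdist_height + 7 * (sqdist_height + 1))%N.
Definition point_bits : nat := (b * (2 * (10 * (length_height + 1)) + 1))%N.

Definition step_vector_bound : nat :=
  (sum_bound 11 b + (ecost_bound 7 sqdist_height +
    (ecost_bound 3 length_height + ecost_bound 1 length_height + 1 +
     fill_bound 1 10 length_height)))%N.

Lemma runs_step_vector s : reg s 0 = d%:R -> reg s 1 = eps -> reg s 2 = L ->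
  (forall j, (j < d)%N -> Defs.mem s 0%N j = a j) ->
  (forall j, (j < d)%N -> Defs.mem s 2%N j = z j) ->
  runs O StepVector s
    (fun s' => forall j, (j < d)%N -> Defs.mem s' 7%N j = step_point j /\
       (height (step_point j) <= 10 * (length_height + 1))%N)
    step_vector_bound.
Proof.
move=> r0 r1 r2 m0 m2.
have b1 : (b <= sqdist_height)%N := leq_addr _ _.
have b2 : (sqdist_height <= length_height)%N := leq_addr _ _.
set D := \sum_(j < d) (z j - a j) * (z j - a j).
apply: runs_seq.
  apply: (@runs_sum d O 14 12 0 _ d s b (fun j => (z j - a j) * (z j - a j))) => //.
  - by lia.
  - move=> j s1 jd fr r12.
    have ej : evaluates_to s1 b (Reg 12) j%:R by apply: ev_regnat => //; lia.
    have e : evaluates_to s1 b (Bin Defs.Sub (Cell 2 (Reg 12)) (Cell 0 (Reg 12))) (z j - a j).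
      apply: ev_sub.
        by apply: (ev_cell ej _ (hz jd)); rewrite (proj2 fr) // m2.
      by apply: (ev_cell ej _ (ha jd)); rewrite (proj2 fr) // m0.
    exact: (ev_mul e e).
move=> s1 [r14 h14 fr1] _.
set t := eps / (4%:R * L * D).
have et : evaluates_to s1 sqdist_height
    (Bin Div (Reg 1) (Bin Mul (Bin Mul (Cst 4%:R) (Reg 2)) (Reg 14))) t.
  apply: ev_div; first by apply: ev_reg; [rewrite (proj1 fr1)|lia].
  apply: ev_mul; last first.
    by apply: (ev_reg r14); rewrite /D -r14; apply: leq_trans h14 (leq_addl _ _).
  apply: ev_mul; first by apply: ev_nat; lia.
  by apply: ev_reg; [rewrite (proj1 fr1)|lia].
have ht : (height t <= length_height)%N by apply: leq_trans (ev_height et) (leq_addl _ _).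
apply: (runs_seq (@runs_assign _ O 18 _ _ (fun s2 => s2 = set_reg s1 18 t) _ _ et erefl)).
move=> _ -> _; set s2 := set_reg s1 18 t.
have fr2 : frame [:: 18%N] [::] s1 s2 by apply: frame_set_reg.
have H : runs O (If (Bin Leq (Cst 1%:R) (Reg 18)) (Assign 18 (Cst 1%:R)) Skip) s2
    (fun s3 => reg s3 18 = step_length)
    (ecost_bound 3 length_height + ecost_bound 1 length_height + 1).
  have e18 : evaluates_to s2 length_height (Reg 18) t by apply: ev_reg.
  have e1 : evaluates_to s2 length_height (Cst 1%:R) 1%:R by apply: ev_nat; lia.
  apply: (runs_if (ev_leq e1 e18)) => h.
    apply: (runs_assign O e1); rewrite /= /upd /=.
    by rewrite /step_length -/D -/t h.
  apply: runs_skip => //.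
  by rewrite /= /upd /= /step_length -/D -/t (negbTE h).
apply: (runs_seq H) => s3 r18 fr3.
have hlen : (height step_length <= length_height)%N.
  rewrite /step_length -/D -/t; case: ifP => _ //; apply: height_nat; lia.
have lb : (d < length_height)%N by lia.
have ra r : r \notin [:: 14; 12; 18]%N -> reg s3 r = reg s r.
  rewrite !inE !negb_or => /and3P[n14 n12 n18].
  have -> : reg s3 r = reg s2 r by apply: (proj1 fr3); rewrite /= inE.
  have -> : reg s2 r = reg s1 r by apply: (proj1 fr2); rewrite inE.
  by apply: (proj1 fr1); rewrite !inE negb_or n14.
have ma A : Defs.mem s3 A = Defs.mem s A.
  by rewrite (proj2 fr3) // (proj2 fr2) // (proj2 fr1).
have r0' : reg s3 0 = d%:R by rewrite ra.
apply: runs_weaken (@runs_fill d O 7 12 0 (Cst 0) (Bin Add (Cell 0 (Reg 12))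
     (Bin Mul (Reg 18) (Bin Defs.Sub (Cell 2 (Reg 12)) (Cell 0 (Reg 12)))))
    d 0 s3 length_height step_point r0' isT lb _) _ (leqnn _).
- move=> j s4 jd fr4 r12 _; split; first by apply: (@ev_nat _ _ 0); lia.
  have ej : evaluates_to s4 length_height (Reg 12) j%:R by apply: ev_regnat => //; lia.
  have ea : evaluates_to s4 length_height (Cell 0 (Reg 12)) (a j).
    apply: (ev_cell ej); first by rewrite (proj2 fr4) // ma m0.
    by have := ha jd; lia.
  apply: (ev_add ea); apply: ev_mul; first by apply: ev_reg hlen; rewrite (proj1 fr4).
  apply: (ev_sub _ ea); apply: (ev_cell ej); first by rewrite (proj2 fr4) // ma m2.
  by have := hz jd; lia.
- move=> s4 [m7 h7 _] j jd; split; last exact: h7.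
  by rewrite m7 /= add0n jd subn0.
Qed.

End step_vector.

Section normalized.
Variables (d : nat) (O : oracles d) (g : nat -> rat) (c : nat).
Hypotheses (cd : (d + 64 < c)%N) (hg : forall j, (j < d)%N -> (height (g j) <= c)%N).

Definition abs_height : nat := (c + 11 * (c + 1))%N.

Definition normalized_bound : nat :=
  (fill_bound 1 11 c + (argmin_bound abs_height +
    (fill_bound 1 7 abs_height + ecost_bound 1 c)))%N.

Lemma runs_normalized s : (0 < d)%N -> reg s 0 = d%:R ->
  (forall j, (j < d)%N -> Defs.mem s 8%N j = g j) ->
  runs O NormalizedCut s
    (fun s' => reg s' 0 = 1%:R /\
       exists k, [/\ (k < d)%N, forall j, (j < d)%N -> `|g j| <= `|g k|
         & forall j, (j < d)%N -> Defs.mem s' 0%N j = g j / `|g k|])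
    normalized_bound.
Proof.
move=> d0 r0 m8.
have bc : (c <= abs_height)%N := leq_addr _ _.
have dc : (d < c)%N by lia.
have absE x : x * (1%:R - 2%:R * (0 <= x)%R%:R) = - `|x| :> rat.
  by have [h|h] := ger0P x; rewrite ?mulr1 ?mulr0 ?subr0 ?mulr1 ?opprK //; ring.
apply: (runs_seq (@runs_fill d O 9 12 0 (Cst 0) (neg_abs_expr (Cell 8 (Reg 12))) d 0 s c
    (fun j => - `|g j|) r0 isT dc _)).
  move=> j s1 jd fr1 r12 _; split; first by apply: (@ev_nat _ _ 0); lia.
  have ej : evaluates_to s1 c (Reg 12) j%:R by apply: ev_regnat => //; lia.
  have eg : evaluates_to s1 c (Cell 8 (Reg 12)) (g j).
    by apply: (ev_cell ej _ (hg jd)); rewrite (proj2 fr1) // m8.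
  rewrite -absE; apply: (ev_mul eg); apply: ev_sub; first by apply: ev_nat; lia.
  apply: ev_mul; first by apply: ev_nat; lia.
  by apply: (ev_leq _ eg); apply: (@ev_nat _ _ 0); lia.
move=> s1 [m9 h9 _] fr1.
have r01 : reg s1 0 = d%:R by rewrite (proj1 fr1).
have dah : (0 < d < abs_height)%N by lia.
apply: (runs_seq (@runs_argmin d O 9 16 12 0 d s1 abs_height (fun j => - `|g j|)
   r01 isT dah _)).
  move=> l ld; split; first by rewrite m9 /= add0n ld subn0.
  by apply: leq_trans (h9 _ ld) (leq_addl _ _).
move=> s2 [[k kd [r16 kmin]] _] fr2.
have r02 : reg s2 0 = d%:R by rewrite (proj1 fr2).
have dah' : (d < abs_height)%N by lia.
apply: (runs_seq (@runs_fill d O 0 12 0 (Cst 0)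
   (Bin Div (Cell 8 (Reg 12)) (Bin Defs.Sub (Cst 0) (Cell 9 (Reg 16)))) d 0 s2 abs_height
   (fun j => g j / `|g k|) r02 isT dah' _)).
  move=> j s3 jd fr3 r12 _; split; first by apply: (@ev_nat _ _ 0); lia.
  have ej : evaluates_to s3 abs_height (Reg 12) j%:R by apply: ev_regnat => //; lia.
  have ek : evaluates_to s3 abs_height (Reg 16) k%:R.
    by apply: ev_regnat; [rewrite (proj1 fr3)|lia].
  apply: ev_div.
    apply: (ev_cell ej); last by have := hg jd; lia.
    by rewrite (proj2 fr3) // (proj2 fr2) // (proj2 fr1) // m8.
  rewrite -[`|_|]opprK -[- - _]add0r; apply: ev_sub.
    by apply: (@ev_nat _ _ 0); lia.
  apply: (ev_cell ek); last by apply: leq_trans (h9 _ kd) (leq_addl _ _).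
  by rewrite (proj2 fr3) // (proj2 fr2) // m9 /= add0n kd subn0.
move=> s3 [m0 _ _] _.
apply: (@runs_assign _ O _ _ _ _ c 1%:R); first by apply: ev_nat; lia.
split=> //; exists k; split=> // j jd; first by have := kmin _ jd; rewrite lerN2.
by rewrite /= m0 /= add0n jd subn0.
Qed.

End normalized.

(** * Iterating the rounds *)

Definition MainLoop : cmd := For 11 9 (If (Reg 10) Skip LoopBody).

Section main_loop.
Variables (d : nat) (O : oracles d) (a f : nat -> rat) (eps : rat).
Variables (pS : {poly nat}) (b N : nat) (P : nat -> (nat -> nat -> rat) -> Prop).
Hypotheses (sepO : sep_bits O pS) (b_large : (d.+1 + 64 < b)%N).
Hypotheses (Nb : (N < b)%N) (heps : (height eps <= b)%N).
Hypothesis ha : forall j, (j < d)%N -> (height (a j) <= b)%N.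
Hypothesis hf : forall j, (j < d)%N -> (height (f j) <= b)%N.
Hypothesis P_step : forall k v v', P k v -> step O a f eps v v' -> P k.+1 v'.
Hypothesis P_height : forall k v i j, (k <= N)%N -> P k v -> (i < d.+1)%N -> (j < d)%N ->
  (height (v i j) <= b)%N.

Definition found (s : state) : Prop := exists v,
  [/\ sep O (centroid_row d v) = None, improves d a f eps (centroid d v) &
      forall j, (j < d)%N -> Defs.mem s 2%N j = centroid d v j /\
             (height (centroid d v j) <= centroid_height b)%N].

Definition main_bound : nat :=
  for_bound b (ecost_bound 1 b + 1 + body_bound pS b)%N.

(** The invariant [P] is abstract: only [P_height] matters for the cost, as it gives every round the
    same bound [b]. Once an improving point has been found, the remaining rounds of the counted loop
    do nothing. *)
Lemma runs_main s v0 : persistent d a f eps s -> reg s 9 = N%:R -> reg s 10 = 0 ->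
  holds_matrix d s v0 -> P 0 v0 ->
  runs O MainLoop s
    (fun s' => reg s' 10 = 1 /\ found s' \/
               reg s' 10 = 0 /\ exists v, P N v)
    main_bound.
Proof.
move=> ps r9 r10 hs P0.
pose I k s1 := reg s1 10 = 1 /\ found s1 \/
  reg s1 10 = 0 /\ exists2 v, P k v & holds_matrix d s1 v.
apply: runs_weaken (@runs_for d O I 11 9 N (If (Reg 10) Skip LoopBody) s b
  (ecost_bound 1 b + 1 + body_bound pS b) r9 isT isT isT Nb _ _) _ (leqnn _).
- by right; split=> //; exists v0.
- move=> k s1 kN Ik fr r11.
  have ps1 := persistent_frame fr isT isT isT isT isT ps.
  case: Ik => [[r1 fnd]|[r1 [v Pv hv]]].
    apply: (runs_if (x := true) (b := b)) => [|_|] //.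
      by apply: ev_reg => //; apply: height_nat; lia.
    by apply: runs_skip => //; left.
  apply: (runs_if (x := false) (b := b)) => [||_] //.
    by apply: ev_reg => //; apply: (@height_nat 0); lia.
  apply: runs_weaken (@runs_body d O a f eps pS v b b_large _ ha hf heps sepO s1 ps1 hv r1)
    _ (leqnn _).
    by move=> i j i_n jd; apply: P_height (ltnW kN) Pv i_n jd.
  move=> s2 [[sN imp r2 hz]|[r2 [v' st hv']]]; first by left; split=> //; exists v.
  by right; split=> //; exists v' => //; exact: P_step Pv st.
- move=> s' [[[r1 fnd]|[r1 [v Pv _]]] _]; [by left|by right; split=> //; exists v].
Qed.

End main_loop.

(** * Sizes of the vertices and progress of the search *)

Lemma leq_expW m n k : (m <= n)%N -> (m ^ k <= n ^ k)%N.
Proof. by case: k => [|k] h; rewrite ?expn0 // leq_exp2r. Qed.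

Lemma affine_common_denominator (R : fieldType) (k y z1 z2 A : R) : k != 0 -> y != 0 ->
  z1 / y + A / k * (z2 / y - z1 / y) = (k * z1 + A * (z2 - z1)) / (k * y).
Proof. by move=> k0 y0; field; rewrite k0 y0. Qed.

(** The worst case [h = - m] gives [(4 w + 1) / (4 w)], at most [5 / 4]. For [m = 0] the quotient is
    0, whatever its denominator. *)
Lemma pivot_ratio (R : realFieldType) (w m h : R) : 1 <= w -> 0 <= m -> - m <= h ->
  0 <= (4%:R * w + 1) * m / ((4%:R * w + 1) * m + h) <= 5%:R / 4%:R.
Proof.
move=> w1 m0 mh; have [->|m1] := eqVneq m 0; first by rewrite mulr0 mul0r; lra.
have mp : 0 < m by rewrite lt_def m1.
have wm : m <= w * m by rewrite ler_peMl.
have Q0 : 0 < (4%:R * w + 1) * m by rewrite mulr_gt0 //; lra.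
have D0 : 4%:R * (w * m) <= (4%:R * w + 1) * m + h by lra.
have D1 : 0 < (4%:R * w + 1) * m + h by lra.
apply/andP; split; first by rewrite divr_ge0 // ltW.
by rewrite ler_pdivrMr //; lra.
Qed.

(** The bound [2 * K] on the numerator leaves room for the added 1, since [5 / 4 * K + 1 <= 2 * K]
    for [K >= 64]. *)
Lemma round_up (R : archiRealFieldType) (K : nat) (x : R) : (64 <= K)%N ->
  0 <= x <= 5%:R / 4%:R ->
  let A := Num.floor (K%:R * x) + 1 in
  0 <= A <= (2 * K)%N%:Z /\ x <= A%:~R / K%:R <= x + K%:R^-1.
Proof.
move=> K64 /andP[x0 x1] A.
have K0 : 0 < K%:R :> R by rewrite ltr0n; lia.
have /andP[f1 f2] := floor_itv (K%:R * x).
have Kx0 : 0 <= K%:R * x by rewrite mulr_ge0 // ltW.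
have f0 : 0 <= Num.floor (K%:R * x) by rewrite floor_ge0.
split.
  apply/andP; split; first by rewrite /A; lia.
  rewrite -(ler_int R) rmorphD /= -pmulrn natrM.
  have : K%:R * x <= K%:R * (5%:R / 4%:R) by rewrite ler_pM2l.
  have : 64%:R <= K%:R :> R by rewrite ler_nat.
  lra.
apply/andP; split; first by rewrite ler_pdivlMr // mulrC ltW.
rewrite rmorphD /= mulrDl mul1r lerD2r ler_pdivrMr //.
by rewrite [leRHS]mulrC.
Qed.

Section dyadic.
Variables d K : nat.
Hypothesis KE : K = (64 * d.+1 ^ 3)%N.

Lemma K_ge64 : (64 <= K)%N.
Proof. by rewrite KE leq_pmulr // expn_gt0. Qed.

Lemma slack_sum0 (v : nat -> nat -> rat) c : \sum_(i < d.+1) slack d v c i = 0.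
Proof.
rewrite /slack exchange_big /= big1 // => j _.
rewrite -mulr_sumr big_split /= sumr_const card_ord /centroid.
by rewrite mulNrn -[X in _ - X]mulr_natr divfK ?subrr ?mulr0 // pnatr_eq0.
Qed.

Lemma contraction_bounds (h : nat -> rat) k i : h k <= 0 -> h k <= h i ->
  let Qm := (4%:R * (d.+1%:R * d.+1%:R) + 1) * (0 - h k) in
  exists A : int, [/\ contraction d h k i = A%:~R / K%:R, 0 <= A <= (2 * K)%N%:Z &
    Qm / (Qm + h i) <= contraction d h k i <= Qm / (Qm + h i) + K%:R^-1].
Proof.
move=> hk0 hki Qm; set x := Qm / (Qm + h i).
have KE' : 64%:R * (d.+1%:R * (d.+1%:R * d.+1%:R)) = K%:R :> rat.
  by rewrite KE natrM natrX; ring.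
have x01 : 0 <= x <= 5%:R / 4%:R.
  apply: pivot_ratio; rewrite ?sub0r ?opprK; [|by rewrite oppr_ge0|exact: hki].
  by rewrite -natrM ler1n.
have [A2 xA] := round_up K_ge64 x01.
exists (Num.floor (K%:R * x) + 1); split; [|exact: A2|].
  by rewrite /contraction KE' rmorphD.
by rewrite /contraction KE' -/x -[1%:R]/(1%:~R) -rmorphD.
Qed.

(** After [k] rounds all coordinates share the denominator [K ^ k], where [K] is in general not a
    power of 2. A round multiplies the numerators by at most [5 K]: the kept vertex contributes [K],
    and a factor of numerator at most [2 K] meets a difference of two numerators. *)
Definition dyadic (M : nat) (k : nat) (v : nat -> nat -> rat) : Prop :=
  forall i j, (i < d.+1)%N -> (j < d)%N ->
    exists2 z : int, v i j = z%:~R / K%:R ^+ k & (`|z| <= M * (5 * K) ^ k)%N.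

Lemma dyadic_step (O : oracles d) a f eps M k v v' :
  dyadic M k v -> step O a f eps v v' -> dyadic M k.+1 v'.
Proof.
move=> hv [c [p [pn _ hmin hv']]] i j i_n jd.
have K0 : K%:R != 0 :> rat by rewrite pnatr_eq0; have := K_ge64; lia.
(* The size bound must hold even if there is no improving point, so only the vanishing sum of the
   slacks is available. It leaves open that the minimum is 0, which [pivot_ratio] allows. *)
have hp : slack d v c p <= 0.
  rewrite leNgt; apply/negP => h.
  have := slack_sum0 v c; apply/eqP; rewrite gt_eqF //.
  rewrite big_ord_recl; apply: ltr_pwDl; first exact: lt_le_trans h (hmin _ _).
  by apply: sumr_ge0 => l _; apply: le_trans (ltW h) (hmin _ _); exact: ltn_ord.
have [A [fE /andP[A0 A2] _]] := contraction_bounds hp (hmin _ i_n).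
have [z1 e1 h1] := hv _ _ pn jd; have [z2 e2 h2] := hv _ _ i_n jd.
exists (K%:Z * z1 + A * (z2 - z1)).
  rewrite (hv' _ _ i_n jd) /shrunk fE e1 e2 exprS affine_common_denominator; [|exact: K0|exact: expf_neq0].
  by rewrite rmorphD !rmorphM rmorphB.
rewrite expnS; set W := (M * (5 * K) ^ k)%N in h1 h2.
have -> : (M * (5 * K * (5 * K) ^ k) = 5 * K * W)%N by rewrite /W mulnCA.
have a1 : (`|A| <= 2 * K)%N by lia.
have a2 : (`|(z2 - z1)%R| <= 2 * W)%N by lia.
have a3 : (`|A| * `|(z2 - z1)%R| <= 2 * K * (2 * W))%N by rewrite leq_mul.
have a4 : (K * `|z1| <= K * W)%N by rewrite leq_mul2l h1 orbT.
have tri (x y : int) : (`|(x + y)%R| <= `|x| + `|y|)%N by lia.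
apply: leq_trans (tri _ _) _; rewrite !abszM /=.
have -> : (5 * K * W = K * W + 2 * K * (2 * W))%N by ring.
exact: leq_add a4 a3.
Qed.

(** The crude estimate [5 * K <= 2 ^ (K + 3)] costs [K + 3] bits per round instead of order [log K],
    which is still polynomial. *)
Definition vertex_height (M N : nat) : nat := (M + 1 + (K + 3) * N)%N.

Lemma dyadic_height M N k v i j : dyadic M k v -> (k <= N)%N ->
  (i < d.+1)%N -> (j < d)%N -> (height (v i j) <= vertex_height M N)%N.
Proof.
move=> hv kN i_n jd; have [z -> hz] := hv _ _ i_n jd.
have e5 : (5 * K <= 2 ^ (K + 3))%N.
  rewrite expnD mulnC leq_mul //; apply: ltnW; exact: ltn_expl.
have e5k : ((5 * K) ^ k <= 2 ^ ((K + 3) * N))%N.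
  apply: leq_trans (_ : (2 ^ (K + 3)) ^ k <= _)%N; first exact: leq_expW.
  by rewrite -expnM leq_exp2l // leq_mul2l kN orbT.
rewrite -natrX -[(_ ^ k)%:R]/(((K ^ k)%N%:Z)%:~R); apply: height_div.
- apply: (leq_ltn_trans hz); rewrite /vertex_height expnD.
  apply: (@leq_ltn_trans (M * 2 ^ ((K + 3) * N))); first by rewrite leq_mul2l e5k orbT.
  rewrite ltn_mul2r expn_gt0 /=.
  by apply: ltn_trans (ltn_expl M (isT : 1 < 2)%N) _; rewrite ltn_exp2l // addn1.
- rewrite absz_nat; apply: (@leq_ltn_trans (2 ^ ((K + 3) * N))).
    apply: leq_trans (_ : (2 ^ K) ^ k <= _)%N.
      by apply: leq_expW; exact: ltnW (ltn_expl _ _).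
    by rewrite -expnM leq_exp2l //; apply: leq_mul => //; lia.
  by rewrite ltn_exp2l // /vertex_height; lia.
- by rewrite /vertex_height; lia.
Qed.

(** The language compares by [Leq] only, so the indicator of [i = j + 1] is a product of two
    comparisons. *)
Definition init_vertex (rho i j : nat) : rat :=
  0 - rho%:R + 2%:R * d%:R * rho%:R * ((i <= j.+1)%N%:R * (j.+1 <= i)%N%:R).

Lemma dyadic_init rho : dyadic (2 * d * rho) 0 (init_vertex rho).
Proof.
move=> i j i_n jd; exists ((2 * d * rho)%N%:Z * ((i <= j.+1)%N && (j.+1 <= i)%N)%:Z - rho%:Z).
  rewrite expr0 divr1 rmorphB rmorphM /= -!pmulrn /init_vertex.
  by rewrite -mulnb !natrM; ring.
rewrite expn0 muln1; have : (rho <= d * rho)%N by rewrite leq_pmull //; lia.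
by case: (_ && _) => /=; lia.
Qed.

End dyadic.

(** * Localization of the improving points *)

Section potential.
Variables (R : realType) (d K : nat).
Hypothesis KE : K = (64 * d.+1 ^ 3)%N.
Variables (X : set 'rV[R]_d) (O : oracles d) (a f : nat -> rat) (eps : rat) (rho : nat).
Hypothesis sepX : separates X O.

Definition vecf (c : nat -> rat) : 'rV[rat]_d := \row_j c j.

Definition simplex_of (v : nat -> nat -> rat) : 'M[R]_(1 + d, d) :=
  \matrix_(i, j) ratr (v i j).

Notation target := (improving X (ratv R (vecf f)) (ratv R (vecf a)) (ratr eps)).

(** Conditional on the existence of a target, because otherwise the smallest slack may be 0 and the
    decrease of the determinant is not guaranteed. The final argument by contradiction supplies a
    target. *)
Definition localized (k : nat) (v : nat -> nat -> rat) : Prop :=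
  (exists w, target w) ->
  (forall w, target w -> in_simplex (simplex_of v) w) /\
  `|\det (homog (simplex_of v))| <= (2 * d * rho)%:R ^+ d * shrink_rate R d ^+ k.

Lemma dotv_vecfB (c x y : nat -> rat) :
  dotv (vecf c) (vecf x - vecf y) = \sum_(j < d) c j * (x j - y j).
Proof. by apply: eq_bigr => j _; rewrite !mxE. Qed.

Lemma ratr_affine (x t y : rat) :
  ratr (x + t * (y - x)) = ratr x + ratr t * (ratr y - ratr x) :> R.
Proof. by rewrite rmorphD rmorphM rmorphB. Qed.

Lemma ratr_slack v c (i : 'I_(1 + d)) :
  ratr (slack d v c i) =
  dotv (ratv R (vecf c)) (row i (simplex_of v) - ratv R (centroid_row d v)).
Proof.
rewrite /slack rmorph_sum; apply: eq_bigr => j _.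
by rewrite rmorphM rmorphB !mxE.
Qed.

(** For an oracle cut this is strict separation; for the cut [f], the centroid has value at least
    [- eps / 2] while a target lies strictly below. *)
Lemma valid_cut_lt v c w : valid_cut O a f eps v c -> target w ->
  dotv (ratv R (vecf c)) (w - ratv R (centroid_row d v)) < 0.
Proof.
move=> hc [Xw hw]; rewrite dotvBr subr_lt0.
case: hc => [sS|[_ ni cf]].
  by have := sepX (centroid_row d v); rewrite sS => -[_ /(_ w Xw)].
have -> : vecf c = vecf f by apply/rowP => j; rewrite !mxE cf.
have hz : - (ratr eps / 2) <=
    dotv (ratv R (vecf f)) (ratv R (centroid_row d v) - ratv R (vecf a)).
  move: ni; rewrite /improves -leNgt -dotv_vecfB -(ler_rat R) => h.
  rewrite -ratvB dotv_ratv; apply: le_trans h.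
  by rewrite sub0r rmorphN fmorph_div /= ratr_nat.
by move: hw hz; rewrite !dotvBr; lra.
Qed.

Lemma localized_step k v v' : localized k v -> step O a f eps v v' ->
  localized k.+1 v'.
Proof.
move=> lv [c [p [pn cut hmin hv']]] ext.
have [inV detV] := lv ext.
pose kk : 'I_(1 + d) := Ordinal pn.
pose h (i : 'I_(1 + d)) : R := ratr (slack d v c i).
pose al (i : 'I_(1 + d)) : R := ratr (contraction d (slack d v c) p i).
have hk i : h kk <= h i by rewrite /h ler_rat; apply: hmin; exact: ltn_ord.
have hsum : \sum_i h i = 0 by rewrite -rmorph_sum (slack_sum0 d v c) rmorph0.
have lh w (l : 'rV[R]_(1 + d)) : target w -> \sum_i l 0 i = 1 ->
    w = l *m simplex_of v -> \sum_i l 0 i * h i < 0.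
  move=> tw l1 wE; have := valid_cut_lt cut tw.
  have -> : w - ratv R (centroid_row d v) =
      \sum_i l 0 i *: (row i (simplex_of v) - ratv R (centroid_row d v)).
    under eq_bigr do rewrite scalerBr.
    by rewrite big_split /= sumrN -scaler_suml l1 scale1r wE mulmx_sum_row.
  by rewrite dotv_sumr; under eq_bigr do rewrite -ratr_slack.
(* A target is a convex combination of the vertices with negative weighted slack, so some slack is
   negative. *)
have hk0 : h kk < 0.
  case: ext => w tw; have [l [l0 l1 wE]] := inV w tw.
  rewrite ltNge; apply/negP => hk0; have := lh w l tw l1 wE.
  apply/negP; rewrite -leNgt; apply: sumr_ge0 => i _.
  by apply: mulr_ge0 => //; apply: le_trans hk0 (hk i).
have hp : slack d v c p <= 0 by rewrite -(ler_rat R) rmorph0 ltW.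
pose n : R := (1 + d)%:R.
pose Q : R := 4 * n ^+ 2 + 1.
have hal i : Q * - h kk / (Q * - h kk + h i) <= al i <=
    Q * - h kk / (Q * - h kk + h i) + (64 * n ^+ 3)^-1.
  have hpi : slack d v c p <= slack d v c i by apply: hmin; exact: ltn_ord.
  have [A [_ _]] := contraction_bounds KE hp hpi.
  set q := _ / _; set fa := contraction _ _ _ _ => /andP[q1 q2].
  have KR : ratr K%:R^-1 = (64 * n ^+ 3)^-1 :> R.
    by rewrite fmorphV /= ratr_nat KE natrM natrX.
  have qR : ratr q = Q * - h kk / (Q * - h kk + h i) :> R.
    have e : ratr ((4 * (d.+1%:R * d.+1%:R) + 1) * (0 - slack d v c p)) = Q * - h kk :> R.
      rewrite rmorphM rmorphD rmorphM rmorphM sub0r rmorphN rmorph1 /= !ratr_nat.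
      by rewrite -expr2.
    by rewrite /q fmorph_div rmorphD /= e.
  have g1 : ratr q <= ratr fa :> R by rewrite ler_rat; exact: q1.
  have g2 : ratr fa <= ratr (q + K%:R^-1) :> R by rewrite ler_rat; exact: q2.
  have sE : ratr (q + K%:R^-1) =
      Q * - h kk / (Q * - h kk + h i) + (64 * n ^+ 3)^-1 :> R.
    by rewrite rmorphD /= qR KR.
  rewrite sE in g2; rewrite qR in g1.
  by apply/andP; split; [exact: g1|exact: g2].
have vE : simplex_of v' = shrink (simplex_of v) kk al.
  apply/matrixP => i j; rewrite !mxE (hv' _ _ (ltn_ord i) (ltn_ord j)).
  exact: ratr_affine.
have Q1 : 1 < Q by rewrite ltrDr mulr_gt0 // exprn_gt0 // ltr0n.
have q0 i : 0 <= Q * - h kk / (Q * - h kk + h i).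
  have m0 : 0 < - h kk by rewrite oppr_gt0.
  have Qm : - h kk < Q * - h kk by rewrite ltr_pMl.
  by apply: divr_ge0; [apply: ltW; exact: lt_trans Qm|have := hk i; lra].
split.
  move=> w tw; have [l [l0 l1 wE]] := inV w tw; rewrite vE wE.
  apply: (@in_shrink R d (simplex_of v) kk al h Q l) => //.
    by move=> i; have /andP[] := hal i.
  exact: ltW (lh w l tw l1 wE).
rewrite vE det_shrink normrM.
have al0 i : 0 <= al i by have /andP[h1 _] := hal i; apply: le_trans (q0 i) h1.
have pr : \prod_(i < d) al (lift kk i) <= shrink_rate R d.
  apply: (@prod_shrink R d kk al h) => // i.
  by have /andP[_ h2] := hal i; rewrite al0 h2.
rewrite ger0_norm ?prodr_ge0 // exprS mulrCA; apply: ler_pM => //.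
exact: prodr_ge0.
Qed.

Variable (Rad : R).
Hypotheses (Xball : X `<=` eball Rad) (Rad_rho : Rad <= rho%:R).

(** [X] lies in the cube of half-width [rho]. Seen from the corner with all coordinates [- rho], its
    points have coordinates summing to at most [2 * d * rho], the edge length of the simplex. *)
Lemma localized_init : (0 < d)%N -> (0 < rho)%N -> localized 0 (init_vertex d rho).
Proof.
move=> d0 rho0 _.
have -> : simplex_of (init_vertex d rho) =
    corner (const_mx (- rho%:R)) (2 * d * rho)%:R.
  apply/matrixP => i j; rewrite !mxE /init_vertex sub0r.
  rewrite rmorphD rmorphN !rmorphM /= !ratr_nat !natrM; congr (_ + _ * _).
  by rewrite -natrM mulnb -eqn_leq.
have D0 : 0 < (2 * d * rho)%:R :> R by rewrite ltr0n !muln_gt0 d0.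
split; last by rewrite det_corner expr0 mulr1 ger0_norm // exprn_ge0 // ltW.
move=> w [Xw _].
have hw j : `|w 0 j| <= rho%:R.
  apply: le_trans (coord_le_enorm w j) _; apply: le_trans Rad_rho.
  exact: Xball Xw.
apply: in_corner => // [j|]; first by rewrite mxE; have := hw j; rewrite ler_norml; lra.
apply: le_trans (_ : \sum_(j < d) 2 * rho%:R <= _).
  by apply: ler_sum => j _; rewrite mxE; have := hw j; rewrite ler_norml; lra.
rewrite sumr_const card_ord -mulr_natr !natrM.
by rewrite [leLHS](_ : _ = 2%:R * d%:R * rho%:R) //; ring.
Qed.

Hypothesis convX : convex_set (X : set (convex_lmodType 'rV[R]_d)).
Hypothesis ballX : eball 1 `<=` X.

(** The number of rounds makes the total contraction at most [(2 ^ - m) ^ d], so [d]-th powers are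
    compared through their bases. The hypothesis on [m] says [2 * d * rho / 2 ^ m < t], with [t] as
    in [no_improvement]. *)
Lemma localized_svi (B : rat) m v : (0 < d)%N -> 0 < eps -> 0 < B ->
  X (ratv R (vecf a)) -> enorm (ratv R (vecf f)) <= ratr B ->
  4%:R * d%:R * rho%:R * (eps + B * (1 + rho%:R)) / eps < (2 ^ m)%:R ->
  localized (12 * (1 + d) ^ 2 * (d * m)) v ->
  forall x, X x -> - ratr eps <= dotv (ratv R (vecf f)) (x - ratv R (vecf a)).
Proof.
move=> d0 e0 B0 Xa fB hm lv.
have eR : 0 < ratr eps :> R by rewrite ltr0q.
have BR : 0 < ratr B :> R by rewrite ltr0q.
apply: (no_improvement convX ballX Xball (V := simplex_of v) Xa eR fB Rad_rho _ BR) => //.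
move=> ext; have [h1 h2] := lv ext; split=> //.
apply: le_lt_trans h2 _.
set t := ratr eps / _.
have t0 : 0 < t.
  by rewrite divr_gt0 // mulr_gt0 // addr_gt0 // mulr_gt0 // ltr_pwDl.
have D0 : 0 <= (2 * d * rho)%:R :> R by [].
apply: (@le_lt_trans _ _ ((2 * d * rho)%:R ^+ d * (2^-1 ^+ m) ^+ d)).
  by rewrite -exprM [(m * d)%N]mulnC ler_wpM2l ?exprn_ge0 // shrink_rate_iter.
rewrite -exprMn; set u := _ * 2^-1 ^+ m.
have u0 : 0 <= u by rewrite /u mulr_ge0 ?exprn_ge0 ?invr_ge0.
suff ut : u < t by have t0' := ltW t0; rewrite ltr_pXn2r ?nnegrE.
rewrite /u exprVn ltr_pdivrMr ?exprn_gt0 //.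
have s0 : 0 < 2%:R * (ratr eps + ratr B * (1 + rho%:R)) :> R.
  by rewrite mulr_gt0 // addr_gt0 // mulr_gt0 // ltr_pwDl.
have LE : ratr (4%:R * d%:R * rho%:R * (eps + B * (1 + rho%:R)) / eps) =
    4%:R * d%:R * rho%:R * (ratr eps + ratr B * (1 + rho%:R)) / ratr eps :> R.
  by rewrite !(fmorph_div, rmorphM, rmorphD, rmorph1) /= !ratr_nat.
have := hm; rewrite -(ltr_rat R) LE ratr_nat ltr_pdivrMr // natrX => hm'.
rewrite /t mulrAC ltr_pdivlMr // !natrM.
lra.
Qed.

End potential.

(** * Polynomial bounds *)

Definition polybounded (f : nat -> nat) : Prop :=
  exists p : {poly nat}, forall m, (f m <= p.[m])%N.

Lemma polybounded_id : polybounded id.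
Proof. by exists 'X => m; rewrite hornerX. Qed.

Lemma polybounded_const c : polybounded (fun=> c).
Proof. by exists c%:P => m; rewrite hornerC. Qed.

Lemma polybounded_add f g : polybounded f -> polybounded g ->
  polybounded (fun m => f m + g m)%N.
Proof. by move=> [p hp] [q hq]; exists (p + q) => m; rewrite hornerD; exact: leq_add. Qed.

Lemma polybounded_mul f g : polybounded f -> polybounded g ->
  polybounded (fun m => f m * g m)%N.
Proof. by move=> [p hp] [q hq]; exists (p * q) => m; rewrite hornerM; exact: leq_mul. Qed.

Lemma polybounded_comp f g : polybounded f -> polybounded g ->
  polybounded (fun m => f (g m)).
Proof.
move=> [p hp] [q hq]; exists (p \Po q) => m; rewrite horner_comp.
by apply: leq_trans (hp _) _; exact: leq_horner.
Qed.

Lemma polybounded_horner (p : {poly nat}) : polybounded (horner p).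
Proof. by exists p. Qed.

Lemma polybounded_exp f k : polybounded f -> polybounded (fun m => f m ^ k)%N.
Proof.
move=> hf; elim: k => [|k IH]; first exact: polybounded_const.
have [p hp] := polybounded_mul hf IH; exists p => m; rewrite expnS; exact: hp.
Qed.

(* Compound bounds are handled as compositions, so that each of them is unfolded
   with a variable as its argument; unfolding them in place would be exponential. *)
Ltac polybound :=
  let rec head t := lazymatch t with ?g _ => head g | _ => t end in
  lazymatch goal with
  | |- polybounded (fun _ => ?c) => exact: polybounded_const
  | |- polybounded (fun m => m) => exact: polybounded_id
  | |- polybounded (fun m => addn _ _) => apply: polybounded_add; polybound
  | |- polybounded (fun m => muln _ _) => apply: polybounded_mul; polybound
  | |- polybounded (fun m => expn _ _) => apply: polybounded_exp; polybound
  | |- polybounded (fun m => succn (@?g m)) =>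
      apply: (polybounded_add (f := fun=> 1%N) (g := g)); polybound
  | |- polybounded (fun m => for_bound _ _) => rewrite /for_bound; polybound
  | |- polybounded (fun m => ?f (@?g m)) => apply: (@polybounded_comp f g); polybound
  | |- polybounded (horner _) => exact: polybounded_horner
  | |- polybounded succn => exact: (polybounded_add (polybounded_const 1) polybounded_id)
  | |- polybounded (addn ?c) => exact: (polybounded_add (polybounded_const c) polybounded_id)
  | |- polybounded (muln ?c) => exact: (polybounded_mul (polybounded_const c) polybounded_id)
  | |- polybounded ?f => let c := head f in unfold c; polybound
  end.

Section cut_polynomial.
Variable R : realType.

Definition gap_mnm1 : multinom 3 := Multinom [tuple of [:: 2; 1; 1]%N].
Definition gap_mnm2 : multinom 3 := Multinom [tuple of [:: 1; 0; 2]%N].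

Definition gap_poly : mpoly 3 R :=
  64%:R *: mpolyX R gap_mnm1 + 16%:R *: mpolyX R gap_mnm2.

Lemma eval_gap_poly (x y z : R) :
  eval3 gap_poly x y z = 64 * x ^+ 2 * y * z + 16 * x * z ^+ 2.
Proof.
rewrite /eval3 /gap_poly mevalD !mevalZ !mevalX !big_ord_recl !big_ord0.
by rewrite !multinomE /tnth /= !expr1 expr0; ring.
Qed.

Lemma gap_poly_pos : pos_mpoly gap_poly.
Proof.
split.
  apply/eqP => h; have := eval_gap_poly 1 1 1.
  by rewrite h /eval3 meval0 !expr1n !mulr1 => /eqP; rewrite lt_eqF //; lra.
move=> m; rewrite mcoeff_msupp => h; rewrite lt_def h /=.
rewrite /gap_poly mcoeffD !mcoeffZ !mcoeffX.
by rewrite addr_ge0 // mulr_ge0 // ler0n.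
Qed.

End cut_polynomial.

(** * The algorithm *)

Definition threshold_expr : expr :=
  Bin Div (Bin Mul (Bin Mul (Bin Mul (Cst 4%:R) (Reg 0)) (Reg 5))
    (Bin Add (Reg 1) (Bin Mul (Reg 3) (Bin Add (Cst 1%:R) (Reg 5))))) (Reg 1).

Definition count_expr : expr :=
  Bin Mul (Bin Mul (Cst 12%:R) (Bin Mul (Reg 4) (Reg 4))) (Bin Mul (Reg 0) (Reg 7)).

Definition init_expr : expr :=
  Bin Add (Bin Defs.Sub (Cst 0) (Reg 5))
    (Bin Mul (Bin Mul (Bin Mul (Cst 2%:R) (Reg 0)) (Reg 5))
      (Bin Mul (Bin Leq (Reg 13) (Bin Add (Reg 12) (Cst 1%:R)))
               (Bin Leq (Bin Add (Reg 12) (Cst 1%:R)) (Reg 13)))).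

Definition InitLoop : cmd :=
  For 13 4 (Fill 3 12 0 (Bin Mul (Reg 13) (Reg 0)) init_expr).

Definition Setup (pR : {poly nat}) : cmd :=
  Seq (CallF 0 1) (Seq (Assign 4 (Bin Add (Reg 0) (Cst 1%:R)))
  (Seq (Assign 5 (horner_expr pR (Reg 0))) (Seq (Assign 6 threshold_expr)
  (Seq (LogLoop 7 8 6) (Seq (Assign 9 count_expr) (Seq InitLoop (Assign 10 (Cst 0)))))))).

Lemma input_bits_ge (d : nat) (a : 'rV[rat]_d) (eps L B : rat) (mu := input_bits a eps L B) :
  [/\ (d <= mu)%N, (vbits a <= mu)%N, (height eps <= mu)%N,
  (height L <= mu)%N & (height B <= mu)%N].
Proof.
have h1 := height_qbits eps; have h2 := height_qbits L; have h3 := height_qbits B.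
by rewrite /mu /input_bits; split; lia.
Qed.

Section bounds.
Variables pR pS pF pT : {poly nat}.

(** [sumn pR] dominates every coefficient of the polynomial, as [ev_horner] requires, and 70 exceeds
    the largest constant of the program, 64, with room for [d + 1]. *)
Definition input_bound mu : nat := (mu + 70 + sumn pR)%N.
Definition radius_bound mu : nat := (input_bound mu + pR.[mu] + pF.[mu] + 1)%N.
Definition threshold_bound mu : nat :=
  (radius_bound mu + 15 * (radius_bound mu + 1) + 1)%N.
Definition count_bound mu : nat := (12 * (1 + mu) ^ 2 * (mu * threshold_bound mu))%N.
Definition iterate_bound mu : nat :=
  (2 * mu * pR.[mu] + 1 + (64 * (1 + mu) ^ 3 + 3) * count_bound mu)%N.
Definition loop_bound mu : nat :=
  (threshold_bound mu + count_bound mu + iterate_bound mu + 1)%N.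

Definition setup_bound mu : nat :=
  (1 + mu + pT.[mu] + pF.[mu] + (ecost_bound 3 (input_bound mu) +
  (ecost_bound (esize (horner_expr pR (Reg 0))) (input_bound mu) +
  (ecost_bound 15 (radius_bound mu) + (log_bound (threshold_bound mu) +
  (ecost_bound 9 (threshold_bound mu) +
  (for_bound (threshold_bound mu) (fill_bound 3 21 (threshold_bound mu)) +
   ecost_bound 1 (input_bound mu))))))))%N.

Section setup.
Variables (d : nat) (O : oracles d) (a : 'rV[rat]_d) (eps L B : rat).
Hypothesis fbits : (vbits (feval O a) <= pF.[vbits a])%N.
Hypothesis ftim : (ftime O a <= pT.[d + vbits a])%N.

Notation mu := (input_bits a eps L B).
Notation rho := pR.[d].
Notation b0 := (input_bound mu).
Notation b1 := (radius_bound mu).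
Notation b2 := (threshold_bound mu).

Definition threshold : rat :=
  4%:R * d%:R * rho%:R * (eps + B * (1%:R + rho%:R)) / eps.

Lemma leq_b0 : (mu + 70 <= b0)%N. Proof. exact: leq_addr. Qed.

Lemma leq_b1 : (b0 + pR.[mu] + pF.[mu] < b1)%N. Proof. by rewrite /radius_bound addn1. Qed.

Lemma leq_b2 : (b1 < b2)%N. Proof. by rewrite /threshold_bound; lia. Qed.

Lemma rho_le : (rho <= pR.[mu])%N.
Proof. by apply: leq_horner; case: (@input_bits_ge d a eps L B). Qed.

Lemma runs_init_loop s b : reg s 0 = d%:R -> reg s 4 = d.+1%:R -> reg s 5 = rho%:R ->
  (d.+1 + 64 < b)%N -> (rho < b)%N ->
  runs O InitLoop s (fun s' => holds_matrix d s' (init_vertex d rho))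
    (for_bound b (fill_bound 3 21 b)).
Proof.
move=> r0 r4 r5 db rb.
pose I i s1 := forall i' j', (i' < i)%N -> (j' < d)%N ->
  Defs.mem s1 3%N (i' * d + j')%N = init_vertex d rho i' j'.
have nb : (d.+1 < b)%N by lia.
have db' : (d < b)%N by lia.
apply: runs_weaken (@runs_for d O I 13 4 d.+1 _ s b
  (fill_bound 3 21 b) r4 _ _ _ nb _ _) _ (leqnn _) => //.
- move=> i s1 i_n Ii fr r13.
  have r01 : reg s1 0 = d%:R by rewrite (proj1 fr).
  have r51 : reg s1 5 = rho%:R by rewrite (proj1 fr).
  apply: runs_weaken (@runs_fill d O 3 12 0 (Bin Mul (Reg 13) (Reg 0)) init_expr d
    (i * d) s1 b (fun j => init_vertex d rho i j) r01 isT db' _) _ (leqnn _).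
  + move=> j s2 jd fr2 r12 _.
    have e13 : evaluates_to s2 b (Reg 13) i%:R.
      by apply: ev_regnat; [rewrite (proj1 fr2)|lia].
    have e0 : evaluates_to s2 b (Reg 0) d%:R.
      by apply: ev_regnat; [rewrite (proj1 fr2)|lia].
    have e5 : evaluates_to s2 b (Reg 5) rho%:R.
      by apply: ev_regnat; [rewrite (proj1 fr2)|lia].
    have ej : evaluates_to s2 b (Bin Add (Reg 12) (Cst 1%:R)) j.+1%:R.
      apply: ev_eq (_ : j%:R + 1%:R = _); last by rewrite -natrD addn1.
      by apply: ev_add; [apply: ev_regnat => //; lia|apply: ev_nat; lia].
    have e13j := ev_leq e13 ej; have ej13 := ev_leq ej e13.
    rewrite ler_nat in e13j; rewrite ler_nat in ej13.
    split; first by apply: ev_eq (ev_mul e13 e0) _; rewrite natrM.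
    apply: ev_add; first by apply: (ev_sub _ e5); apply: (@ev_nat _ _ 0); lia.
    apply: (ev_mul _ (ev_mul e13j ej13)); apply: (ev_mul _ e5).
    by apply: (ev_mul _ e0); apply: ev_nat; lia.
  + move=> s2 [m2 _ _] i' j' i'n jd /=; rewrite m2.
    have [->|ne] := eqVneq i' i; first by rewrite leq_addr ltn_add2l jd addKn.
    rewrite row_index_other // Ii //.
    by move: i'n; rewrite ltnS leq_eqVlt (negbTE ne).
- by move=> s' [Is _] i j i_n jd; apply: Is.
Qed.

Lemma runs_setup :
  runs O (Setup pR) (init_state a eps L B)
    (fun s => [/\ persistent d (array_of a) (array_of (feval O a)) eps s,
       reg s 2 = L, holds_matrix d s (init_vertex d rho), reg s 10 = 0 &
       exists m, [/\ (m <= b2)%N, threshold < (2 ^ m)%:R &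
         reg s 9 = (12 * (1 + d) ^ 2 * (d * m))%:R]])
    (setup_bound mu).
Proof.
have [dmu amu emu Lmu Bmu] := @input_bits_ge d a eps L B.
have l0 := leq_b0; have l1 := leq_b1; have l2 := leq_b2; have lr := rho_le.
set s0 := init_state a eps L B.
have aE : get_array d s0 0 = a by apply/rowP => j; rewrite !mxE /= /upd /= array_ofE.
set s1 := set_array s0 1 (feval O a).
have R1 : runs O (CallF 0 1) s0 (fun s => s = s1) (1 + mu + pT.[mu] + pF.[mu])%N.
  exists s1, (1 + vbits a + ftime O a + vbits (feval O a))%N; split=> //.
    by have := @ExF d O 0 1 s0; rewrite aE.
  apply: leq_add; last by apply: leq_trans fbits _; exact: leq_horner.
  apply: leq_add; first by rewrite leq_add2l.
  by apply: leq_trans ftim _; apply: leq_horner; rewrite /input_bits; lia.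
apply: (runs_seq R1) => _ -> _.
have r1 k : reg s1 k = nth 0 [:: d%:R; eps; L; B] k by [].
have e4 : evaluates_to s1 b0 (Bin Add (Reg 0) (Cst 1%:R)) d.+1%:R.
  apply: ev_eq (_ : d%:R + 1%:R = _); last by rewrite -natrD addn1.
  by apply: ev_add; [apply: ev_regnat; [exact: r1|lia]|apply: ev_nat; lia].
apply: (runs_seq (@runs_assign _ O 4 _ _ (fun s => s = set_reg s1 4 d.+1%:R) _ _ e4 erefl)).
move=> _ -> _; set s2 := set_reg s1 4 _.
have e5 : evaluates_to s2 b0 (horner_expr pR (Reg 0)) rho%:R.
  apply: ev_horner; [by apply: ev_regnat; [exact: r1|lia]| |by lia].
  move=> c cp; have : (c <= sumn pR)%N.
    by elim: (pR : seq nat) cp => //= x l IH; rewrite inE => /predU1P[->|/IH]; lia.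
  by rewrite /input_bound; lia.
apply: (runs_seq (@runs_assign _ O 5 _ _ (fun s => s = set_reg s2 5 rho%:R) _ _ e5 erefl)).
move=> _ -> _; set s3 := set_reg s2 5 _.
have rb1 : (rho < b1)%N by lia.
have e0 : evaluates_to s3 b1 (Reg 0) d%:R by apply: ev_regnat; [exact: r1|lia].
have e1 : evaluates_to s3 b1 (Reg 1) eps by apply: ev_reg; [exact: r1|lia].
have e3 : evaluates_to s3 b1 (Reg 3) B by apply: ev_reg; [exact: r1|lia].
have e5' : evaluates_to s3 b1 (Reg 5) rho%:R by apply: ev_regnat.
have e6 : evaluates_to s3 b1 threshold_expr threshold.
  apply: (ev_div _ e1); apply: ev_mul.
    by apply: (ev_mul _ e5'); apply: (ev_mul _ e0); apply: ev_nat; lia.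
  apply: (ev_add e1); apply: (ev_mul e3); apply: (ev_add _ e5'); apply: ev_nat; lia.
have ht : (height threshold < b2)%N.
  apply: leq_ltn_trans (ev_height e6 : (_ <= 15 * (b1 + 1))%N) _.
  by rewrite /threshold_bound; lia.
move: {e6}(@runs_assign _ O 6 _ _ (fun s => s = set_reg s3 6 threshold) _ _ e6 erefl) => R6.
apply: (runs_seq R6) => _ -> _; set s4 := set_reg s3 6 _.
have e64 : reg s4 6 = threshold by [].
apply: (runs_seq (runs_log O e64 _ ht)) => //.
move=> s5 [[m r7 [mh hm]] _] fr5.
have mb2 : (m < b2)%N by apply: leq_ltn_trans ht.
have f0 : evaluates_to s5 b2 (Reg 0) d%:R.
  by apply: ev_regnat; [rewrite (proj1 fr5) //; exact: r1|lia].
have f4 : evaluates_to s5 b2 (Reg 4) d.+1%:R.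
  by apply: ev_regnat; [rewrite (proj1 fr5)|lia].
have f7 : evaluates_to s5 b2 (Reg 7) m%:R by apply: ev_regnat.
have f9 : evaluates_to s5 b2 count_expr (12 * (1 + d) ^ 2 * (d * m))%:R.
  apply: ev_eq (ev_mul (ev_mul (_ : evaluates_to s5 b2 (Cst 12%:R) 12%:R)
    (ev_mul f4 f4)) (ev_mul f0 f7)) _; first by apply: ev_nat; lia.
  by rewrite -expr2 -natrX -!natrM add1n.
apply: (runs_seq (@runs_assign _ O 9 _ _ (fun s => s = set_reg s5 9 _) _ _ f9 erefl)).
move=> _ -> _; set s6 := set_reg s5 9 _.
have q0 : reg s6 0 = d%:R by case: f0.
have q4 : reg s6 4 = d.+1%:R by case: f4.
have q5 : reg s6 5 = rho%:R by rewrite /= /upd /= (proj1 fr5).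
have db2 : (d.+1 + 64 < b2)%N by lia.
have rb2 : (rho < b2)%N by lia.
apply: (runs_seq (runs_init_loop q0 q4 q5 db2 rb2)) => s7 h7 fr7.
apply: (@runs_assign _ O _ _ _ _ b0 0); first by apply: (@ev_nat _ _ 0); lia.
have reg7 r : r \notin [:: 13; 12; 9; 7; 8; 10]%N -> reg (set_reg s7 10 0) r = reg s4 r.
  rewrite !inE !negb_or => /and5P[n13 n12 n9 n7 /andP[n8 n10]].
  have -> : reg (set_reg s7 10 0) r = reg s7 r by rewrite /= /upd (negbTE n10).
  have -> : reg s7 r = reg s6 r by apply: (proj1 fr7); rewrite /= !inE !negb_or n13 n12.
  have -> : reg s6 r = reg s5 r by rewrite /= /upd (negbTE n9).
  by apply: (proj1 fr5); rewrite /= !inE !negb_or n7 n8.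
have mem7 A : A != 3%N -> Defs.mem (set_reg s7 10 0) A = Defs.mem s1 A.
  move=> A3; have -> : Defs.mem (set_reg s7 10 0) A = Defs.mem s7 A by [].
  by rewrite (proj2 fr7) ?inE // (proj2 fr5).
split.
- split; rewrite ?reg7 ?mem7 //.
- by rewrite reg7.
- exact: h7.
- by [].
- exists m; split; [exact: ltnW|exact: hm|].
  by rewrite /= /upd /= (proj1 fr7) //= /upd.
Qed.

End setup.
End bounds.

Definition Program (pR : {poly nat}) : cmd := Seq (Setup pR) (Seq MainLoop Finish).

Section total_bound.
Variables pR pS pF pT : {poly nat}.

Definition point_bound mu : nat := centroid_height (loop_bound pR pF mu).
Definition value_bound mu : nat :=
  (point_bound mu + pF.[point_bits (point_bound mu)])%N.

Definition found_bound mu : nat :=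
  (step_vector_bound (point_bound mu) +
   ((1 + point_bits (point_bound mu) +
     pT.[(point_bound mu + point_bits (point_bound mu))%N] +
     pF.[point_bits (point_bound mu)]) + normalized_bound (value_bound mu)))%N.

Definition finish_bound mu : nat :=
  (ecost_bound 1 (point_bound mu) + found_bound mu + ecost_bound 1 (point_bound mu))%N.

Definition total_bound mu : nat :=
  (setup_bound pR pF pT mu + (main_bound pS (loop_bound pR pF mu) + finish_bound mu))%N.

Lemma polybounded_total : polybounded total_bound.
Proof.
polybound.
Qed.

End total_bound.

Lemma supnorm_normalized (d k : nat) (g : nat -> rat) : (k < d)%N ->
  (forall j, (j < d)%N -> `|g j| <= `|g k|) -> 0 < `|g k| ->
  supnorm (\row_(j < d) (g j / `|g k|)) = 1.
Proof.
move=> kd gk g0; apply/le_anti/andP; split.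
  apply/bigmax_leP; split=> // j _.
  by rewrite mxE normrM normfV normr_id ler_pdivrMr // mul1r gk.
apply: le_trans (le_bigmax _ _ (Ordinal kd)).
by rewrite mxE normrM normfV normr_id divff // gt_eqF.
Qed.

(** * Correctness and running time of the program *)

Section correctness.
Variables (R : realType) (pR pS pF pT : {poly nat}).
Variables (d : nat) (X : set 'rV[R]_d) (F : 'rV[R]_d -> 'rV[R]_d).
Variables (Rad : R) (L B : rat) (O : oracles d).
Hypotheses (convX : convex_set (X : set (convex_lmodType 'rV[R]_d))).
Hypotheses (ballX : eball 1 `<=` X) (Xball : X `<=` eball Rad).
Hypotheses (Rad_le : Rad <= (pR.[d])%:R) (sepX : separates X O) (sepO : sep_bits O pS).
Hypotheses (evF : evaluates X F O) (bitsF : feval_bits X O pF) (timeF : feval_time X O pT).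
Hypotheses (L0 : 0 < L) (lipF : elipschitz X F (ratr L)).
Hypotheses (B0 : 0 < B) (bndF : ebounded X F (ratr B)).
Variables (a : 'rV[rat]_d) (eps : rat).
Hypotheses (Xa : X (ratv R a)) (eps0 : 0 < eps).

Notation mu := (input_bits a eps L B).
Notation af := (array_of a).
Notation ff := (array_of (feval O a)).

Definition correct_output (s : state) : Prop :=
  match output d s with
  | SolvesSVI => eps_svi X F (ratr eps) (ratv R a)
  | Cut c =>
      supnorm c = 1 /\
      exists gamma : R,
        ratr eps ^+ 2 / eval3 (gap_poly R) Rad (ratr L) (ratr B) <= gamma /\
        forall x, mvi X F x ->
          dotv (ratv R c) x <= dotv (ratv R c) (ratv R a) - gamma
  end.

Lemma vecf_array_of (x : 'rV[rat]_d) : vecf d (array_of x) = x.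
Proof. by apply/rowP => j; rewrite mxE array_ofE. Qed.

Lemma FaE : F (ratv R a) = ratv R (vecf d ff).
Proof. by rewrite vecf_array_of evF. Qed.

Lemma improves_improving z : X (ratv R (vecf d z)) -> improves d af ff eps z ->
  improving X (F (ratv R a)) (ratv R a) (ratr eps) (ratv R (vecf d z)).
Proof.
move=> Xz; rewrite /improves -dotv_vecfB (vecf_array_of a) -(ltr_rat R) => h.
split=> //; rewrite FaE -ratvB dotv_ratv; apply: lt_le_trans h _.
by rewrite sub0r rmorphN fmorph_div /= ratr_nat.
Qed.

(** Membership of the point [y] comes first and apart from the cut, because value, bit length and
    time of the evaluation oracle are controlled on [X] only; it is needed before [F] is called at
    [y]. *)
Lemma cut_correct (z : nat -> rat) (c : 'rV[rat]_d) :
  let y := step_point d af z eps L in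
  let g := array_of (feval O (vecf d y)) in
  X (ratv R (vecf d z)) -> improves d af ff eps z ->
  X (ratv R (vecf d y)) /\
  forall k, (k < d)%N -> (forall j, (j < d)%N -> `|g j| <= `|g k|) ->
    c = \row_j (g j / `|g k|) ->
    supnorm c = 1 /\
      exists gamma : R,
        ratr eps ^+ 2 / eval3 (gap_poly R) Rad (ratr L) (ratr B) <= gamma /\
        forall x, mvi X F x ->
          dotv (ratv R c) x <= dotv (ratv R c) (ratv R a) - gamma.
Proof.
move=> y g Xz imp; have imp' := improves_improving Xz imp.
have eR : 0 < ratr eps :> R by rewrite ltr0q.
have LR : 0 < ratr L :> R by rewrite ltr0q.
have BR : 0 < ratr B :> R by rewrite ltr0q.
have [] := extragradient_cut convX Xball LR BR lipF bndF Xa eR imp'.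
set D := dotv (_ - _) _; set lam := Num.min _ _; set b := _ + _.
move=> Xb dec gap cut.
have lamE : ratr (step_length d af z eps L) = lam.
  have DE : ratr (\sum_(j < d) (z j - af j) * (z j - af j)) = D.
    rewrite /D -ratvB dotv_ratv; congr ratr.
    by apply: eq_bigr => j _; rewrite !mxE array_ofE.
  have tE : ratr (eps / (4%:R * L * \sum_(j < d) (z j - af j) * (z j - af j))) =
      ratr eps / (4 * ratr L * D).
    by rewrite fmorph_div rmorphM rmorphM /= DE ratr_nat.
  rewrite /step_length /lam minEle -tE; set t := eps / _.
  have -> : (1 <= ratr t :> R) = (1%:R <= t) by rewrite -(ler_rat R) rmorph1.
  by case: ifP => _; rewrite ?rmorph1.
have bE : b = ratv R (vecf d y).
  have -> : vecf d y = a + step_length d af z eps L *: (vecf d z - a).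
    by apply/rowP => j; rewrite !mxE /y /step_point array_ofE.
  by rewrite ratvD ratvZ ratvB lamE.
split; first by rewrite -bE.
move=> k kd gk cE.
have FbE : F b = ratv R (vecf d g) by rewrite vecf_array_of bE evF // -bE.
(* The strict inequality for [dotv (F b) (z - a)] excludes [F b = 0], so the normalization does not
   divide by 0. *)
have g0 : 0 < `|g k|.
  rewrite lt_def normr_ge0 andbT; apply/eqP => gk0.
  have G0 : F b = 0.
    rewrite FbE; apply/rowP => j; rewrite !mxE.
    have := gk _ (ltn_ord j); rewrite gk0 normr_le0 => /eqP ->.
    exact: rmorph0.
  by move: dec; rewrite G0 dotvC dotv0 ltxx.
have gR : 0 < ratr `|g k| :> R by rewrite ltr0q.
split; first by rewrite cE; exact: supnorm_normalized.
have gB : ratr `|g k| <= ratr B :> R.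
  apply: le_trans (bndF Xb); apply: le_trans (coord_le_enorm _ (Ordinal kd)).
  by rewrite FbE !mxE ratr_norm.
have D0 : 0 < D.
  rewrite /D lt_def dotv_ge0 andbT; apply/eqP => /dotv_eq0 h.
  by move: dec; rewrite h dotv0 ltxx.
have lam0 : 0 < lam by rewrite /lam lt_min ltr01 divr_gt0 // mulr_gt0 // mulr_gt0.
(* This is the gap for [F b] divided by its sup norm; that norm is at most [B], which gives the
   bound with [4 * B] from [extragradient_cut]. *)
exists (lam * ratr eps / 4 / ratr `|g k|); split.
  rewrite eval_gap_poly; apply: le_trans gap _.
  rewrite -[leRHS]mulrA -invfM; apply: ler_wpM2l; first by rewrite ltW // mulr_gt0.
  have g4 : 0 < 4 * ratr `|g k| :> R by rewrite mulr_gt0.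
  have B4 : 0 < 4 * ratr B :> R by rewrite mulr_gt0.
  by rewrite lef_pV2 // ler_pM2l.
move=> x mx.
have dE w : dotv (ratv R c) w = dotv (F b) w / ratr `|g k|.
  rewrite FbE /dotv mulr_suml; apply: eq_bigr => j _.
  by rewrite cE !mxE fmorph_div mulrAC.
by rewrite !dE -mulrBl ler_pM2r ?invr_gt0 // cut.
Qed.

Lemma svi_correct m v : threshold pR d eps B < (2 ^ m)%:R ->
  localized X af ff eps pR.[d] (12 * (1 + d) ^ 2 * (d * m)) v ->
  eps_svi X F (ratr eps) (ratv R a).
Proof.
move=> hm lv; split=> // x Xx.
(* In dimension 0 the inner product is an empty sum; [localized_svi] needs [0 < d]. *)
have [d0|d0] := posnP d.
  rewrite /dotv big1 ?oppr_le0 ?ler0q ?(ltW eps0) // => j _.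
  by have := ltn_ord j; rewrite {2}d0.
have Fb : enorm (ratv R (vecf d ff)) <= ratr B by rewrite -FaE; exact: bndF.
have S := @localized_svi R d X af ff eps pR.[d] Rad Xball Rad_le convX ballX B m v d0 eps0 B0.
by rewrite (vecf_array_of a) in S; rewrite FaE; exact: S Xa Fb hm lv x Xx.
Qed.

Lemma runs_program :
  runs O (Program pR) (init_state a eps L B) correct_output (total_bound pR pS pF pT mu).
Proof.
have fbits := bitsF Xa; have ftim := timeF Xa.
apply: (runs_seq (runs_setup pR eps L B fbits ftim)).
move=> s1 [ps r2 hs r10 [m [mb hm r9]]] _.
have [dmu amu emu Lmu Bmu] := @input_bits_ge d a eps L B.
set b3 := loop_bound pR pF mu.
pose N := (12 * (1 + d) ^ 2 * (d * m))%N.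
pose K := (64 * d.+1 ^ 3)%N.
pose P k v := dyadic d K (2 * d * pR.[d]) k v /\ localized X af ff eps pR.[d] k v.
have Nb : (N <= count_bound pR pF mu)%N.
  by rewrite /N /count_bound; apply: leq_mul;
    [rewrite leq_mul2l leq_exp2r // leq_add2l dmu|apply: leq_mul].
have Nb3 : (N < b3)%N by rewrite /b3 /loop_bound; lia.
have mu70 : (mu + 70 < b3)%N.
  rewrite /b3 /loop_bound /threshold_bound /radius_bound /input_bound; lia.
have vb3 : (vertex_height K (2 * d * pR.[d]) N <= b3)%N.
  apply: (@leq_trans (iterate_bound pR pF mu)); last by rewrite /b3 /loop_bound; lia.
  rewrite /vertex_height /iterate_bound; apply: leq_add.
    rewrite leq_add2r; apply: leq_mul; last exact: leq_horner.
    by rewrite leq_mul2l.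
  apply: leq_mul => //; rewrite leq_add2r leq_mul2l leq_exp2r //.
have db3 : (d.+1 + 64 < b3)%N by lia.
have eb3 : (height eps <= b3)%N by lia.
have Lb3 : (height L <= b3)%N by lia.
have ab3 j : (j < d)%N -> (height (af j) <= b3)%N.
  by move=> jd; have := height_array_of a jd; lia.
have fb3 j : (j < d)%N -> (height (ff j) <= b3)%N.
  move=> jd; have h1 := height_array_of (feval O a) jd.
  have h2 : (pF.[vbits a] <= pF.[mu])%N by apply: leq_horner.
  have h3 : (pF.[mu] <= b3)%N.
    by rewrite /b3 /loop_bound /threshold_bound /radius_bound; lia.
  by apply: leq_trans h1 (leq_trans fbits (leq_trans h2 h3)).
have P0 : P 0%N (init_vertex d pR.[d]).
  split; first exact: dyadic_init.
  have [d0 [w [_ hw]]|d0] := posnP d.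
    move: hw; rewrite /dotv big1 => [|j _]; last by have := ltn_ord j; rewrite {2}d0.
    have : 0 < ratr eps :> R by rewrite ltr0q.
    lra.
  apply: (@localized_init R d X af ff eps pR.[d] Rad Xball Rad_le d0).
  by rewrite -(ltr0n R) (lt_le_trans ltr01) // (le_trans (Rad_ge1 ballX Xball d0)).
have Pstep k v v' : P k v -> step O af ff eps v v' -> P k.+1 v'.
  move=> [p1 p2] st; split; first exact: dyadic_step p1 st.
  exact: localized_step p2 st.
have Pheight k v i j : (k <= N)%N -> P k v -> (i < d.+1)%N -> (j < d)%N ->
    (height (v i j) <= b3)%N.
  by move=> kN [p1 _] i_n jd; apply: leq_trans vb3; exact: dyadic_height p1 kN i_n jd.
apply: (runs_seq (@runs_main d O af ff eps pS b3 N P sepO db3 Nb3 eb3 ab3 fb3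
  Pstep Pheight s1 (init_vertex d pR.[d]) ps r9 r10 hs P0)) => s2 main fr2.
set b4 := point_bound pR pF mu.
have b34 : (b3 <= b4)%N := leq_addr _ _.
have ps2 := persistent_frame fr2 isT isT isT isT isT ps.
case: main => [[r1 [v [sN imp hz]]]|[r1 [v [_ lv]]]]; last first.
  apply: (runs_if (x := false) (b := b4)) => [||_] //.
    by apply: ev_reg => //; apply: (@height_nat 0); lia.
  apply: (@runs_assign _ O _ _ _ _ b4 0); first by apply: (@ev_nat _ _ 0); lia.
  exact: svi_correct hm lv.
apply: (runs_if (x := true) (b := b4)) => [|_|] //.
  by apply: ev_reg => //; apply: height_nat; lia.
pose z := centroid d v.
have Xz : X (ratv R (vecf d z)).
  by have := sepX (vecf d z); rewrite (sN : sep O (vecf d z) = None).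
pose y := step_point d af z eps L.
(* Only membership of [y] is extracted here. The cut is not computed yet, so [0] stands in its
   place. *)
have [Xy _] := @cut_correct z 0 Xz imp.
have d0 : (0 < d)%N.
  rewrite lt0n; apply/eqP => d0; move: imp; rewrite /improves big1.
    by apply/negP; rewrite -leNgt sub0r oppr_le0 divr_ge0 // ltW.
  by move=> j _; have := ltn_ord j; rewrite {2}d0.
have rg2 r : r \in [:: 0; 1; 2]%N -> reg s2 r = reg s1 r.
  by rewrite !inE => /or3P[]/eqP->; rewrite (proj1 fr2).
have r02 : reg s2 0 = d%:R := pers_d ps2.
have r12 : reg s2 1 = eps := pers_eps ps2.
have r22 : reg s2 2 = L by rewrite rg2.
have db4 : (d + 64 < b4)%N by lia.
have eb4 : (height eps <= b4)%N := leq_trans eb3 b34.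
have Lb4 : (height L <= b4)%N := leq_trans Lb3 b34.
have ab4 j : (j < d)%N -> (height (af j) <= b4)%N.
  by move=> jd; exact: leq_trans (ab3 j jd) b34.
have zb4 j : (j < d)%N -> (height (z j) <= b4)%N by move=> jd; case: (hz j jd).
have mz j : (j < d)%N -> Defs.mem s2 2%N j = z j by move=> jd; case: (hz j jd).
apply: (runs_seq (@runs_step_vector d O af z eps L b4 db4 eb4 Lb4 ab4 zb4 s2
  r02 r12 r22 (pers_a ps2) mz)) => s3 h7 fr3.
set E := point_bits b4; set c := value_bound pR pF mu.
have yE : get_array d s3 7 = vecf d y.
  by apply/rowP => j; rewrite !mxE; case: (h7 j (ltn_ord j)).
have yb : (vbits (vecf d y) <= E)%N.
  apply: leq_trans (@vbits_le d _ (10 * (length_height b4 + 1)) _) _.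
    by move=> j; rewrite mxE; case: (h7 j (ltn_ord j)).
  by rewrite /E /point_bits leq_mul2r; apply/orP; right; lia.
have gb : (vbits (feval O (vecf d y)) <= pF.[E])%N.
  by apply: leq_trans (bitsF Xy) _; exact: leq_horner.
set g := array_of (feval O (vecf d y)).
set s4 := set_array s3 8 (feval O (vecf d y)).
have R4 : runs O (CallF 7 8) s3 (fun s => s = s4)
    (1 + E + pT.[(b4 + E)%N] + pF.[E])%N.
  exists s4, (1 + vbits (vecf d y) + ftime O (vecf d y) + vbits (feval O (vecf d y)))%N.
  split=> //; first by have := @ExF d O 7 8 s3; rewrite yE.
  apply: leq_add gb; apply: leq_add; first by rewrite leq_add2l.
  apply: leq_trans (timeF Xy) _; apply: leq_horner; apply: leq_add yb; lia.
apply: (runs_seq R4) => _ -> fr4.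
have cd : (d + 64 < c)%N by apply: leq_trans db4 _; exact: leq_addr.
have gc j : (j < d)%N -> (height (g j) <= c)%N.
  move=> jd; apply: leq_trans (height_array_of _ jd) _.
  by apply: leq_trans gb _; exact: leq_addl.
have r04 : reg s4 0 = d%:R.
  have -> : reg s4 0 = reg s3 0 by [].
  by rewrite (proj1 fr3).
apply: runs_weaken (@runs_normalized d O g c cd gc s4 d0 r04 (fun j _ => erefl)) _
  (leqnn _) => s5 [r5 [k [kd gk m5]]].
have oE : output d s5 = Cut (get_array d s5 0) by rewrite /output r5.
rewrite /correct_output oE.
have [_ cutE] := @cut_correct z (get_array d s5 0) Xz imp.
apply: (cutE k kd gk); apply/rowP => j; rewrite !mxE; exact: m5.
Qed.

End correctness.

Theorem lemma1p6 (R : realType) :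
  exists q : mpoly 3 R, pos_mpoly q /\
  forall pR : {poly nat},
  exists P : cmd,
  forall pS pF pT : {poly nat},
  exists T : {poly nat},
  forall (d : nat) (X : set 'rV[R]_d) (F : 'rV[R]_d -> 'rV[R]_d)
    (Rad : R) (L B : rat) (O : oracles d),
    convex_set (X : set (convex_lmodType 'rV[R]_d)) -> compact X ->
    eball 1 `<=` X -> X `<=` eball Rad -> Rad <= (pR.[d])%:R ->
    separates X O -> sep_bits O pS ->
    evaluates X F O -> feval_bits X O pF -> feval_time X O pT ->
    0 < L -> elipschitz X F (ratr L) ->
    0 < B -> ebounded X F (ratr B) ->
  forall (a : 'rV[rat]_d) (eps : rat),
    X (ratv R a) -> 0 < eps ->
  exists (s : state) (t : nat),
    [/\ exec O P (init_state a eps L B) s t,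
        (t <= T.[input_bits a eps L B])%N &
        match output d s with
        | SolvesSVI => eps_svi X F (ratr eps) (ratv R a)
        | Cut c =>
            supnorm c = 1 /\
            exists gamma : R,
              ratr eps ^+ 2 / eval3 q Rad (ratr L) (ratr B) <= gamma /\
              forall x, mvi X F x ->
                dotv (ratv R c) x <= dotv (ratv R c) (ratv R a) - gamma
        end].
Proof.
exists (gap_poly R); split; first exact: gap_poly_pos.
move=> pR; exists (Program pR) => pS pF pT.
have [T hT] := polybounded_total pR pS pF pT.
exists T => d X F Rad L B O cX _ bX Xb Rl sX sO evF bF tF L0 lF B0 bndF a eps Xa e0.
have [s [t [ex ht cs]]] := runs_program cX bX Xb Rl sX sO evF bF tF L0 lF B0 bndF Xa e0.
by exists s, t; split=> //; exact: leq_trans ht (hT _).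
Qed.
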